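(* Let $M,N$ be networks of the calculus CaIT with $M\approx N$. Then $M\cong N$.
   Context: The calculus CaIT. Fix a set of locations with a distance $d(h,k)\in\mathbb N$ between locations, a constant $\delta\in\mathbb N$, and a function $\mathrm{rng}$ giving each channel $c$ a range $\mathrm{rng}(c)\in\mathbb N\cup\{-1,\infty\}$. Values $v,w$ include basic values, sensor/actuator values and locations; boolean guards $b$ are decidable. Processes: $P,Q::=\mathsf{nil}\mid \rho.P\mid P\parallel Q\mid \lfloor\pi.P\rfloor Q\mid [b]P;Q\mid X\mid \mathsf{fix}\,X.P$ with $\rho\in\{\sigma,\ @(x),\ s?(x),\ a!v\}$ ($s$ a sensor, $a$ an actuator) and $\pi\in\{\overline{c}\langle v\rangle,\ c(x)\}$. The variable $x$ is bound in $c(x).P$, $s?(x).P$, $@(x).P$ and $X$ in $\mathsf{fix}X.P$; in $\sigma.Q$ and $\lfloor\pi.P\rfloor Q$ the occurrence of $Q$ is time-guarded, and in $\mathsf{fix}X.P$ all occurrences of $X$ must be time-guarded. Networks: $M,N::=\mathbf 0\mid n[\mathcal I\bowtie P]^{\mu}_{h}\mid M\mid N\mid (\nu c)M$, where $n$ is a node name, $\mathcal I$ a partial map from sensor and actuator names to values (physical interface), $\mu\in\{\mathsf s,\mathsf m\}$ (stationary/mobile) and $h$ a location. Sensors are node-dependent or location-dependent. Networks are closed and well-formed: node names are distinct; distinct nodes have distinct actuators and distinct node-dependent sensors; if $P$ in $n[\mathcal I\bowtie P]^\mu_h$ contains $s?(x)$ (resp. $a!v$) then $\mathcal I(s)$ (resp.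 $\mathcal I(a)$) is defined; a node whose interface defines a location-dependent sensor is stationary. $\prod$ denotes iterated parallel composition, with empty product $\mathsf{nil}$ or $\mathbf 0$; $T\{v/x\}$ is substitution. Structural congruence $\equiv$ is the least congruence with: $\parallel$ commutative, associative, unit $\mathsf{nil}$; $[b]P;Q\equiv P$ if $b$ true, $\equiv Q$ if $b$ false; $\mathsf{fix}X.P\equiv P\{\mathsf{fix}X.P/X\}$; $P\equiv Q$ implies $n[\mathcal I\bowtie P]^\mu_h\equiv n[\mathcal I\bowtie Q]^\mu_h$; network $\mid$ commutative, associative, unit $\mathbf 0$; $(\nu c)\mathbf 0\equiv\mathbf 0$; $(\nu c)(\nu d)M\equiv(\nu d)(\nu c)M$; $(\nu c)(M\mid N)\equiv M\mid(\nu c)N$ if $c$ not in $M$. Reduction relations $\to_\tau$, $\to_a$ ($a$ an actuator), $\to_\sigma$ are the least relations closed under: (pos) $n[\mathcal I\bowtie @(x).P]^\mu_h\to_\tau n[\mathcal I\bowtie P\{h/x\}]^\mu_h$; (sensread) if $\mathcal I(s)=v$, $n[\mathcal I\bowtie s?(x).P]^\mu_h\to_\tau n[\mathcal I\bowtie P\{v/x\}]^\mu_h$; (actunchg) if $\mathcal I(a)=v$, $n[\mathcal I\bowtie a!v.P]^\mu_h\to_\tau n[\mathcal I\bowtie P]^\mu_h$; (actchg) if $\mathcal I(a)\ne v$, $n[\mathcal I\bowtie a!v.P]^\mu_h\to_a n[\mathcal I[a\mapsto v]\bowtie P]^\mu_h$; (loccom) if $\mathrm{rng}(c)=-1$, $n[\mathcal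 I\bowtie \lfloor\overline c\langle v\rangle.P\rfloor R\parallel\lfloor c(x).Q\rfloor S]^\mu_h\to_\tau n[\mathcal I\bowtie P\parallel Q\{v/x\}]^\mu_h$; (timestat) if $N=n[\mathcal I\bowtie \prod_i\lfloor\pi_i.P_i\rfloor Q_i\parallel\prod_j\sigma.R_j]^{\mathsf s}_h$ has no $\to_\tau$ reduction then $N\to_\sigma n[\mathcal I\bowtie\prod_iQ_i\parallel\prod_jR_j]^{\mathsf s}_h$; (timemob) likewise for $\mu=\mathsf m$, with result located at any $k$ with $d(h,k)\le\delta$; (glbcom) if $d(h,k)\le\mathrm{rng}(c)$, $n[\mathcal I\bowtie\lfloor\overline c\langle v\rangle.P\rfloor R]^{\mu_1}_h\mid m[\mathcal J\bowtie\lfloor c(x).Q\rfloor S]^{\mu_2}_k\to_\tau n[\mathcal I\bowtie P]^{\mu_1}_h\mid m[\mathcal J\bowtie Q\{v/x\}]^{\mu_2}_k$; (parp) for $\omega\in\{\tau,a\}$, if $\prod_i n_i[\mathcal I_i\bowtie P_i]^{\mu_i}_{h_i}\to_\omega\prod_i n_i[\mathcal I'_i\bowtie P'_i]^{\mu'_i}_{h'_i}$ then $\prod_i n_i[\mathcal I_i\bowtie P_i\parallel Q_i]^{\mu_i}_{h_i}\to_\omega\prod_i n_i[\mathcal I'_i\bowtie P'_i\parallel Q_i]^{\mu'_i}_{h'_i}$; (parn) for $\omega\in\{\tau,a\}$, $M\to_\omega M'$ implies $M\mid N\to_\omega M'\mid N$; (timepar) $M\to_\sigma M'$, $N\to_\sigma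 N'$ and $M\mid N$ has no $\to_\tau$ reduction imply $M\mid N\to_\sigma M'\mid N'$; (timezero) $\mathbf 0\to_\sigma\mathbf 0$; (res) $M\to_\omega N$ implies $(\nu c)M\to_\omega(\nu c)N$ for $\omega\in\{\tau,a,\sigma\}$; (struct) $M\equiv N\to_\omega N'\equiv M'$ implies $M\to_\omega M'$. Let $\to\;=\;\to_\tau\cup\to_\sigma$, with reflexive–transitive closure $\to^*$. Reduction barbed congruence. Barb: $M\downarrow_{a!v@h}$ iff $M\equiv(\nu\tilde g)(n[\mathcal I\bowtie P]^\mu_h\mid M')$ with $\mathcal I(a)=v$; $M\Downarrow_{a!v@h}$ iff $M\to^* M''$ with $M''\downarrow_{a!v@h}$. Sensor update: $n[\mathcal I\bowtie P]^\mu_h[s@h\mapsto v]=n[\mathcal I[s\mapsto v]\bowtie P]^\mu_h$ if $\mathcal I(s)$ is defined; a node is unchanged if $\mathcal I(s)$ is undefined or it is located at $k\ne h$; the update distributes over $\mid$ and $(\nu c)$, and $\mathbf 0[s@h\mapsto v]=\mathbf 0$. A relation $\mathcal R$ on networks is barb preserving if $M\,\mathcal R\,N$ and $M\downarrow_{a!v@h}$ imply $N\Downarrow_{a!v@h}$; reduction closed if $M\,\mathcal R\,N$ implies (i) $M\to M'$ gives $N\to^*N'$ with $M'\,\mathcal R\,N'$ and (ii) $M\to_a M'$ gives $N\to^*\to_a\to^*N'$ with $M'\,\mathcal R\,N'$; contextual if $M\,\mathcal R\,N$ implies $M\mid O\;\mathcal R\;N\mid O$ for all networks $O$, $(\nu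 c)M\;\mathcal R\;(\nu c)N$ for all channels $c$, and $M[s@h\mapsto v]\;\mathcal R\;N[s@h\mapsto v]$ for all sensors $s$, locations $h$ and values $v$ in the domain of $s$. $\cong$ is the largest symmetric relation on networks that is reduction closed, barb preserving and contextual. Labelled (intensional) semantics. Process transitions $P\xrightarrow{\lambda}P'$, $\lambda\in\{\sigma,\tau,\overline cv,cv,@h,s?v,a!v\}$, with $[b]P;Q$ identified with $P$ if $b$ is true and with $Q$ otherwise, are the least relation closed under: $\lfloor\overline c\langle v\rangle.P\rfloor Q\xrightarrow{\overline cv}P$; $\lfloor c(x).P\rfloor Q\xrightarrow{cv}P\{v/x\}$ (any $v$); $s?(x).P\xrightarrow{s?v}P\{v/x\}$ (any $v$); $a!v.P\xrightarrow{a!v}P$; $@(x).P\xrightarrow{@h}P\{h/x\}$ (any $h$); if $P\xrightarrow{\overline cv}P'$, $Q\xrightarrow{cv}Q'$ and $\mathrm{rng}(c)=-1$ then $P\parallel Q\xrightarrow{\tau}P'\parallel Q'$ and $Q\parallel P\xrightarrow{\tau}Q'\parallel P'$; if $P\xrightarrow{\lambda}P'$ with $\lambda\ne\sigma$ then $P\parallel Q\xrightarrow{\lambda}P'\parallel Q$ and $Q\parallel P\xrightarrow{\lambda}Q\parallel P'$; if $P\{\mathsf{fix}X.P/X\}\xrightarrow{\lambda}Q$ then $\mathsf{fix}X.P\xrightarrow{\lambda}Q$; $\mathsf{nil}\xrightarrow{\sigma}\mathsf{nil}$; $\sigma.P\xrightarrow{\sigma}P$; $\lfloor\pi.P\rfloor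 Q\xrightarrow{\sigma}Q$; if $P\xrightarrow{\sigma}P'$, $Q\xrightarrow{\sigma}Q'$ and $P\parallel Q$ has no $\tau$-transition then $P\parallel Q\xrightarrow{\sigma}P'\parallel Q'$. Network transitions $M\xrightarrow{\nu}M'$, $\nu\in\{\sigma,\tau,a,\overline cv@h,cv@h\}$, are the least relation closed under (for a node $n[\mathcal I\bowtie P]^\mu_h$): if $P\xrightarrow{@h}P'$ then node $\xrightarrow{\tau}n[\mathcal I\bowtie P']^\mu_h$; if $\mathcal I(s)=v$ and $P\xrightarrow{s?v}P'$ then node $\xrightarrow{\tau}n[\mathcal I\bowtie P']^\mu_h$; if $\mathcal I(a)=v$ and $P\xrightarrow{a!v}P'$ then node $\xrightarrow{\tau}n[\mathcal I\bowtie P']^\mu_h$; if $\mathcal I(a)\ne v$ and $P\xrightarrow{a!v}P'$ then node $\xrightarrow{a}n[\mathcal I[a\mapsto v]\bowtie P']^\mu_h$; if $P\xrightarrow{\tau}P'$ then node $\xrightarrow{\tau}n[\mathcal I\bowtie P']^\mu_h$; if $P\xrightarrow{\sigma}P'$ and the node has no $\tau$-transition then $n[\mathcal I\bowtie P]^{\mathsf s}_h\xrightarrow{\sigma}n[\mathcal I\bowtie P']^{\mathsf s}_h$ and $n[\mathcal I\bowtie P]^{\mathsf m}_h\xrightarrow{\sigma}n[\mathcal I\bowtie P']^{\mathsf m}_k$ for every $k$ with $d(h,k)\le\delta$; if $P\xrightarrow{\overline cv}P'$ (resp. $\xrightarrow{cv}$) and $\mathrm{rng}(c)\ge0$ then node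 $\xrightarrow{\overline cv@h}$ (resp. $\xrightarrow{cv@h}$) $n[\mathcal I\bowtie P']^\mu_h$; if $M\xrightarrow{\overline cv@k}M'$, $N\xrightarrow{cv@h}N'$ and $d(h,k)\le\mathrm{rng}(c)$ then $M\mid N\xrightarrow{\tau}M'\mid N'$ and $N\mid M\xrightarrow{\tau}N'\mid M'$; if $M\xrightarrow{\nu}M'$, $\nu\ne\sigma$, then $M\mid N\xrightarrow{\nu}M'\mid N$ and $N\mid M\xrightarrow{\nu}N\mid M'$; if $M\xrightarrow{\sigma}M'$, $N\xrightarrow{\sigma}N'$ and $M\mid N$ has no $\tau$-transition then $M\mid N\xrightarrow{\sigma}M'\mid N'$; $\mathbf 0\xrightarrow{\sigma}\mathbf 0$; if $M\xrightarrow{\nu}N$ and $\nu$ is not of the form $\overline cv@h$ or $cv@h$ then $(\nu c)M\xrightarrow{\nu}(\nu c)N$. Extensional semantics: the transitions labelled $\tau,\sigma,a$ are those above; in addition (i) if $M\xrightarrow{\overline cv@h}M'$ and $d(h,k)\le\mathrm{rng}(c)$ then $M\xrightarrow{\overline cv\triangleright k}M'$; (ii) if $M\xrightarrow{cv@h}M'$ and $d(k,h)\le\mathrm{rng}(c)$ then $M\xrightarrow{cv\triangleleft k}M'$; (iii) for every sensor $s$, location $h$ and $v$ in the domain of $s$, $M\xrightarrow{s?v@h}M[s@h\mapsto v]$; (iv) if $M\downarrow_{a!v@h}$ then $M\xrightarrow{a!v@h}M$. Let $\alpha$ range over extensional labels. $\Rightarrow$ is $(\xrightarrow{\tau})^*$,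 $\xRightarrow{\alpha}$ is $\Rightarrow\xrightarrow{\alpha}\Rightarrow$, and $\xRightarrow{\hat\alpha}$ is $\Rightarrow$ if $\alpha=\tau$ and $\xRightarrow{\alpha}$ otherwise. A symmetric relation $\mathcal R$ is a bisimulation if $M\,\mathcal R\,N$ and $M\xrightarrow{\alpha}M'$ imply $N\xRightarrow{\hat\alpha}N'$ with $M'\,\mathcal R\,N'$; $\approx$ is the union of all bisimulations.
   Formalization: Interfaces are required to map each sensor to a value in that sensor's domain (the claim fails otherwise); distance is symmetric, names and locations have decidable equality, and every channel has unboundedly many fresh channels of the same range for alpha-conversion. *)

(* Defs.v *)
From HB Require Import structures.
From mathcomp Require Import all_boot.
From Stdlib Require List.
From Stdlib Require Import Relation_Operators.

Set Implicit Arguments.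
Unset Strict Implicit.
Unset Printing Implicit Defensive.

(* Ranges of channels, [N + {-1, oo}]; [RLocal] is [-1]. *)
Inductive range := RLocal | RFin of nat | RInf.

Definition within (d : nat) (r : range) : bool :=
  match r with RLocal => false | RFin n => d <= n | RInf => true end.

Definition nonneg_range (r : range) : bool :=
  if r is RLocal then false else true.

Inductive value (B D L : Type) := VBasic of B | VDevice of D | VLoc of L.
Arguments VBasic {B D L}.
Arguments VDevice {B D L}.
Arguments VLoc {B D L}.

(* [geval] interprets the (decidable) predicate symbols from which guards are
   built.  [chan_fresh] says that every channel can be alpha-converted, outside
   any finite set of names, to one with the same range. *)
Record cait := Cait {
  loc : eqType;
  chan : eqType;
  nodename : eqType;
  sensor : eqType;
  actuator : eqType;
  basic : Type;
  device : Type;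
  gsym : Type;
  geval : gsym -> seq (value basic device loc) -> bool;
  dist : loc -> loc -> nat;
  dist_sym : forall h k, dist h k = dist k h;
  delta : nat;
  rng : chan -> range;
  chan_fresh : forall (c : chan) (l : seq chan),
    exists2 d, d \notin l & rng d = rng c;
  locdep : pred sensor;
  sdom : sensor -> value basic device loc -> Prop
}.

Inductive mobility := Stationary | Mobile.

Section Calculus.

Variable S : cait.

Local Notation loc := (loc S).
Local Notation chan := (chan S).
Local Notation nodename := (nodename S).
Local Notation sensor := (sensor S).
Local Notation actuator := (actuator S).

Definition val := value (basic S) (device S) loc.

(* Value variables and process variables are two separate families of
   de Bruijn indices. *)
Inductive vexp := Val of val | Var of nat.

Record guard := Guard { gpred : gsym S; gargs : seq vexp }.

Definition guard_is (b : guard) (t : bool) : Prop :=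
  exists2 vs, gargs b = map Val vs & geval (gpred b) vs = t.

Inductive ipre :=
  | ISigma
  | IPos                          (* @(x), binder *)
  | ISens of sensor               (* s?(x), binder *)
  | IAct of actuator & vexp.      (* a!v *)

Inductive cpre :=
  | COut of chan & vexp           (* c<v> *)
  | CIn of chan.                  (* c(x), binder *)

Inductive proc :=
  | PNil
  | PPref of ipre & proc          (* rho.P *)
  | PPar of proc & proc
  | PTout of cpre & proc & proc   (* |_pi.P_|Q : [pi] binds in [P] only *)
  | PCond of guard & proc & proc  (* [b]P;Q *)
  | PVar of nat
  | PFix of proc.

(* Number of value variables bound by a prefix. *)
Definition ibind (r : ipre) : nat :=
  match r with IPos | ISens _ => 1 | _ => 0 end.
Definition cbind (p : cpre) : nat := if p is CIn _ then 1 else 0.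

Definition imapE (f : vexp -> vexp) (r : ipre) : ipre :=
  if r is IAct a e then IAct a (f e) else r.
Definition cmapE (f : vexp -> vexp) (p : cpre) : cpre :=
  if p is COut c e then COut c (f e) else p.
Definition gmapE (f : vexp -> vexp) (b : guard) : guard :=
  Guard (gpred b) (map f (gargs b)).

(* Applies [f i] to the value expressions lying below [i - k] value binders. *)
Fixpoint pmapE (f : nat -> vexp -> vexp) (k : nat) (P : proc) : proc :=
  match P with
  | PNil => PNil
  | PPref r P => PPref (imapE (f k) r) (pmapE f (ibind r + k) P)
  | PPar P Q => PPar (pmapE f k P) (pmapE f k Q)
  | PTout p P Q =>
      PTout (cmapE (f k) p) (pmapE f (cbind p + k) P) (pmapE f k Q)
  | PCond b P Q => PCond (gmapE (f k) b) (pmapE f k P) (pmapE f k Q)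
  | PVar X => PVar X
  | PFix P => PFix (pmapE f k P)
  end.

Definition eshift (k : nat) (e : vexp) : vexp :=
  if e is Var i then Var (bump k i) else e.
Definition esubst (v : val) (k : nat) (e : vexp) : vexp :=
  if e is Var i then (if i == k then Val v else Var (unbump k i)) else e.

Definition vshift (P : proc) : proc := pmapE eshift 0 P.

(* [P{v/x}], where [x] is the outermost value variable of [P]. *)
Definition vsubst (v : val) (P : proc) : proc := pmapE (esubst v) 0 P.

Fixpoint pshift (k : nat) (P : proc) : proc :=
  match P with
  | PNil => PNil
  | PPref r P => PPref r (pshift k P)
  | PPar P Q => PPar (pshift k P) (pshift k Q)
  | PTout p P Q => PTout p (pshift k P) (pshift k Q)
  | PCond b P Q => PCond b (pshift k P) (pshift k Q)
  | PVar X => PVar (bump k X)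
  | PFix P => PFix (pshift k.+1 P)
  end.

(* [P{R/X}] for the process variable [X] of index [k]. *)
Fixpoint psubst (k : nat) (R P : proc) : proc :=
  match P with
  | PNil => PNil
  | PPref r P => PPref r (psubst k (iter (ibind r) vshift R) P)
  | PPar P Q => PPar (psubst k R P) (psubst k R Q)
  | PTout p P Q =>
      PTout p (psubst k (iter (cbind p) vshift R) P) (psubst k R Q)
  | PCond b P Q => PCond b (psubst k R P) (psubst k R Q)
  | PVar X => if X == k then R else PVar (unbump k X)
  | PFix P => PFix (psubst k.+1 (pshift 0 R) P)
  end.

Definition unfold_fix (P : proc) : proc := psubst 0 (PFix P) P.

Fixpoint tguarded (X : nat) (P : proc) : bool :=
  match P with
  | PNil => true
  | PPref ISigma _ => true
  | PPref _ P => tguarded X P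
  | PPar P Q => tguarded X P && tguarded X Q
  | PTout _ P _ => tguarded X P
  | PCond _ P Q => tguarded X P && tguarded X Q
  | PVar Y => Y != X
  | PFix P => tguarded X.+1 P
  end.

Fixpoint proc_ok (P : proc) : bool :=
  match P with
  | PNil | PVar _ => true
  | PPref _ P => proc_ok P
  | PPar P Q | PTout _ P Q | PCond _ P Q => proc_ok P && proc_ok Q
  | PFix P => tguarded 0 P && proc_ok P
  end.

Definition escoped (m : nat) (e : vexp) : bool :=
  if e is Var i then i < m else true.

(* Free process variables are below [k] and free value variables below [m]. *)
Fixpoint pscoped (k m : nat) (P : proc) : bool :=
  match P with
  | PNil => true
  | PPref r P =>
      (if r is IAct _ e then escoped m e else true) && pscoped k (ibind r + m) P
  | PPar P Q => pscoped k m P && pscoped k m Q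
  | PTout p P Q =>
      [&& (if p is COut _ e then escoped m e else true),
          pscoped k (cbind p + m) P & pscoped k m Q]
  | PCond b P Q => [&& all (escoped m) (gargs b), pscoped k m P & pscoped k m Q]
  | PVar X => X < k
  | PFix P => pscoped k.+1 m P
  end.

Definition pclosed (P : proc) : bool := pscoped 0 0 P.

Fixpoint has_ipre (p : ipre -> bool) (P : proc) : bool :=
  match P with
  | PNil | PVar _ => false
  | PPref r P => p r || has_ipre p P
  | PPar P Q | PTout _ P Q | PCond _ P Q => has_ipre p P || has_ipre p Q
  | PFix P => has_ipre p P
  end.

Definition reads (s : sensor) : proc -> bool :=
  has_ipre (fun r => if r is ISens t then t == s else false).
Definition writes (a : actuator) : proc -> bool :=
  has_ipre (fun r => if r is IAct b _ then b == a else false).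

Definition cmapC (f : chan -> chan) (p : cpre) : cpre :=
  match p with COut c e => COut (f c) e | CIn c => CIn (f c) end.

Fixpoint pmapC (f : chan -> chan) (P : proc) : proc :=
  match P with
  | PNil => PNil
  | PPref r P => PPref r (pmapC f P)
  | PPar P Q => PPar (pmapC f P) (pmapC f Q)
  | PTout p P Q => PTout (cmapC f p) (pmapC f P) (pmapC f Q)
  | PCond b P Q => PCond b (pmapC f P) (pmapC f Q)
  | PVar X => PVar X
  | PFix P => PFix (pmapC f P)
  end.

Definition cchan (p : cpre) : chan := match p with COut c _ | CIn c => c end.

Fixpoint pchans (P : proc) : seq chan :=
  match P with
  | PNil | PVar _ => [::]
  | PPref _ P | PFix P => pchans P
  | PPar P Q | PCond _ P Q => pchans P ++ pchans Q
  | PTout p P Q => cchan p :: pchans P ++ pchans Q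
  end.

Record iface := Iface {
  isens : sensor -> option val;
  iact : actuator -> option val
}.

Definition upd_sens (I : iface) (s : sensor) (v : val) : iface :=
  Iface (fun t => if t == s then Some v else isens I t) (iact I).
Definition upd_act (I : iface) (a : actuator) (v : val) : iface :=
  Iface (isens I) (fun b => if b == a then Some v else iact I b).

Record nodeT := MkNode {
  nname : nodename;
  niface : iface;
  nproc : proc;
  nmob : mobility;
  nloc : loc
}.

Inductive net :=
  | NZero
  | NNode of nodeT
  | NPar of net & net
  | NRes of chan & net.

Definition Node n I P mu h : net := NNode (MkNode n I P mu h).

Fixpoint nodes (M : net) : seq nodeT :=
  match M with
  | NZero => [::]
  | NNode x => [:: x]
  | NPar M N => nodes M ++ nodes N
  | NRes _ M => nodes M
  end.

Fixpoint nfree (M : net) : seq chan :=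
  match M with
  | NZero => [::]
  | NNode x => pchans (nproc x)
  | NPar M N => nfree M ++ nfree N
  | NRes c M => [seq d <- nfree M | d != c]
  end.

(* Renames all channels, including the binding occurrences. *)
Fixpoint nmapC (f : chan -> chan) (M : net) : net :=
  match M with
  | NZero => NZero
  | NNode x =>
      Node (nname x) (niface x) (pmapC f (nproc x)) (nmob x) (nloc x)
  | NPar M N => NPar (nmapC f M) (nmapC f N)
  | NRes c M => NRes (f c) (nmapC f M)
  end.

Definition cswap (c d e : chan) : chan :=
  if e == c then d else if e == d then c else e.

(* The last clause is the requirement that a physical interface assigns to
   each of its sensors a value in the domain of that sensor. *)
Definition node_ok (x : nodeT) : Prop :=
  [/\ pclosed (nproc x) && proc_ok (nproc x),
      forall s, reads s (nproc x) -> isens (niface x) s <> None,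
      forall a, writes a (nproc x) -> iact (niface x) a <> None,
      forall s, locdep s -> isens (niface x) s <> None -> nmob x = Stationary
    & forall s v, isens (niface x) s = Some v -> sdom s v].

Definition network (M : net) : Prop :=
  [/\ forall x, List.In x (nodes M) -> node_ok x,
      uniq (map nname (nodes M)),
      forall x y a, List.In x (nodes M) -> List.In y (nodes M) ->
        nname x <> nname y ->
        iact (niface x) a <> None -> iact (niface y) a = None
    & forall x y s, List.In x (nodes M) -> List.In y (nodes M) ->
        nname x <> nname y -> ~~ locdep s ->
        isens (niface x) s <> None -> isens (niface y) s = None].

(* In both congruences, transitivity is the only rule with a term that does not
   occur in the conclusion; its side condition keeps derivations within
   processes with time-guarded recursion, resp. within networks. *)
Inductive pcong : proc -> proc -> Prop :=
  | pc_refl P : pcong P P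
  | pc_sym P Q : pcong P Q -> pcong Q P
  | pc_trans P R Q : proc_ok R -> pcong P R -> pcong R Q -> pcong P Q
  | pc_pref r P Q : pcong P Q -> pcong (PPref r P) (PPref r Q)
  | pc_par P P' Q Q' : pcong P P' -> pcong Q Q' -> pcong (PPar P Q) (PPar P' Q')
  | pc_tout p P P' Q Q' :
      pcong P P' -> pcong Q Q' -> pcong (PTout p P Q) (PTout p P' Q')
  | pc_cond b P P' Q Q' :
      pcong P P' -> pcong Q Q' -> pcong (PCond b P Q) (PCond b P' Q')
  | pc_fix P Q : pcong P Q -> pcong (PFix P) (PFix Q)
  | pc_parC P Q : pcong (PPar P Q) (PPar Q P)
  | pc_parA P Q R : pcong (PPar P (PPar Q R)) (PPar (PPar P Q) R)
  | pc_par0 P : pcong (PPar P PNil) P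
  | pc_true b P Q : guard_is b true -> pcong (PCond b P Q) P
  | pc_false b P Q : guard_is b false -> pcong (PCond b P Q) Q
  | pc_unfold P : pcong (PFix P) (unfold_fix P).

Inductive ncong : net -> net -> Prop :=
  | nc_refl M : ncong M M
  | nc_sym M N : ncong M N -> ncong N M
  | nc_trans M O N : network O -> ncong M O -> ncong O N -> ncong M N
  | nc_par M M' N N' : ncong M M' -> ncong N N' -> ncong (NPar M N) (NPar M' N')
  | nc_res c M N : ncong M N -> ncong (NRes c M) (NRes c N)
  | nc_node n I P Q mu h : pcong P Q -> ncong (Node n I P mu h) (Node n I Q mu h)
  | nc_parC M N : ncong (NPar M N) (NPar N M)
  | nc_parA M N O : ncong (NPar M (NPar N O)) (NPar (NPar M N) O)
  | nc_par0 M : ncong (NPar M NZero) M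
  | nc_res0 c : ncong (NRes c NZero) NZero
  | nc_resC c d M : ncong (NRes c (NRes d M)) (NRes d (NRes c M))
  | nc_extr c M N :
      c \notin nfree M -> ncong (NRes c (NPar M N)) (NPar M (NRes c N))
  | nc_alpha c d M :   (* alpha-conversion, which must preserve ranges *)
      d \notin nfree M -> rng d = rng c ->
      ncong (NRes c M) (NRes d (nmapC (cswap c d) M)).

Definition scong (M N : net) : Prop := [/\ network M, network N & ncong M N].

Definition pprod (k : nat) (F : 'I_k -> proc) : proc :=
  \big[PPar/PNil]_(i < k) F i.
Definition nprod (k : nat) (F : 'I_k -> net) : net :=
  \big[NPar/NZero]_(i < k) F i.

Inductive ract := RTau | RAct of actuator.

Inductive red : ract -> net -> net -> Prop :=
  | red_pos n I P mu h :
      red RTau (Node n I (PPref IPos P) mu h)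
               (Node n I (vsubst (VLoc h) P) mu h)
  | red_sensread n I s v P mu h :
      isens I s = Some v ->
      red RTau (Node n I (PPref (ISens s) P) mu h) (Node n I (vsubst v P) mu h)
  | red_actunchg n I a v P mu h :
      iact I a = Some v ->
      red RTau (Node n I (PPref (IAct a (Val v)) P) mu h) (Node n I P mu h)
  | red_actchg n I a v P mu h :
      iact I a <> Some v ->
      red (RAct a) (Node n I (PPref (IAct a (Val v)) P) mu h)
                   (Node n (upd_act I a v) P mu h)
  | red_loccom n I c v P R Q T mu h :
      rng c = RLocal ->
      red RTau
        (Node n I (PPar (PTout (COut c (Val v)) P R) (PTout (CIn c) Q T)) mu h)
        (Node n I (PPar P (vsubst v Q)) mu h)
  | red_glbcom n I c v P R mu1 h m J Q T mu2 k :
      within (dist h k) (rng c) ->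
      red RTau
        (NPar (Node n I (PTout (COut c (Val v)) P R) mu1 h)
              (Node m J (PTout (CIn c) Q T) mu2 k))
        (NPar (Node n I P mu1 h) (Node m J (vsubst v Q) mu2 k))
  | red_parp w k (n : 'I_k -> nodename) (I I' : 'I_k -> iface)
      (P P' Q : 'I_k -> proc) (mu mu' : 'I_k -> mobility) (h h' : 'I_k -> loc) :
      red w (nprod (fun i => Node (n i) (I i) (P i) (mu i) (h i)))
            (nprod (fun i => Node (n i) (I' i) (P' i) (mu' i) (h' i))) ->
      red w (nprod (fun i => Node (n i) (I i) (PPar (P i) (Q i)) (mu i) (h i)))
            (nprod (fun i =>
               Node (n i) (I' i) (PPar (P' i) (Q i)) (mu' i) (h' i)))
  | red_parn w M M' N : red w M M' -> red w (NPar M N) (NPar M' N)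
  | red_res w c M M' : red w M M' -> red w (NRes c M) (NRes c M')
  | red_struct w M N N' M' :
      scong M N -> red w N N' -> scong N' M' -> red w M M'.

Definition no_redtau (M : net) : Prop := forall M', ~ red RTau M M'.

(* Sigma-reductions are defined after [red], on which they have negative
   premises. *)
Inductive redsigma : net -> net -> Prop :=
  | rs_stat n I p (pi : 'I_p -> cpre) (P Q : 'I_p -> proc)
      q (R : 'I_q -> proc) h :
      let N := Node n I (PPar (pprod (fun i => PTout (pi i) (P i) (Q i)))
                              (pprod (fun j => PPref ISigma (R j))))
                    Stationary h in
      no_redtau N ->
      redsigma N (Node n I (PPar (pprod Q) (pprod R)) Stationary h)
  | rs_mob n I p (pi : 'I_p -> cpre) (P Q : 'I_p -> proc)
      q (R : 'I_q -> proc) h k :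
      let N := Node n I (PPar (pprod (fun i => PTout (pi i) (P i) (Q i)))
                              (pprod (fun j => PPref ISigma (R j))))
                    Mobile h in
      no_redtau N -> dist h k <= delta S ->
      redsigma N (Node n I (PPar (pprod Q) (pprod R)) Mobile k)
  | rs_par M M' N N' :
      redsigma M M' -> redsigma N N' -> no_redtau (NPar M N) ->
      redsigma (NPar M N) (NPar M' N')
  | rs_zero : redsigma NZero NZero
  | rs_res c M M' : redsigma M M' -> redsigma (NRes c M) (NRes c M')
  | rs_struct M N N' M' :
      scong M N -> redsigma N N' -> scong N' M' -> redsigma M M'.

Definition reduces (M N : net) : Prop := red RTau M N \/ redsigma M N.
Definition reduces_star : net -> net -> Prop := clos_refl_trans net reduces.

Definition ress (g : seq chan) (M : net) : net := foldr NRes M g.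

Definition barb (a : actuator) (v : val) (h : loc) (M : net) : Prop :=
  exists g n I P mu M',
    scong M (ress g (NPar (Node n I P mu h) M')) /\ iact I a = Some v.

Definition wbarb (a : actuator) (v : val) (h : loc) (M : net) : Prop :=
  exists2 M', reduces_star M M' & barb a v h M'.

Fixpoint sens_update (s : sensor) (h : loc) (v : val) (M : net) : net :=
  match M with
  | NZero => NZero
  | NNode x =>
      if (nloc x == h) && isens (niface x) s
      then Node (nname x) (upd_sens (niface x) s v) (nproc x) (nmob x) (nloc x)
      else NNode x
  | NPar M N => NPar (sens_update s h v M) (sens_update s h v N)
  | NRes c M => NRes c (sens_update s h v M)
  end.

Definition on_networks (R : net -> net -> Prop) : Prop :=
  forall M N, R M N -> network M /\ network N.

Definition symmetric_rel (R : net -> net -> Prop) : Prop :=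
  forall M N, R M N -> R N M.

Definition barb_preserving (R : net -> net -> Prop) : Prop :=
  forall M N a v h, R M N -> barb a v h M -> wbarb a v h N.

Definition reduction_closed (R : net -> net -> Prop) : Prop :=
  forall M N, R M N ->
    (forall M', reduces M M' -> exists2 N', reduces_star N N' & R M' N') /\
    (forall a M', red (RAct a) M M' ->
       exists N1 N2 N', [/\ reduces_star N N1, red (RAct a) N1 N2,
                            reduces_star N2 N' & R M' N']).

(* [M | O] and [N | O] have to be networks for [R] to relate them. *)
Definition contextual (R : net -> net -> Prop) : Prop :=
  forall M N, R M N ->
    [/\ forall O, network (NPar M O) -> network (NPar N O) ->
          R (NPar M O) (NPar N O),
        forall c, R (NRes c M) (NRes c N)
      & forall s h v, sdom s v ->
          R (sens_update s h v M) (sens_update s h v N)].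

(* The largest relation with these closure properties, as the union of all of
   them. *)
Definition barbed_congruent (M N : net) : Prop :=
  exists R, [/\ [/\ on_networks R & symmetric_rel R], reduction_closed R,
                barb_preserving R, contextual R & R M N].

(* The labels other than sigma, whose transitions have negative premises on
   the tau-transitions and are therefore defined in a second step. *)
Inductive plab :=
  | LTau
  | LOut of chan & val
  | LIn of chan & val
  | LPos of loc
  | LSens of sensor & val
  | LAct of actuator & val.

(* [PCond] is identified with the selected branch. *)
Inductive ptrans : plab -> proc -> proc -> Prop :=
  | pt_out c v P Q : ptrans (LOut c v) (PTout (COut c (Val v)) P Q) P
  | pt_in c v P Q : ptrans (LIn c v) (PTout (CIn c) P Q) (vsubst v P)
  | pt_sens s v P : ptrans (LSens s v) (PPref (ISens s) P) (vsubst v P)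
  | pt_act a v P : ptrans (LAct a v) (PPref (IAct a (Val v)) P) P
  | pt_pos h P : ptrans (LPos h) (PPref IPos P) (vsubst (VLoc h) P)
  | pt_comL c v P P' Q Q' :
      ptrans (LOut c v) P P' -> ptrans (LIn c v) Q Q' -> rng c = RLocal ->
      ptrans LTau (PPar P Q) (PPar P' Q')
  | pt_comR c v P P' Q Q' :
      ptrans (LOut c v) P P' -> ptrans (LIn c v) Q Q' -> rng c = RLocal ->
      ptrans LTau (PPar Q P) (PPar Q' P')
  | pt_parL l P P' Q : ptrans l P P' -> ptrans l (PPar P Q) (PPar P' Q)
  | pt_parR l P P' Q : ptrans l P P' -> ptrans l (PPar Q P) (PPar Q P')
  | pt_fix l P Q : ptrans l (unfold_fix P) Q -> ptrans l (PFix P) Q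
  | pt_true l b P Q P' :
      guard_is b true -> ptrans l P P' -> ptrans l (PCond b P Q) P'
  | pt_false l b P Q Q' :
      guard_is b false -> ptrans l Q Q' -> ptrans l (PCond b P Q) Q'.

Inductive ptick : proc -> proc -> Prop :=
  | pk_nil : ptick PNil PNil
  | pk_sigma P : ptick (PPref ISigma P) P
  | pk_tout p P Q : ptick (PTout p P Q) Q
  | pk_par P P' Q Q' :
      ptick P P' -> ptick Q Q' -> (forall R, ~ ptrans LTau (PPar P Q) R) ->
      ptick (PPar P Q) (PPar P' Q')
  | pk_fix P Q : ptick (unfold_fix P) Q -> ptick (PFix P) Q
  | pk_true b P Q P' : guard_is b true -> ptick P P' -> ptick (PCond b P Q) P'
  | pk_false b P Q Q' : guard_is b false -> ptick Q Q' -> ptick (PCond b P Q) Q'.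

Inductive nlab :=
  | NLTau
  | NLAct of actuator
  | NLOut of chan & val & loc
  | NLIn of chan & val & loc.

Definition nlab_on (c : chan) (l : nlab) : bool :=
  match l with NLOut d _ _ | NLIn d _ _ => d == c | _ => false end.

Inductive ntrans : nlab -> net -> net -> Prop :=
  | nt_pos n I P P' mu h :
      ptrans (LPos h) P P' -> ntrans NLTau (Node n I P mu h) (Node n I P' mu h)
  | nt_sensread n I s v P P' mu h :
      isens I s = Some v -> ptrans (LSens s v) P P' ->
      ntrans NLTau (Node n I P mu h) (Node n I P' mu h)
  | nt_actunchg n I a v P P' mu h :
      iact I a = Some v -> ptrans (LAct a v) P P' ->
      ntrans NLTau (Node n I P mu h) (Node n I P' mu h)
  | nt_actchg n I a v P P' mu h :
      iact I a <> Some v -> ptrans (LAct a v) P P' ->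
      ntrans (NLAct a) (Node n I P mu h) (Node n (upd_act I a v) P' mu h)
  | nt_loccom n I P P' mu h :
      ptrans LTau P P' -> ntrans NLTau (Node n I P mu h) (Node n I P' mu h)
  | nt_out n I c v P P' mu h :
      ptrans (LOut c v) P P' -> nonneg_range (rng c) ->
      ntrans (NLOut c v h) (Node n I P mu h) (Node n I P' mu h)
  | nt_in n I c v P P' mu h :
      ptrans (LIn c v) P P' -> nonneg_range (rng c) ->
      ntrans (NLIn c v h) (Node n I P mu h) (Node n I P' mu h)
  | nt_glbcomL c v k h M M' N N' :
      ntrans (NLOut c v k) M M' -> ntrans (NLIn c v h) N N' ->
      within (dist h k) (rng c) -> ntrans NLTau (NPar M N) (NPar M' N')
  | nt_glbcomR c v k h M M' N N' :
      ntrans (NLOut c v k) M M' -> ntrans (NLIn c v h) N N' ->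
      within (dist h k) (rng c) -> ntrans NLTau (NPar N M) (NPar N' M')
  | nt_parL l M M' N : ntrans l M M' -> ntrans l (NPar M N) (NPar M' N)
  | nt_parR l M M' N : ntrans l M M' -> ntrans l (NPar N M) (NPar N M')
  | nt_res l c M M' :
      ntrans l M M' -> ~~ nlab_on c l -> ntrans l (NRes c M) (NRes c M').

Definition no_ntau (M : net) : Prop := forall M', ~ ntrans NLTau M M'.

Inductive ntick : net -> net -> Prop :=
  | nk_stat n I P P' h :
      ptick P P' -> no_ntau (Node n I P Stationary h) ->
      ntick (Node n I P Stationary h) (Node n I P' Stationary h)
  | nk_mob n I P P' h k :
      ptick P P' -> no_ntau (Node n I P Mobile h) -> dist h k <= delta S ->
      ntick (Node n I P Mobile h) (Node n I P' Mobile k)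
  | nk_par M M' N N' :
      ntick M M' -> ntick N N' -> no_ntau (NPar M N) ->
      ntick (NPar M N) (NPar M' N')
  | nk_zero : ntick NZero NZero
  | nk_res c M M' : ntick M M' -> ntick (NRes c M) (NRes c M').

Inductive elab :=
  | ETau
  | ESigma
  | EAct of actuator
  | EOut of chan & val & loc       (* output observable at the location *)
  | EIn of chan & val & loc        (* input provided from the location *)
  | ESens of sensor & val & loc    (* s?v@h *)
  | EBarb of actuator & val & loc. (* a!v@h *)

Inductive etrans : elab -> net -> net -> Prop :=
  | et_tau M M' : ntrans NLTau M M' -> etrans ETau M M'
  | et_sigma M M' : ntick M M' -> etrans ESigma M M'
  | et_act a M M' : ntrans (NLAct a) M M' -> etrans (EAct a) M M'
  | et_out c v h k M M' :
      ntrans (NLOut c v h) M M' -> within (dist h k) (rng c) ->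
      etrans (EOut c v k) M M'
  | et_in c v h k M M' :
      ntrans (NLIn c v h) M M' -> within (dist k h) (rng c) ->
      etrans (EIn c v k) M M'
  | et_sens s v h M :
      sdom s v -> etrans (ESens s v h) M (sens_update s h v M)
  | et_barb a v h M : barb a v h M -> etrans (EBarb a v h) M M.

Definition taus : net -> net -> Prop := clos_refl_trans net (etrans ETau).

Definition wtrans (l : elab) (M N : net) : Prop :=
  exists M1 M2, [/\ taus M M1, etrans l M1 M2 & taus M2 N].

Definition wtrans_hat (l : elab) (M N : net) : Prop :=
  if l is ETau then taus M N else wtrans l M N.

Definition bisimulation (R : net -> net -> Prop) : Prop :=
  [/\ on_networks R, symmetric_rel R
    & forall M N l M', R M N -> etrans l M M' ->
        exists2 N', wtrans_hat l N N' & R M' N'].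

Definition bisimilar (M N : net) : Prop := exists2 R, bisimulation R & R M N.

End Calculus.

(* Main.v *)
(** Bisimilarity itself is a symmetric relation that is reduction closed, barb
    preserving and contextual.

    Reduction closure rests on the agreement, up to structural congruence, of
    reductions and transitions.  For this, structural congruence has to be a
    strong bisimulation: as recursion is time-guarded, every move of an
    unfolding [P{fix X.P/X}] is a move of [P], so that the congruence rule for
    [fix] causes no circularity.  To invert structural congruence, all bound
    channels are identified with each other.

    For parallel composition the delicate case is a tick of [M | O], whose match
    must not be preempted by a communication with [O]; since [M] has no internal
    move, it would have to exhibit the same communication.

    Closure under sensor updates [u] is not immediate, because the weak answer
    to the label of [u] may perform internal moves before the update.  If [M]
    and [N] are bisimilar, these answers, and the fact that the environment can
    restore any value read by an internal move, yield paths made of internal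
    moves and updates that lead from [u M] to a network bisimilar to [u N] and
    back.  Both paths can be repeated indefinitely up to bisimilarity, while
    internal moves terminate.  Hence they can eventually be followed by updates
    alone, and then [u M] and [u N] are bisimilar. *)

From mathcomp Require Import all_boot zify.
From Stdlib Require List.
From Stdlib Require Import Permutation FunctionalExtensionality Classical.
From Stdlib Require Import Relation_Operators.
Require Import Defs.

Set Implicit Arguments.
Unset Strict Implicit.
Unset Printing Implicit Defensive.

(** * Substitution in processes *)

(** Structural congruence has to be inverted because of [red_parp]: that rule adds processes inside
    the nodes of a product, while the reduct of its premise may be known only up to congruence. That
    the congruence survives such an addition is not evident. One must know that two congruent
    products consist of nodes agreeing in pairs up to congruence of their processes, although a
    derivation between products may pass through restrictions. The added processes are therefore
    attached to node names, which survive every rearrangement.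

    Both congruences are transitive only through well-formed intermediate terms, so each
    rearrangement carries along the well-formedness of its two ends. Ticks have negative premises;
    hence internal moves are settled first, in both directions or under an invertible renaming.

    A communication may be derived between nodes that lie below restrictions, whereas [red_glbcom]
    wants two adjacent nodes; the fresh channels of equal range given by [chan_fresh] allow the
    scopes to be extruded. *)

Section Substitution.

Variable S : cait.
Implicit Types (P Q R : proc S) (f g : nat -> vexp S -> vexp S).

Lemma ibind_map (f : vexp S -> vexp S) r : ibind (imapE f r) = ibind r.
Proof. by case: r. Qed.

Lemma cbind_map (f : vexp S -> vexp S) p : cbind (cmapE f p) = cbind p.
Proof. by case: p. Qed.

(** The offset [i] counts the value binders already crossed. As the hypothesis is required for every
    [i], it passes under binders, and exchanging two traversals reduces to exchanging them on
    expressions. *)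
Lemma pmapE_swap f g f' g' P k k1 k2 k3 :
  (forall i e, f (i + k) (g (i + k1) e) = g' (i + k2) (f' (i + k3) e)) ->
  pmapE f k (pmapE g k1 P) = pmapE g' k2 (pmapE f' k3 P).
Proof.
elim: P k k1 k2 k3 => //=.
- move=> r P IH k k1 k2 k3 H; rewrite !ibind_map; congr PPref.
    by case: r => //= a e; rewrite (H 0).
  by apply: IH => i e; have := H (i + ibind r) e; rewrite !addnA.
- by move=> P IH Q IH' k k1 k2 k3 H; rewrite (IH k k1 k2 k3) // (IH' k k1 k2 k3).
- move=> p P IH Q IH' k k1 k2 k3 H; rewrite !cbind_map (IH' k k1 k2 k3) //.
  congr PTout; first by case: p => //= c e; rewrite (H 0).
  by apply: IH => i e; have := H (i + cbind p) e; rewrite !addnA.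
- move=> b P IH Q IH' k k1 k2 k3 H; rewrite (IH k k1 k2 k3) // (IH' k k1 k2 k3) //.
  congr PCond; rewrite /gmapE /= -!map_comp; congr Guard.
  by apply: eq_map => e /=; exact: (H 0).
- by move=> P IH k k1 k2 k3 H; rewrite (IH k k1 k2 k3).
Qed.

(** Compatibility with weakening at an index not above the current one. It is what allows a
    traversal to be exchanged with [psubst], which weakens the substituted process at each value
    binder. *)
Definition shift_stable f :=
  forall i k e, f (i + k).+1 (eshift i e) = eshift i (f (i + k) e).

Lemma eshift_stable : shift_stable (@eshift S).
Proof. by move=> i k [v|j] //=; congr Var; rewrite /bump; lia. Qed.

Lemma esubst_stable v : shift_stable (@esubst S v).
Proof.
move=> i k [w|j] //=.
have -> : (bump i j == (i + k).+1) = (j == i + k) by rewrite /bump; lia.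
by case: eqP => //= hj; congr Var; rewrite /bump /unbump; lia.
Qed.

Lemma pmapE_vshift f k P : shift_stable f ->
  pmapE f k.+1 (vshift P) = vshift (pmapE f k P).
Proof. by move=> H; apply: pmapE_swap => i e; rewrite addnS addn0 H. Qed.

Lemma pshift_pmapE f k j P : pshift j (pmapE f k P) = pmapE f k (pshift j P).
Proof.
elim: P k j => //= [r P IH|P IH Q IH'|p P IH Q IH'|b P IH Q IH'|P IH] k j;
  by rewrite ?IH ?IH'.
Qed.

Lemma pmapE_psubst f k j R P : shift_stable f ->
  pmapE f k (psubst j R P) = psubst j (pmapE f k R) (pmapE f k P).
Proof.
move=> H; elim: P k j R => //= [r P IH|P IH Q IH'|p P IH Q IH'|b P IH Q IH'|X|P IH] k j R.
- rewrite IH ibind_map; congr PPref; congr psubst.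
  by case: r => //= *; rewrite pmapE_vshift.
- by rewrite IH IH'.
- rewrite IH IH' cbind_map; congr PTout; congr psubst.
  by case: p => //= *; rewrite pmapE_vshift.
- by rewrite IH IH'.
- by case: eqP.
- by rewrite IH pshift_pmapE.
Qed.

Lemma unfold_pmapE f k P : shift_stable f ->
  pmapE f k (unfold_fix P) = unfold_fix (pmapE f k P).
Proof. exact: pmapE_psubst. Qed.

Lemma bumpC_le i j X : i <= j -> bump j.+1 (bump i X) = bump i (bump j X).
Proof.
by move=> h; have := eshift_stable i (j - i) (Var S X); rewrite subnKC // => -[].
Qed.

Lemma pshift_pshift i j P : i <= j ->
  pshift j.+1 (pshift i P) = pshift i (pshift j P).
Proof.
elim: P i j => //= [r P IH|P IH Q IH'|p P IH Q IH'|b P IH Q IH'|X|P IH] i j h;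
  try by rewrite IH ?IH'.
by rewrite bumpC_le.
Qed.

Lemma pshift_iter n j R : pshift j (iter n (@vshift S) R) = iter n (@vshift S) (pshift j R).
Proof. by elim: n => //= n IH; rewrite pshift_pmapE IH. Qed.

Lemma psubst_iter n j R Q :
  psubst j (iter n (@vshift S) R) (iter n (@vshift S) Q) = iter n (@vshift S) (psubst j R Q).
Proof. by elim: n => //= n <-; rewrite [RHS]pmapE_psubst //; exact: eshift_stable. Qed.

Lemma pshift_psubst i j R P : i <= j ->
  pshift j (psubst i R P) = psubst i (pshift j R) (pshift j.+1 P).
Proof.
elim: P i j R => //= [r P IH|P IH Q IH'|p P IH Q IH'|b P IH Q IH'|X|P IH] i j R h.
- by rewrite IH // pshift_iter.
- by rewrite IH // IH'.
- by rewrite IH // IH' // pshift_iter.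
- by rewrite IH // IH'.
- have -> : (bump j.+1 X == i) = (X == i) by rewrite /bump; lia.
  by case: eqP => //= hX; congr PVar; rewrite /bump /unbump; lia.
- by rewrite IH // pshift_pshift.
Qed.

Lemma psubst_pshift j R P : psubst j R (pshift j P) = P.
Proof.
elim: P j R => //= [r P IH|P IH Q IH'|p P IH Q IH'|b P IH Q IH'|X|P IH] j R;
  rewrite ?IH ?IH' //.
by rewrite eq_sym (negbTE (neq_bump _ _)) bumpK.
Qed.

Lemma psubst_pshift_lt i j R P : i <= j ->
  psubst j.+1 (pshift i R) (pshift i P) = pshift i (psubst j R P).
Proof.
elim: P i j R => //= [r P IH|P IH Q IH'|p P IH Q IH'|b P IH Q IH'|X|P IH] i j R h.
- by rewrite -pshift_iter IH.
- by rewrite IH // IH'.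
- by rewrite -pshift_iter IH // IH'.
- by rewrite IH // IH'.
- have -> : (bump i X == j.+1) = (X == j) by rewrite /bump; lia.
  by case: eqP => //= hX; congr PVar; rewrite /bump /unbump; lia.
- by rewrite -(@pshift_pshift 0 i R) // IH.
Qed.

(** The substitution lemma in de Bruijn form. With [F] the recursion itself it makes substitution
    commute with unfolding, on which the [fix] cases below rely. *)
Lemma psubst_psubst i j R F P : i <= j ->
  psubst j R (psubst i F P) =
  psubst i (psubst j R F) (psubst j.+1 (pshift i R) P).
Proof.
elim: P i j R F => //= [r P IH|P IH Q IH'|p P IH Q IH'|b P IH Q IH'|X|P IH] i j R F h.
- by rewrite IH // pshift_iter psubst_iter.
- by rewrite IH // IH'.
- by rewrite IH // IH' // pshift_iter psubst_iter.
- by rewrite IH // IH'.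
- have [->|hi] := eqVneq X i => /=.
    have -> : (i == j.+1) = false by lia.
    by rewrite /= (_ : unbump j.+1 i == i) // /unbump; lia.
  have -> : (unbump i X == j) = (X == j.+1) by rewrite /unbump; lia.
  have [_|hj] := eqVneq X j.+1 => /=; first by rewrite psubst_pshift.
  have -> : (unbump j.+1 X == i) = false by rewrite /unbump; lia.
  by congr PVar; rewrite /unbump; lia.
- by rewrite IH // psubst_pshift_lt // -(@pshift_pshift 0 i R).
Qed.

Lemma unfold_psubst k R P :
  psubst k R (unfold_fix P) = unfold_fix (psubst k.+1 (pshift 0 R) P).
Proof. by rewrite /unfold_fix psubst_psubst. Qed.

Lemma unfold_pshift k P : pshift k (unfold_fix P) = unfold_fix (pshift k.+1 P).
Proof. by rewrite /unfold_fix pshift_psubst. Qed.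

(** On the right [R] is placed under the binder and has to be weakened; the value substitution then
    removes exactly the index that the weakening has skipped. *)
Lemma psubst_vsubst k v R P :
  psubst k R (vsubst v P) = vsubst v (psubst k (vshift R) P).
Proof.
rewrite /vsubst (pmapE_psubst _ _ _ _ (esubst_stable v)); congr psubst.
symmetry; suff H : forall i, pmapE (esubst v) i (pmapE (@eshift S) i R) = R by exact: H.
have He i e : esubst v i (eshift i e) = e.
  by case: e => //= j; rewrite eq_sym (negbTE (neq_bump _ _)) bumpK.
have Hg i b : gmapE (esubst v i) (gmapE (@eshift S i) b) = b.
  by case: b => p l; rewrite /gmapE /= -map_comp (eq_map (He i)) map_id.
elim: R => //= [r Q IH|Q IH Q' IH'|p Q IH Q' IH'|b Q IH Q' IH'|Q IH] i.
- by rewrite ibind_map IH; case: r => //= a e; rewrite He.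
- by rewrite IH IH'.
- by rewrite cbind_map IH IH'; case: p => //= a e; rewrite He.
- by rewrite Hg IH IH'.
- by rewrite IH.
Qed.

Lemma guard_is_pmapE f k b t : (forall v, f k (Val v) = Val v) ->
  guard_is b t -> guard_is (gmapE (f k) b) t.
Proof.
move=> Hf [vs h1 h2]; exists vs => //=; rewrite h1 -map_comp.
exact: eq_map.
Qed.

(** ** Syntactic side conditions *)

Lemma tguarded_pmapE f k X P : tguarded X (pmapE f k P) = tguarded X P.
Proof.
elim: P k X => //= [r P IH|P IH Q IH'|b P IH Q IH'] k X; try by rewrite IH IH'.
by case: r => [|||a e] /=.
Qed.

Lemma tguarded_iter n X P : tguarded X (iter n (@vshift S) P) = tguarded X P.
Proof. by elim: n => //= n <-; rewrite tguarded_pmapE. Qed.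

Lemma tguarded_pshift_eq k P : tguarded k (pshift k P).
Proof.
elim: P k => //= [r P IH|P IH Q IH'|b P IH Q IH'|X] k; try by rewrite IH IH'.
  by case: r => [|||a e] /=.
by rewrite eq_sym neq_bump.
Qed.

Lemma tguarded_pshift k X P : tguarded (bump k X) (pshift k P) = tguarded X P.
Proof.
elim: P k X => //= [r P IH|P IH Q IH'|b P IH Q IH'|Y|P IH] k X; try by rewrite IH IH'.
- by case: r => [|||a e] /=.
- by rewrite (can_eq (bumpK k)).
- by rewrite -bumpS IH.
Qed.

(** [bump j X] is the index that [X] has before the variable [j] is eliminated. *)
Lemma tguarded_psubst j X R P : tguarded (bump j X) P -> tguarded X R ->
  tguarded X (psubst j R P).
Proof.
elim: P j X R => //= [r P IH|P IH Q IH'|p P IH Q IH'|b P IH Q IH'|Y|P IH] j X R.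
- by case: r => //= *; apply: IH => //; rewrite tguarded_pmapE.
- by move=> /andP [? ?] ?; rewrite IH ?IH'.
- by move=> *; apply: IH; rewrite ?tguarded_iter.
- by move=> /andP [? ?] ?; rewrite IH ?IH'.
- by move=> h hR; case: (Y =P j) => //= hY; apply/eqP => hX; move: h; rewrite -hX unbumpK ?eqxx //; exact/eqP.
- rewrite -bumpS => *; apply: IH => //.
  by have := tguarded_pshift 0 X R; rewrite /bump /= add1n => ->.
Qed.

Lemma proc_ok_pmapE f k P : proc_ok (pmapE f k P) = proc_ok P.
Proof.
elim: P k => //= [P IH Q IH'|p P IH Q IH'|b P IH Q IH'|P IH] k;
  by rewrite ?tguarded_pmapE ?IH ?IH'.
Qed.

Lemma proc_ok_iter n P : proc_ok (iter n (@vshift S) P) = proc_ok P.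
Proof. by elim: n => //= n <-; rewrite proc_ok_pmapE. Qed.

Lemma proc_ok_pshift k P : proc_ok (pshift k P) = proc_ok P.
Proof.
elim: P k => //= [P IH Q IH'|p P IH Q IH'|b P IH Q IH'|P IH] k; rewrite ?IH ?IH' //.
by have := tguarded_pshift k.+1 0 P; rewrite /bump /= add0n => ->.
Qed.

Lemma proc_ok_psubst j R P : proc_ok P -> proc_ok R -> proc_ok (psubst j R P).
Proof.
elim: P j R => //= [r P IH|P IH Q IH'|p P IH Q IH'|b P IH Q IH'|Y|P IH] j R.
- by move=> *; rewrite IH // proc_ok_iter.
- by move=> /andP [? ?] ?; rewrite IH ?IH'.
- by move=> /andP [? ?] ?; rewrite IH ?IH' ?proc_ok_iter.
- by move=> /andP [? ?] ?; rewrite IH ?IH'.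
- by case: eqP.
(* The shifted [R] does not mention the variable bound by this recursion, so the substitution cannot
   spoil its guardedness. *)
- move=> /andP [hg ?] ?; rewrite IH ?proc_ok_pshift // andbT.
  by apply: tguarded_psubst => //; exact: tguarded_pshift_eq.
Qed.

Lemma proc_ok_unfold P : proc_ok (PFix P) -> proc_ok (unfold_fix P).
Proof. by move=> h; apply: proc_ok_psubst => //; case/andP: h. Qed.

Lemma escoped_eshift i m e : @escoped S m e -> escoped m.+1 (eshift i e).
Proof. by case: e => //= j; rewrite /bump; lia. Qed.

Lemma escoped_esubst v i m e : i <= m -> @escoped S m.+1 e -> escoped m (esubst v i e).
Proof.
by case: e => //= j hi hj; case: eqP => //= hji; rewrite /unbump; lia.
Qed.

Lemma pscoped_eshift i k m P : pscoped k m P -> pscoped k m.+1 (pmapE (@eshift S) i P).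
Proof.
elim: P i k m => //= [r P IH|P IH Q IH'|p P IH Q IH'|b P IH Q IH'|P IH] i k m.
- move=> /andP [h1 h2]; apply/andP; split; first by case: r h1 {h2} => //= a e; exact: escoped_eshift.
  by rewrite ibind_map addnS; exact: IH.
- by case/andP => *; rewrite IH ?IH'.
- move=> /and3P [h1 h2 h3]; rewrite cbind_map addnS IH ?IH' // !andbT.
  by case: p h1 {h2} => //= a e; exact: escoped_eshift.
- move=> /and3P [h1 h2 h3]; rewrite IH ?IH' // !andbT all_map.
  by apply: sub_all h1 => e; exact: escoped_eshift.
- exact: IH.
Qed.

Lemma pscoped_iter n k m P : pscoped k m P -> pscoped k (n + m) (iter n (@vshift S) P).
Proof. by move=> h; elim: n => //= n; exact: pscoped_eshift. Qed.

Lemma pscoped_esubst v i k m P : i <= m ->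
  pscoped k m.+1 P -> pscoped k m (pmapE (@esubst S v) i P).
Proof.
elim: P i k m => //= [r P IH|P IH Q IH'|p P IH Q IH'|b P IH Q IH'|P IH] i k m hi.
- move=> /andP [h1 h2]; apply/andP; split; first by case: r h1 {h2} => //= a e; exact: escoped_esubst.
  by rewrite ibind_map; apply: IH; rewrite ?leq_add2l -?addnS.
- by case/andP => *; rewrite IH ?IH'.
- move=> /and3P [h1 h2 h3]; rewrite cbind_map IH ?IH' -?addnS ?leq_add2l // !andbT.
  by case: p h1 {h2} => //= a e; exact: escoped_esubst.
- move=> /and3P [h1 h2 h3]; rewrite IH ?IH' // !andbT all_map.
  by apply: sub_all h1 => e; exact: escoped_esubst.
- exact: IH.
Qed.

Lemma pscoped_pshift j k m P : pscoped k m P -> pscoped k.+1 m (pshift j P).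
Proof.
elim: P j k m => //= [r P IH|P IH Q IH'|p P IH Q IH'|b P IH Q IH'|X|P IH] j k m.
- by case/andP => *; rewrite IH ?andbT.
- by case/andP => *; rewrite IH ?IH'.
- by case/and3P => -> *; rewrite IH ?IH'.
- by case/and3P => -> *; rewrite IH ?IH'.
- by rewrite /bump; lia.
- exact: IH.
Qed.

Lemma pscoped_psubst j k m R P : j <= k -> pscoped k.+1 m P -> pscoped k m R ->
  pscoped k m (psubst j R P).
Proof.
elim: P j k m R => //= [r P IH|P IH Q IH'|p P IH Q IH'|b P IH Q IH'|X|P IH] j k m R hj.
- by case/andP => -> *; apply: IH => //; exact: pscoped_iter.
- by case/andP => *; rewrite IH ?IH'.
- by case/and3P => -> *; rewrite IH ?IH' //; exact: pscoped_iter.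
- by case/and3P => -> *; rewrite IH ?IH'.
- by move=> hX hR; case: eqP => //= hj'; rewrite /unbump; lia.
- by move=> *; apply: IH => //; exact: pscoped_pshift.
Qed.

Lemma pclosed_vsubst v P : pscoped 0 1 P -> pclosed (vsubst v P).
Proof. exact: pscoped_esubst. Qed.

Lemma pclosed_unfold P : pclosed (PFix P) -> pclosed (unfold_fix P).
Proof. by move=> h; apply: pscoped_psubst. Qed.

(** Tests that ignore value expressions are insensitive to value substitution and to the weakenings
    performed by [psubst]. *)
Definition expr_blind (p : ipre S -> bool) := forall h r, p (imapE h r) = p r.

Lemma has_ipre_pmapE p f k P : expr_blind p -> has_ipre p (pmapE f k P) = has_ipre p P.
Proof.
move=> H; elim: P k => //= [r P IH|P IH Q IH'|q P IH Q IH'|b P IH Q IH'] k;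
  by rewrite ?IH ?IH' ?H.
Qed.

Lemma has_ipre_pshift p k P : has_ipre p (pshift k P) = has_ipre p P.
Proof.
by elim: P k => //= [r P IH|P IH Q IH'|q P IH Q IH'|b P IH Q IH'] k; rewrite ?IH ?IH'.
Qed.

Lemma has_ipre_psubst p k R P : expr_blind p ->
  has_ipre p (psubst k R P) -> has_ipre p R || has_ipre p P.
Proof.
move=> H; have Hi n Q : has_ipre p (iter n (@vshift S) Q) = has_ipre p Q.
  by elim: n => //= n <-; rewrite has_ipre_pmapE.
elim: P k R => //= [r P IH|P IH Q IH'|q P IH Q IH'|b P IH Q IH'|X|P IH] k R.
- by case/orP => [->|/IH]; rewrite ?orbT // Hi => /orP [] ->; rewrite ?orbT.
- by case/orP => [/IH|/IH'] /orP [] ->; rewrite ?orbT.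
- by case/orP => [/IH|/IH']; rewrite ?Hi => /orP [] ->; rewrite ?orbT.
- by case/orP => [/IH|/IH'] /orP [] ->; rewrite ?orbT.
- by case: eqP => // _ ->.
- by move/IH; rewrite has_ipre_pshift.
Qed.

Lemma pchans_pmapE f k P : pchans (pmapE f k P) = pchans P.
Proof.
elim: P k => //= [P IH Q IH'|q P IH Q IH'|b P IH Q IH'] k; rewrite ?IH ?IH' //.
by case: q.
Qed.

Lemma pchans_pshift k P : pchans (pshift k P) = pchans P.
Proof.
by elim: P k => //= [P IH Q IH'|q P IH Q IH'|b P IH Q IH'] k; rewrite ?IH ?IH'.
Qed.

Lemma pchans_psubst k R P : {subset pchans (psubst k R P) <= pchans R ++ pchans P}.
Proof.
have Hi n Q : pchans (iter n (@vshift S) Q) = pchans Q.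
  by elim: n => //= n <-; rewrite pchans_pmapE.
elim: P k R => //= [r P IH|P IH Q IH'|q P IH Q IH'|b P IH Q IH'|X|P IH] k R c.
- by move/IH; rewrite Hi.
- by rewrite mem_cat => /orP [/IH|/IH']; rewrite !mem_cat => /orP [] ->; rewrite ?orbT.
- rewrite in_cons mem_cat => /or3P [/eqP ->|/IH|/IH'];
    rewrite ?Hi ?mem_cat ?in_cons ?eqxx ?mem_cat ?orbT // => /orP [] ->; by rewrite ?orbT.
- by rewrite mem_cat => /orP [/IH|/IH']; rewrite !mem_cat => /orP [] ->; rewrite ?orbT.
- by case: eqP => // _; rewrite cats0.
- by move/IH; rewrite pchans_pshift.
Qed.

Lemma pchans_unfold P : {subset pchans (unfold_fix P) <= pchans P}.
Proof. by move=> c /pchans_psubst; rewrite mem_cat => /orP []. Qed.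

(** * Renaming of channels in processes *)

Section Renaming.

Variable f : chan S -> chan S.

Lemma pmapC_pmapE g k P : pmapC f (pmapE g k P) = pmapE g k (pmapC f P).
Proof.
elim: P k => //= [r P IH|P IH Q IH'|q P IH Q IH'|b P IH Q IH'|P IH] k; rewrite ?IH ?IH' //.
by case: q.
Qed.

Lemma pmapC_pshift k P : pmapC f (pshift k P) = pshift k (pmapC f P).
Proof.
by elim: P k => //= [r P IH|P IH Q IH'|q P IH Q IH'|b P IH Q IH'|P IH] k; rewrite ?IH ?IH'.
Qed.

Lemma pmapC_psubst k R P : pmapC f (psubst k R P) = psubst k (pmapC f R) (pmapC f P).
Proof.
have Hi n Q : pmapC f (iter n (@vshift S) Q) = iter n (@vshift S) (pmapC f Q).
  by elim: n => //= n <-; rewrite pmapC_pmapE.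
elim: P k R => //= [r P IH|P IH Q IH'|q P IH Q IH'|b P IH Q IH'|X|P IH] k R;
  rewrite ?IH ?IH' ?Hi ?pmapC_pshift //.
  by case: q.
by case: eqP.
Qed.

Lemma pmapC_unfold P : pmapC f (unfold_fix P) = unfold_fix (pmapC f P).
Proof. exact: pmapC_psubst. Qed.

Lemma tguarded_pmapC X P : tguarded X (pmapC f P) = tguarded X P.
Proof.
elim: P X => //= [r P IH|P IH Q IH'|b P IH Q IH'] X; rewrite ?IH ?IH' //.
Qed.

Lemma proc_ok_pmapC P : proc_ok (pmapC f P) = proc_ok P.
Proof.
by elim: P => //= [P -> Q ->|q P -> Q ->|b P -> Q ->|P ->]; rewrite ?tguarded_pmapC.
Qed.

Lemma pscoped_pmapC k m P : pscoped k m (pmapC f P) = pscoped k m P.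
Proof.
elim: P k m => //= [r P IH|P IH Q IH'|q P IH Q IH'|b P IH Q IH'] k m; rewrite ?IH ?IH' //.
by case: q.
Qed.

Lemma has_ipre_pmapC p P : has_ipre p (pmapC f P) = has_ipre p P.
Proof. by elim: P => //= [r P ->|P -> Q ->|q P -> Q ->|b P -> Q ->]. Qed.

Lemma pchans_pmapC P : pchans (pmapC f P) = map f (pchans P).
Proof.
elim: P => //= [P -> Q ->|q P -> Q ->|b P -> Q ->]; rewrite ?map_cat //.
by case: q.
Qed.

End Renaming.

Lemma eq_pmapC (f g : chan S -> chan S) P :
  {in pchans P, f =1 g} -> pmapC f P = pmapC g P.
Proof.
elim: P => //= [r P IH|P IH Q IH'|q P IH Q IH'|b P IH Q IH'|P IH] H.
- by rewrite IH.
- by rewrite IH ?IH' // => c hc; apply: H; rewrite mem_cat hc ?orbT.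
- rewrite IH ?IH' => [|c hc|c hc]; try by apply: H; rewrite in_cons mem_cat hc ?orbT.
  congr PTout; have := H (cchan q) (mem_head _ _); by case: q {H} => [c e|c] /= ->.
- by rewrite IH ?IH' // => c hc; apply: H; rewrite mem_cat hc ?orbT.
- by rewrite IH.
Qed.

Lemma pmapC_comp (f g : chan S -> chan S) P : pmapC f (pmapC g P) = pmapC (f \o g) P.
Proof.
elim: P => //= [r P ->|P -> Q ->|q P -> Q ->|b P -> Q ->|P ->] //.
by case: q.
Qed.

Lemma pmapC_id (f : chan S -> chan S) P : f =1 id -> pmapC f P = P.
Proof.
move=> H; elim: P => //= [r P ->|P -> Q ->|q P -> Q ->|b P -> Q ->|P ->] //.
by case: q => [c e|c] /=; rewrite H.
Qed.

End Substitution.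

(** * Structural congruence and transitions of processes *)

Section Processes.

Variable S : cait.
Implicit Types (P Q R : proc S).

Hint Constructors pcong ptrans ptick : core.

(** [f] has to fix values so that a guard keeps the truth value that selects its branch. *)
Lemma pcong_pmapE (f : nat -> vexp S -> vexp S) k P Q :
  shift_stable f -> (forall i v, f i (Val v) = Val v) ->
  pcong P Q -> pcong (pmapE f k P) (pmapE f k Q).
Proof.
move=> Hf Hv H; elim: H k => /=; eauto.
- by move=> P0 R Q0 hR _ IH1 _ IH2 k; apply: pc_trans (IH1 k) (IH2 k); rewrite proc_ok_pmapE.
- by move=> b P0 Q0 hb k; apply/pc_true/guard_is_pmapE.
- by move=> b P0 Q0 hb k; apply/pc_false/guard_is_pmapE.
- by move=> P0 k; rewrite unfold_pmapE.
Qed.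

Lemma pcong_vsubst v P Q : pcong P Q -> pcong (vsubst v P) (vsubst v Q).
Proof. by apply: pcong_pmapE => //; exact: esubst_stable. Qed.

Hint Resolve pcong_vsubst : core.

Lemma pcong_iter n P Q : pcong P Q -> pcong (iter n (@vshift S) P) (iter n (@vshift S) Q).
Proof.
move=> H; elim: n => //= n; apply: pcong_pmapE => //; exact: eshift_stable.
Qed.

Lemma pcong_pshift k P Q : pcong P Q -> pcong (pshift k P) (pshift k Q).
Proof.
move=> H; elim: H k => /=; eauto.
- by move=> P0 R Q0 hR _ IH1 _ IH2 k; apply: pc_trans (IH1 k) (IH2 k); rewrite proc_ok_pshift.
- by move=> P0 k; rewrite unfold_pshift.
Qed.

Lemma pcong_pmapC f P Q : pcong P Q -> pcong (pmapC f P) (pmapC f Q).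
Proof.
elim => /=; eauto.
- by move=> P0 R Q0 hR _ IH1 _ IH2; apply: pc_trans IH1 IH2; rewrite proc_ok_pmapC.
- by move=> P0; rewrite pmapC_unfold.
Qed.

(** [proc_ok R] is needed at transitivity: the intermediate process must still have time-guarded
    recursion after the substitution. *)
Lemma pcong_psubst_l k R P Q : proc_ok R -> pcong P Q ->
  pcong (psubst k R P) (psubst k R Q).
Proof.
move=> hR H; elim: H k R hR => /=; eauto.
- move=> P0 R0 Q0 h _ IH1 _ IH2 k R hR; apply: pc_trans (IH1 k R hR) (IH2 k R hR).
  exact: proc_ok_psubst.
- by move=> r P0 Q0 _ IH k R hR; apply/pc_pref/IH; rewrite proc_ok_iter.
- by move=> p P0 P' Q0 Q' _ IH _ IH' k R hR; apply: pc_tout; auto; apply: IH; rewrite proc_ok_iter.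
- by move=> P0 Q0 _ IH k R hR; apply/pc_fix/IH; rewrite proc_ok_pshift.
- by move=> P0 k R hR; rewrite unfold_psubst.
Qed.

Lemma pcong_psubst_r k R R' P : pcong R R' -> pcong (psubst k R P) (psubst k R' P).
Proof.
elim: P k R R' => //= [r P IH|P IH Q IH'|p P IH Q IH'|b P IH Q IH'|X|P IH] k R R' h; auto.
- by apply/pc_pref/IH/pcong_iter.
- by apply: pc_tout; auto; apply/IH/pcong_iter.
- by case: eqP.
- by apply/pc_fix/IH/pcong_pshift.
Qed.

Lemma ptrans_psubst k R l P P' : ptrans l P P' -> ptrans l (psubst k R P) (psubst k R P').
Proof.
elim => /=; eauto; try by move=> *; rewrite psubst_vsubst; constructor.
by move=> l0 P0 Q _; rewrite unfold_psubst => IH; constructor.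
Qed.

(** Guardedness rules out that the moving subterm is the variable [k], and it passes to every
    subterm that can move before a tick. Induction is on the derivation, since unfolding enlarges
    the process; there [unfold_psubst] turns an unfolding of the substituted term into a
    substitution in the unfolding. *)
Lemma ptrans_psubst_inv k R l P T : tguarded k P -> ptrans l (psubst k R P) T ->
  exists2 P', ptrans l P P' & T = psubst k R P'.
Proof.
move E : (psubst k R P) => T0 hg H; elim: H k R P E hg => {l T0 T}.
- move=> c v P0 Q0 k R [] //= => [p P1 Q1|X].
    by case=> -> <- _ /= _; exists P1.
  by case: eqP => // _ _ /eqP.
- move=> c v P0 Q0 k R [] //= => [p P1 Q1|X].
    case=> -> <- _ /= _; exists (vsubst v P1) => //; by rewrite psubst_vsubst.
  by case: eqP => // _ _ /eqP.
- move=> s v P0 k R [] //= => [p P1|X].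
    case=> -> <- /= _; exists (vsubst v P1) => //; by rewrite psubst_vsubst.
  by case: eqP => // _ _ /eqP.
- move=> s v P0 k R [] //= => [p P1|X].
    by case=> -> <- /= _; exists P1.
  by case: eqP => // _ _ /eqP.
- move=> h P0 k R [] //= => [p P1|X].
    case=> -> <- /= _; exists (vsubst (VLoc h) P1) => //; by rewrite psubst_vsubst.
  by case: eqP => // _ _ /eqP.
- move=> c v P0 P0' Q0 Q0' _ IH1 _ IH2 hc k R [] //= => [P1 Q1|X].
    case=> e1 e2 /andP [g1 g2]; have [P2 h1 ->] := IH1 _ _ _ e1 g1.
    by have [Q2 h2 ->] := IH2 _ _ _ e2 g2; exists (PPar P2 Q2); eauto.
  by case: eqP => // _ _ /eqP.
- move=> c v P0 P0' Q0 Q0' _ IH1 _ IH2 hc k R [] //= => [P1 Q1|X].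
    case=> e1 e2 /andP [g1 g2]; have [P2 h1 ->] := IH1 _ _ _ e2 g2.
    by have [Q2 h2 ->] := IH2 _ _ _ e1 g1; exists (PPar Q2 P2); eauto.
  by case: eqP => // _ _ /eqP.
- move=> l P0 P0' Q0 _ IH1 k R [] //= => [P1 Q1|X].
    case=> e1 <- /andP [g1 g2]; have [P2 h1 ->] := IH1 _ _ _ e1 g1.
    by exists (PPar P2 Q1); eauto.
  by case: eqP => // _ _ /eqP.
- move=> l P0 P0' Q0 _ IH1 k R [] //= => [P1 Q1|X].
    case=> <- e1 /andP [g1 g2]; have [P2 h1 ->] := IH1 _ _ _ e1 g2.
    by exists (PPar P1 P2); eauto.
  by case: eqP => // _ _ /eqP.
- move=> l P0 Q0 _ IH k R [] //= => [X|P1].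
    by case: eqP => // _ _ /eqP.
  case=> e1 g1; have [||P2 h1 ->] := IH k R (unfold_fix P1); last by exists P2; eauto.
    by rewrite unfold_psubst e1.
  by apply: tguarded_psubst.
- move=> l b P0 Q0 P0' hb _ IH1 k R [] //= => [b1 P1 Q1|X].
    case=> eb e1 _ /andP [g1 g2]; have [P2 h1 ->] := IH1 _ _ _ e1 g1.
    by exists P2 => //; apply: pt_true => //; rewrite eb.
  by case: eqP => // _ _ /eqP.
- move=> l b P0 Q0 P0' hb _ IH1 k R [] //= => [b1 P1 Q1|X].
    case=> eb _ e1 /andP [g1 g2]; have [P2 h1 ->] := IH1 _ _ _ e1 g2.
    by exists P2 => //; apply: pt_false => //; rewrite eb.
  by case: eqP => // _ _ /eqP.
Qed.

(** In contrast to [ptrans_psubst], guardedness is required: an internal move of the substituted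
    composition has to be traced back to [P] in order to contradict the premise of [pk_par]. *)
Lemma ptick_psubst k R P P' : tguarded k P -> ptick P P' ->
  ptick (psubst k R P) (psubst k R P').
Proof.
move=> hg H; elim: H hg => /=; eauto.
- move=> P0 P0' Q Q' _ IH1 _ IH2 no /andP [g1 g2]; apply: pk_par; auto => T.
  move=> /(@ptrans_psubst_inv k R _ (PPar P0 Q)) [] /=; first by rewrite g1.
  by move=> T' /no.
- move=> P0 Q _; rewrite unfold_psubst => IH hg; constructor; apply: IH.
  by apply: tguarded_psubst.
- by move=> b P0 Q P0' hb _ IH /andP [g1 g2]; apply: pk_true => //; auto.
- by move=> b P0 Q P0' hb _ IH /andP [g1 g2]; apply: pk_false => //; auto.
Qed.

Lemma ptick_psubst_inv k R P T : tguarded k P -> ptick (psubst k R P) T ->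
  exists2 P', ptick P P' & T = psubst k R P'.
Proof.
move E : (psubst k R P) => T0 hg H; elim: H k R P E hg => {T0 T}.
- move=> k R [] //= => [_|X]; first by exists (PNil S).
  by case: eqP => // _ _ /eqP.
- move=> P0 k R [] //= => [p P1|X].
    by case=> -> <- /= _; exists P1.
  by case: eqP => // _ _ /eqP.
- move=> p P0 Q0 k R [] //= => [q P1 Q1|X].
    by case=> -> _ <- /= _; exists Q1.
  by case: eqP => // _ _ /eqP.
- move=> P0 P0' Q0 Q0' _ IH1 _ IH2 no k R [] //= => [P1 Q1|X].
    case=> e1 e2 /andP [g1 g2]; have [P2 h1 ->] := IH1 _ _ _ e1 g1.
    have [Q2 h2 ->] := IH2 _ _ _ e2 g2; exists (PPar P2 Q2) => //; apply: pk_par => // T.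
    by move/(ptrans_psubst k R) => /=; rewrite e1 e2 => /no.
  by case: eqP => // _ _ /eqP.
- move=> P0 Q0 _ IH k R [] //= => [X|P1].
    by case: eqP => // _ _ /eqP.
  case=> e1 g1; have [||P2 h1 ->] := IH k R (unfold_fix P1); last by exists P2; eauto.
    by rewrite unfold_psubst e1.
  by apply: tguarded_psubst.
- move=> b P0 Q0 P0' hb _ IH1 k R [] //= => [b1 P1 Q1|X].
    case=> eb e1 _ /andP [g1 g2]; have [P2 h1 ->] := IH1 _ _ _ e1 g1.
    by exists P2 => //; apply: pk_true => //; rewrite eb.
  by case: eqP => // _ _ /eqP.
- move=> b P0 Q0 P0' hb _ IH1 k R [] //= => [b1 P1 Q1|X].
    case=> eb _ e1 /andP [g1 g2]; have [P2 h1 ->] := IH1 _ _ _ e1 g2.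
    by exists P2 => //; apply: pk_false => //; rewrite eb.
  by case: eqP => // _ _ /eqP.
Qed.

Lemma proc_ok_ptrans l P P' : ptrans l P P' -> proc_ok P -> proc_ok P'.
Proof.
elim => //= {l P P'}; try by move=> *; rewrite ?proc_ok_pmapE; do ?[case/andP: H].
- by move=> c v P Q /andP [].
- by move=> c v P Q /andP [? _]; rewrite proc_ok_pmapE.
- by move=> c v P P' Q Q' _ IH1 _ IH2 _ /andP [/IH1 -> /IH2 ->].
- by move=> c v P P' Q Q' _ IH1 _ IH2 _ /andP [/IH2 -> /IH1 ->].
- by move=> l P P' Q _ IH /andP [/IH -> ->].
- by move=> l P P' Q _ IH /andP [-> /IH ->].
- by move=> l P Q _ IH h; exact/IH/proc_ok_unfold.
- by move=> l b P Q P' _ _ IH /andP [/IH].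
- by move=> l b P Q P' _ _ IH /andP [_ /IH].
Qed.

Lemma proc_ok_ptick P P' : ptick P P' -> proc_ok P -> proc_ok P'.
Proof.
elim => //= {P P'}.
- by move=> c v P /andP [].
- by move=> P P' Q Q' _ IH1 _ IH2 _ /andP [/IH1 -> /IH2 ->].
- by move=> P Q _ IH h; exact/IH/proc_ok_unfold.
- by move=> b P Q P' _ _ IH /andP [/IH].
- by move=> b P Q P' _ _ IH /andP [_ /IH].
Qed.

Lemma guard_isF (b : guard S) : guard_is b true -> guard_is b false -> False.
Proof.
case=> vs e1 h1 [ws e2 h2]; suff E : vs = ws by rewrite E h2 in h1.
have inj : injective (@Val S) by move=> x y [].
by apply: (inj_map inj); rewrite -e1 -e2.
Qed.

Definition psim P Q := forall l P', ptrans l P P' -> exists2 Q', ptrans l Q Q' & pcong P' Q'.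

Local Ltac pinv :=
  repeat match goal with H : ptrans _ (PPar _ _) _ |- _ => inversion H; subst; clear H end.

(** The move of the unfolding comes from a move of the body [P], which the body [Q] answers. What
    remains is to compare two substitution instances, and [psubst 0 (PFix P) Q1] lies between
    them. *)
Lemma pcong_fix_psim P Q : pcong P Q -> proc_ok (PFix P) -> proc_ok (PFix Q) ->
  psim P Q -> psim (PFix P) (PFix Q).
Proof.
move=> h okP okQ IH l T H; inversion H as [| | | | | | | | |l' P0 Q0 H' E1 E2 E3| |]; subst.
case/andP: (okP) => gP oP; case/andP: (okQ) => gQ oQ.
have [P1 h1 ->] := ptrans_psubst_inv gP H'; have [Q1 h2 h3] := IH _ _ h1.
exists (psubst 0 (PFix Q) Q1); first by apply/pt_fix/ptrans_psubst.
apply: pc_trans (pcong_psubst_l 0 okP h3) _.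
  by apply: proc_ok_psubst => //; exact: proc_ok_ptrans h2 oQ.
by apply/pcong_psubst_r/pc_fix.
Qed.

Local Ltac simall :=
  repeat match goal with
  | H : ptrans _ ?X _, A : psim ?X _ |- _ => case: (A _ _ H) => ? ? ?; clear H
  end.

(** Both directions are proved at once, so that symmetry of the congruence is a mere exchange. *)
Lemma pcong_ptrans_sym P Q : pcong P Q -> proc_ok P -> proc_ok Q -> psim P Q /\ psim Q P.
Proof.
elim=> {P Q} /=.
- by move=> P _ _; split=> l P' h; exists P'.
- by move=> P Q _ IH oP oQ; case: (IH oQ oP).
- move=> P R Q oR _ IH1 _ IH2 oP oQ; have [a1 a2] := IH1 oP oR; have [b1 b2] := IH2 oR oQ.
  split=> l T h.
    have [T1 h1 c1] := a1 _ _ h; have [T2 h2 c2] := b1 _ _ h1; exists T2 => //.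
    by apply: pc_trans c1 c2; exact: proc_ok_ptrans h1 oR.
  have [T1 h1 c1] := b2 _ _ h; have [T2 h2 c2] := a2 _ _ h1; exists T2 => //.
  by apply: pc_trans c1 c2; exact: proc_ok_ptrans h1 oR.
- by move=> r P Q h _ oP oQ; split=> l T H; inversion H; subst; eexists; eauto.
- move=> P P' Q Q' hP IHP hQ IHQ /andP [oP oQ] /andP [oP' oQ'].
  have [a1 a2] := IHP oP oP'; have [b1 b2] := IHQ oQ oQ'.
  split=> l T H; [clear a2 b2|clear a1 b1]; pinv; simall; by eexists; eauto.
- by move=> p P P' Q Q' hP _ hQ _ _ _; split=> l T H; inversion H; subst; eexists; eauto.
- move=> b P P' Q Q' hP IHP hQ IHQ /andP [oP oQ] /andP [oP' oQ'].
  have [a1 a2] := IHP oP oP'; have [b1 b2] := IHQ oQ oQ'.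
  split=> l T H; [clear a2 b2|clear a1 b1]; inversion H; subst; simall; by eexists; eauto.
- move=> P Q h IH oP oQ; case/andP: (oP) => gP oP'; case/andP: (oQ) => gQ oQ'.
  by have [a1 a2] := IH oP' oQ'; split; apply: pcong_fix_psim; auto.
- by move=> P Q _ _; split=> l T H; pinv; eexists; eauto.
- by move=> P Q R _ _; split=> l T H; pinv; eexists; eauto.
- move=> P _ _; split=> l T H; last by exists (PPar T (PNil S)); auto.
  inversion H; subst; try by match goal with H : ptrans _ (PNil S) _ |- _ => inversion H end.
  by eexists; eauto.
- move=> b P Q hb _ _; split=> l T H; last by exists T; eauto.
  inversion H; subst; first by exists T.
  by case: (guard_isF hb).
- move=> b P Q hb _ _; split=> l T H; last by exists T; eauto.
  inversion H; subst; last by exists T.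
  by case: (@guard_isF b).
- move=> P _ _; split=> l T H; last by exists T; eauto.
  by inversion H; subst; exists T.
Qed.

Lemma pcong_ptrans P Q l P' : pcong P Q -> proc_ok P -> proc_ok Q ->
  ptrans l P P' -> exists2 Q', ptrans l Q Q' & pcong P' Q'.
Proof. by move=> h oP oQ; have [H _] := pcong_ptrans_sym h oP oQ; exact: H. Qed.

Lemma ptick_stable P P' : ptick P P' -> forall R, ~ ptrans (LTau S) P R.
Proof.
elim=> {P P'} [|P|p P Q|P P' Q Q' _ _ _ _ no|||]; try by move=> R H; inversion H.
- exact: no.
- by move=> P Q _ IH R H; inversion H; subst; eapply IH; eauto.
- move=> b P Q P' hb _ IH R H; inversion H; subst; first by eapply IH; eauto.
  exact: (@guard_isF b).
- move=> b P Q P' hb _ IH R H; inversion H; subst; last by eapply IH; eauto.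
  exact: (@guard_isF b).
Qed.

Definition ptsim P Q := forall P', ptick P P' -> exists2 Q', ptick Q Q' & pcong P' Q'.

Lemma pcong_fix_ptsim P Q : pcong P Q -> proc_ok (PFix P) -> proc_ok (PFix Q) ->
  ptsim P Q -> ptsim (PFix P) (PFix Q).
Proof.
move=> h okP okQ IH T H; inversion H as [| | | |P0 Q0 H' E1 E2| |]; subst.
case/andP: (okP) => gP oP; case/andP: (okQ) => gQ oQ.
have [P1 h1 ->] := ptick_psubst_inv gP H'; have [Q1 h2 h3] := IH _ h1.
exists (psubst 0 (PFix Q) Q1); first by apply/pk_fix/ptick_psubst.
apply: pc_trans (pcong_psubst_l 0 okP h3) _.
  by apply: proc_ok_psubst => //; exact: proc_ok_ptick h2 oQ.
by apply/pcong_psubst_r/pc_fix.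
Qed.

Lemma pcong_stable P Q : pcong P Q -> proc_ok P -> proc_ok Q ->
  (forall R, ~ ptrans (LTau S) P R) -> forall R, ~ ptrans (LTau S) Q R.
Proof.
move=> h oP oQ no R H; have [R' h' _] := pcong_ptrans (pc_sym h) oQ oP H.
exact: no h'.
Qed.

Local Ltac tsimall :=
  repeat match goal with
  | H : ptick ?X _, A : ptsim ?X _ |- _ => case: (A _ H) => ? ? ?; clear H
  end.

Lemma pcong_ptick_sym P Q : pcong P Q -> proc_ok P -> proc_ok Q -> ptsim P Q /\ ptsim Q P.
Proof.
elim=> {P Q} /=.
- by move=> P _ _; split=> P' h; exists P'.
- by move=> P Q _ IH oP oQ; case: (IH oQ oP).
- move=> P R Q oR _ IH1 _ IH2 oP oQ; have [a1 a2] := IH1 oP oR; have [b1 b2] := IH2 oR oQ.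
  split=> T h.
    have [T1 h1 c1] := a1 _ h; have [T2 h2 c2] := b1 _ h1; exists T2 => //.
    by apply: pc_trans c1 c2; exact: proc_ok_ptick h1 oR.
  have [T1 h1 c1] := b2 _ h; have [T2 h2 c2] := a2 _ h1; exists T2 => //.
  by apply: pc_trans c1 c2; exact: proc_ok_ptick h1 oR.
- by move=> r P Q h _ oP oQ; split=> T H; inversion H; subst; eexists; eauto.
- move=> P P' Q Q' hP IHP hQ IHQ /andP [oP oQ] /andP [oP' oQ'].
  have [a1 a2] := IHP oP oP'; have [b1 b2] := IHQ oQ oQ'.
  split=> T H; inversion H as [| | |X1 X2 X3 X4 H1 H2 no| | |]; subst.
    have [P1 ? ?] := a1 _ H1; have [Q1 ? ?] := b1 _ H2.
    exists (PPar P1 Q1); auto; apply: pk_par => //.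
    by apply: pcong_stable no; rewrite /= ?oP ?oQ ?oP' ?oQ' //; auto.
  have [P1 ? ?] := a2 _ H1; have [Q1 ? ?] := b2 _ H2.
  exists (PPar P1 Q1); auto; apply: pk_par => //.
  by apply: pcong_stable no; rewrite /= ?oP ?oQ ?oP' ?oQ' //; auto.
- by move=> p P P' Q Q' hP _ hQ _ _ _; split=> T H; inversion H; subst; eexists; eauto.
- move=> b P P' Q Q' hP IHP hQ IHQ /andP [oP oQ] /andP [oP' oQ'].
  have [a1 a2] := IHP oP oP'; have [b1 b2] := IHQ oQ oQ'.
  split=> T H; [clear a2 b2|clear a1 b1]; inversion H; subst; tsimall; by eexists; eauto.
- move=> P Q h IH oP oQ; case/andP: (oP) => gP oP'; case/andP: (oQ) => gQ oQ'.
  by have [a1 a2] := IH oP' oQ'; split; apply: pcong_fix_ptsim; auto.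
- move=> P Q /andP [oP oQ] _; split=> T H; inversion H as [| | |? P' ? Q' H1 H2 no| | |]; subst;
  exists (PPar Q' P'); auto; apply: pk_par => //; apply: pcong_stable no;
  rewrite /= ?oP ?oQ //; auto.
- move=> P Q R /and3P [oP oQ oR] _.
  have ok1 : proc_ok (PPar P (PPar Q R)) by rewrite /= oP oQ.
  have ok2 : proc_ok (PPar (PPar P Q) R) by rewrite /= oP oQ.
  split=> T H.
    inversion H as [| | |? P' ? X H1 H2 no| | |]; subst.
    inversion H2 as [| | |? Q' ? R' H3 H4 no'| | |]; subst.
    have no2 := pcong_stable (pc_parA P Q R) ok1 ok2 no.
    exists (PPar (PPar P' Q') R'); auto; apply: pk_par => //.
    (* The inner composition is stable because any internal move of it would be one of the whole. *)
    by apply: pk_par => // T h; exact: no2 (pt_parL R h).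
  inversion H as [| | |? X ? R' H1 H2 no| | |]; subst.
  inversion H1 as [| | |? P' ? Q' H3 H4 no'| | |]; subst.
  have no2 := pcong_stable (pc_sym (pc_parA P Q R)) ok2 ok1 no.
  exists (PPar P' (PPar Q' R')); auto; apply: pk_par => //.
  by apply: pk_par => // T h; exact: no2 (pt_parR P h).
- move=> P oP _; split=> T H; last first.
    exists (PPar T (PNil S)); auto; apply: pk_par => // R h; inversion h; subst;
      try (by match goal with H : ptrans _ (PNil S) _ |- _ => inversion H end).
    by eapply (ptick_stable H); eauto.
  inversion H as [| | |X1 X2 X3 X4 H1 H2 no| | |]; subst.
  by inversion H2; subst; eexists; eauto.
- move=> b P Q hb _ _; split=> T H; last by exists T; eauto.
  inversion H; subst; first by exists T.
  by case: (guard_isF hb).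
- move=> b P Q hb _ _; split=> T H; last by exists T; eauto.
  inversion H; subst; last by exists T.
  by case: (@guard_isF b).
- move=> P _ _; split=> T H; last by exists T; eauto.
  by inversion H; subst; exists T.
Qed.

Lemma pcong_ptick P Q P' : pcong P Q -> proc_ok P -> proc_ok Q ->
  ptick P P' -> exists2 Q', ptick Q Q' & pcong P' Q'.
Proof. by move=> h oP oQ; have [H _] := pcong_ptick_sym h oP oQ; exact: H. Qed.

End Processes.

(** * Well-formedness *)

Section WellFormedness.

Variable S : cait.
Implicit Types (P Q R : proc S) (I J : iface S) (M N : net S) (x y : nodeT S).

(** Merges the conditions of [node_ok] on sensors and on actuators into one [has_ipre] test, so that
    a single preservation argument covers both. *)
Definition undefined_pre I (r : ipre S) : bool :=
  match r with
  | ISens s => ~~ isens I s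
  | IAct a _ => ~~ iact I a
  | _ => false
  end.

(** The share of [node_ok] that depends on the process; the remainder, [iface_ok], is untouched when
    only the process moves. *)
Definition pwf I P : bool :=
  [&& pclosed P, proc_ok P & ~~ has_ipre (undefined_pre I) P].

Lemma undefined_pre_blind I : expr_blind (undefined_pre I).
Proof. by move=> h []. Qed.

Lemma has_ipre_ex (p : ipre S -> bool) P : has_ipre p P ->
  exists2 r, p r & forall q : ipre S -> bool, q r -> has_ipre q P.
Proof.
elim: P => //= [r P IH|P IH Q IH'|c P IH Q IH'|b P IH Q IH'].
- case/orP => [h|/IH [r' h h']]; first by exists r => // q ->.
  by exists r' => // q /h' ->; rewrite orbT.
all: case/orP => [/IH|/IH'] [r h h']; exists r => // q /h' ->; by rewrite ?orbT.
Qed.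

Lemma has_ipre_sub (p q : ipre S -> bool) P :
  (forall r, p r -> q r) -> has_ipre p P -> has_ipre q P.
Proof. by move=> H /has_ipre_ex [r /H h]; exact. Qed.

Lemma undefined_preP I P :
  ~~ has_ipre (undefined_pre I) P <->
  (forall s, reads s P -> isens I s <> None) /\ (forall a, writes a P -> iact I a <> None).
Proof.
split=> [h|[h1 h2]].
  split=> [s|a] h' E; move/negP: h; apply; apply: has_ipre_sub h'.
    by case=> //= t /eqP ->; rewrite E.
  by case=> //= t e /eqP ->; rewrite E.
apply/negP => /has_ipre_ex [[||s|a e] //= h H].
  by apply: (h1 s); [apply: H; rewrite /= | move: h; case: isens].
by apply: (h2 a); [apply: H; rewrite /= | move: h; case: iact].
Qed.

Definition iface_ok x : Prop :=
  (forall s, locdep s -> isens (niface x) s <> None -> nmob x = Stationary) /\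
  (forall s v, isens (niface x) s = Some v -> sdom s v).

Lemma node_okE x : node_ok x <-> pwf (niface x) (nproc x) /\ iface_ok x.
Proof.
rewrite /pwf /iface_ok; split=> [[/andP [-> ->] h1 h2 h3 h4]|[/and3P [h1 h2 /undefined_preP [h3 h4]] [h5 h6]]].
  by split=> //=; apply/undefined_preP.
by split=> //; rewrite h1 h2.
Qed.

Lemma pwf_par I P Q : pwf I (PPar P Q) = pwf I P && pwf I Q.
Proof.
rewrite /pwf /pclosed /= negb_or.
by case: (pscoped 0 0 P); case: (proc_ok P); rewrite //= ?andbF // andbCA andbA;
  case: (pscoped 0 0 Q); case: (proc_ok Q); rewrite //= ?andbF.
Qed.

Lemma pwf_ok I P : pwf I P -> proc_ok P.
Proof. by case/and3P. Qed.

Lemma pwf_vsubst I v P :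
  pscoped 0 1 P -> proc_ok P -> ~~ has_ipre (undefined_pre I) P -> pwf I (vsubst v P).
Proof.
move=> h1 h2 h3; rewrite /pwf pclosed_vsubst // proc_ok_pmapE h2.
by rewrite has_ipre_pmapE //; exact: undefined_pre_blind.
Qed.

Lemma pwf_unfold I P : pwf I (PFix P) -> pwf I (unfold_fix P).
Proof.
case/and3P => h1 h2 h3; rewrite /pwf pclosed_unfold // proc_ok_unfold //=.
apply: contra h3 => /has_ipre_psubst -/(_ (@undefined_pre_blind I)).
by rewrite /= orbb.
Qed.

Lemma pwf_cond I b P Q : pwf I (PCond b P Q) -> pwf I P && pwf I Q.
Proof.
rewrite -pwf_par /pwf /pclosed /= => /and3P [/and3P [_ -> ->] -> ->] //.
Qed.

Lemma pwf_tout I p P Q : pwf I (PTout p P Q) ->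
  [/\ pscoped 0 (cbind p) P, proc_ok P, ~~ has_ipre (undefined_pre I) P & pwf I Q].
Proof.
rewrite /pwf /pclosed /= => /and3P [/and3P [_ h1 ->] /andP [-> ->]].
by rewrite negb_or => /andP [-> ->]; rewrite addn0 in h1.
Qed.

Lemma pwf_pref I r P : pwf I (PPref r P) ->
  [/\ pscoped 0 (ibind r) P, proc_ok P, ~~ has_ipre (undefined_pre I) P & ~~ undefined_pre I r].
Proof.
rewrite /pwf /pclosed /= => /and3P [/andP [_ h1] ->].
by rewrite negb_or => /andP [-> ->]; rewrite addn0 in h1.
Qed.

Lemma pwf_ptrans I l P P' : ptrans l P P' -> pwf I P -> pwf I P'.
Proof.
elim=> {l P P'}.
- by move=> c v P Q /pwf_tout [h1 h2 h3 _]; apply/and3P.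
- by move=> c v P Q /pwf_tout [h1 h2 h3 _]; apply: pwf_vsubst.
- by move=> s v P /pwf_pref [h1 h2 h3 _]; apply: pwf_vsubst.
- by move=> a v P /pwf_pref [h1 h2 h3 _]; apply/and3P.
- by move=> h P /pwf_pref [h1 h2 h3 _]; apply: pwf_vsubst.
- by move=> c v P P' Q Q' _ IH1 _ IH2 _; rewrite !pwf_par => /andP [/IH1 -> /IH2 ->].
- by move=> c v P P' Q Q' _ IH1 _ IH2 _; rewrite !pwf_par => /andP [/IH2 -> /IH1 ->].
- by move=> l P P' Q _ IH; rewrite !pwf_par => /andP [/IH -> ->].
- by move=> l P P' Q _ IH; rewrite !pwf_par => /andP [-> /IH ->].
- by move=> l P Q _ IH /pwf_unfold.
- by move=> l b P Q P' _ _ IH /pwf_cond /andP [/IH].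
- by move=> l b P Q P' _ _ IH /pwf_cond /andP [_ /IH].
Qed.

Lemma pwf_ptick I P P' : ptick P P' -> pwf I P -> pwf I P'.
Proof.
elim=> {P P'} //.
- by move=> p P Q /pwf_tout [_ _ _].
- by move=> P P' Q Q' _ IH1 _ IH2 _; rewrite !pwf_par => /andP [/IH1 -> /IH2 ->].
- by move=> P Q _ IH /pwf_unfold.
- by move=> b P Q P' _ _ IH /pwf_cond /andP [/IH].
- by move=> b P Q P' _ _ IH /pwf_cond /andP [_ /IH].
Qed.

Lemma pwf_act I a v P P' : ptrans (LAct a v) P P' -> pwf I P -> iact I a.
Proof.
move E : (LAct a v) => l H; elim: H E => {l P P'} //.
- by move=> b w P [-> _] /pwf_pref [_ _ _]; rewrite negbK.
- by move=> l P P' Q _ IH E; rewrite pwf_par => /andP [/(IH E)].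
- by move=> l P P' Q _ IH E; rewrite pwf_par => /andP [_ /(IH E)].
- by move=> l P Q _ IH E /pwf_unfold /(IH E).
- by move=> l b P Q P' _ _ IH E /pwf_cond /andP [/(IH E)].
- by move=> l b P Q P' _ _ IH E /pwf_cond /andP [_ /(IH E)].
Qed.

(** Only definedness is tested, so overwriting an existing entry of the interface is harmless. *)
Lemma eq_pwf I J P : (forall s, isens I s = isens J s :> bool) ->
  (forall a, iact I a = iact J a :> bool) -> pwf I P = pwf J P.
Proof.
move=> h1 h2; rewrite /pwf; congr [&& _, _ & ~~ _].
by apply/idP/idP; apply: has_ipre_sub => -[||s|a e] //=; rewrite ?h1 ?h2.
Qed.

Lemma pwf_pmapC I f P : pwf I (pmapC f P) = pwf I P.
Proof. by rewrite /pwf /pclosed pscoped_pmapC proc_ok_pmapC has_ipre_pmapC. Qed.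

(* The part of a node on which the conditions of [network] relating different
   nodes depend. *)
Definition dom_of (n : nodename S) I :=
  (n, fun a => isSome (iact I a), fun s => isSome (isens I s)).
Definition dom x := dom_of (nname x) (niface x).

Definition dom_ok (D : seq (nodename S * (actuator S -> bool) * (sensor S -> bool))) : Prop :=
  [/\ uniq (map (fun d => d.1.1) D),
      forall d e a, List.In d D -> List.In e D -> d.1.1 <> e.1.1 -> d.1.2 a -> ~~ e.1.2 a
    & forall d e s, List.In d D -> List.In e D -> d.1.1 <> e.1.1 -> ~~ locdep s ->
        d.2 s -> ~~ e.2 s].

Lemma networkE M :
  network M <-> (forall x, List.In x (nodes M) -> node_ok x) /\ dom_ok (map dom (nodes M)).
Proof.
have inm d : List.In d (map dom (nodes M)) -> exists2 x, List.In x (nodes M) & d = dom x.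
  by move/List.in_map_iff => [x [<- h]]; exists x.
have isN T (o : option T) : (o <> None) <-> o by case: o.
have eqN T (o : option T) : (o = None) <-> ~~ o by case: o.
split=> [[h1 h2 h3 h4]|[h1 [h2 h3 h4]]]; split=> //.
- split; first by rewrite -map_comp.
    move=> d e a /inm [x hx ->] /inm [y hy ->] /= hn /isN h; apply/eqN.
    exact: (h3 x y).
  move=> d e s /inm [x hx ->] /inm [y hy ->] /= hn hs /isN h; apply/eqN.
  exact: (h4 x y).
- by rewrite -map_comp in h2.
- move=> x y a hx hy hn /isN h; apply/eqN.
  by apply: (h3 (dom x) (dom y)) => //; apply: List.in_map.
- move=> x y s hx hy hn hs /isN h; apply/eqN.
  by apply: (h4 (dom x) (dom y)) => //; apply: List.in_map.
Qed.

Lemma Permutation_perm_eq (T : eqType) (s t : seq T) : Permutation s t -> perm_eq s t.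
Proof.
elim=> {s t} //.
- by move=> z s t _; rewrite perm_cons.
- by move=> z t s; rewrite (perm_catCA [:: t] [:: z] s).
- by move=> s t u _ h1 _ h2; exact: seq.perm_trans h1 h2.
Qed.

Lemma dom_ok_perm D D' : Permutation D D' -> dom_ok D -> dom_ok D'.
Proof.
move=> hp [h1 h2 h3]; have hi d : List.In d D' -> List.In d D.
  by apply: Permutation_in; exact: Permutation_sym.
split; last 2 first.
- by move=> d e a /hi hd /hi he; exact: h2.
- by move=> d e s /hi hd /hi he; exact: h3.
by rewrite -(perm_uniq (Permutation_perm_eq (Permutation_map (fun d => d.1.1) hp))).
Qed.

(** The conditions relating different nodes depend only on the multiset of [dom], which moves,
    updates and congruence leave unchanged; what is left to check is local to each node. *)
Lemma network_perm M N :
  Permutation (map dom (nodes M)) (map dom (nodes N)) -> network M ->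
  (forall x, List.In x (nodes N) -> node_ok x) -> network N.
Proof. by move=> hp /networkE [_ /(dom_ok_perm hp) h] hN; apply/networkE. Qed.

Lemma network_parL M N : network (NPar M N) -> network M.
Proof.
case=> h1 h2 h3 h4; have hi x : List.In x (nodes M) -> List.In x (nodes (NPar M N)).
  by move=> h; apply/List.in_app_iff; left.
split; eauto.
by move: h2; rewrite /= map_cat cat_uniq => /andP [].
Qed.

Lemma network_parR M N : network (NPar M N) -> network N.
Proof.
case=> h1 h2 h3 h4; have hi x : List.In x (nodes N) -> List.In x (nodes (NPar M N)).
  by move=> h; apply/List.in_app_iff; right.
split; eauto.
by move: h2; rewrite /= map_cat cat_uniq => /and3P [].
Qed.

Definition all_ok M := forall x, List.In x (nodes M) -> node_ok x.

Lemma all_ok_par M N : all_ok (NPar M N) <-> all_ok M /\ all_ok N.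
Proof.
split=> [h|[h1 h2] x /List.in_app_iff [/h1|/h2] //].
by split=> x hx; apply: h; apply/List.in_app_iff; auto.
Qed.

Lemma all_ok_node n I P mu h : all_ok (Node n I P mu h) <-> node_ok (MkNode n I P mu h).
Proof. by split=> [H|H x [<-|[]]] //; apply: H; left. Qed.

Lemma network_all_ok M : network M -> all_ok M.
Proof. by case. Qed.

Lemma network_node n I P mu h : network (Node n I P mu h) <-> node_ok (MkNode n I P mu h).
Proof.
split=> [/network_all_ok /all_ok_node //|H]; split=> //; first by move/all_ok_node: H.
  by move=> x y a [<-|[]] // [<-|[]].
by move=> x y s [<-|[]] // [<-|[]].
Qed.

Lemma network_pwf n I P mu h : network (Node n I P mu h) -> pwf I P.
Proof. by move/network_node/node_okE => -[]. Qed.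

Lemma node_ok_pwf n I P mu h Q : node_ok (MkNode n I P mu h) -> pwf I Q ->
  node_ok (MkNode n I Q mu h).
Proof. by move=> /node_okE [_ h2] h1; apply/node_okE. Qed.

Lemma dom_upd_act n I a v : iact I a -> dom_of n (upd_act I a v) = dom_of n I.
Proof.
rewrite /dom_of /= => h; congr (_, _, _); apply: functional_extensionality => b.
by case: eqP => // ->.
Qed.

Lemma ntrans_wf l M M' : ntrans l M M' -> all_ok M ->
  all_ok M' /\ map dom (nodes M') = map dom (nodes M).
Proof.
elim=> {l M M'}.
1,2,3,5,6,7: by move=> *;
  match goal with H : ptrans _ _ _, K : all_ok _ |- _ =>
    split=> //; move/all_ok_node: K => K; apply/all_ok_node; apply: (node_ok_pwf K);
    case/node_okE: K => K _; exact: pwf_ptrans H K end.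
- move=> n I a v P P' mu h _ H /all_ok_node /node_okE [/= h1 [h2 h3]].
  have ha := pwf_act H h1; split; last by rewrite /= /dom /= dom_upd_act.
  apply/all_ok_node/node_okE; split=> //=.
  rewrite -(@eq_pwf I) // ?(pwf_ptrans H) // => b /=; by case: eqP => // ->.
- move=> c v k h M M' N N' _ IH1 _ IH2 _ /all_ok_par [/IH1 [h1 e1] /IH2 [h2 e2]].
  by rewrite /= !map_cat e1 e2; split=> //; apply/all_ok_par.
- move=> c v k h M M' N N' _ IH1 _ IH2 _ /all_ok_par [/IH2 [h1 e1] /IH1 [h2 e2]].
  by rewrite /= !map_cat e1 e2; split=> //; apply/all_ok_par.
- move=> l M M' N _ IH /all_ok_par [/IH [h1 e1] h2].
  by rewrite /= !map_cat e1; split=> //; apply/all_ok_par.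
- move=> l M M' N _ IH /all_ok_par [h2 /IH [h1 e1]].
  by rewrite /= !map_cat e1; split=> //; apply/all_ok_par.
- by [].
Qed.

Lemma network_ntrans l M M' : ntrans l M M' -> network M -> network M'.
Proof.
move=> H hM; have [h1 h2] := ntrans_wf H (network_all_ok hM).
by apply: network_perm hM h1; rewrite h2.
Qed.

Lemma ntick_wf M M' : ntick M M' -> all_ok M ->
  all_ok M' /\ map dom (nodes M') = map dom (nodes M).
Proof.
elim=> {M M'}.
- move=> n I P P' h H _ /all_ok_node K; split=> //; apply/all_ok_node; apply: (node_ok_pwf K).
  by case/node_okE: K => K _; exact: pwf_ptick H K.
- move=> n I P P' h k H _ _ /all_ok_node /node_okE [/= h1 h2]; split=> //.
  by apply/all_ok_node/node_okE; split=> //=; exact: pwf_ptick H h1.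
- move=> M M' N N' _ IH1 _ IH2 _ /all_ok_par [/IH1 [h1 e1] /IH2 [h2 e2]].
  by rewrite /= !map_cat e1 e2; split=> //; apply/all_ok_par.
- by [].
- by [].
Qed.

Lemma network_ntick M M' : ntick M M' -> network M -> network M'.
Proof.
move=> H hM; have [h1 h2] := ntick_wf H (network_all_ok hM).
by apply: network_perm hM h1; rewrite h2.
Qed.

Lemma sens_update_wf s h v M : sdom s v -> all_ok M ->
  all_ok (sens_update s h v M) /\
  map dom (nodes (sens_update s h v M)) = map dom (nodes M).
Proof.
move=> hv; elim: M => [|[n I P mu k]|M IH1 N IH2|c M IH] //=.
  case: ifP => [/andP [_ hs]|_] // /all_ok_node /node_okE [/= h1 [h2 h3]]; split.
    apply/all_ok_node/node_okE; split=> /=.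
      by rewrite -(@eq_pwf I) // => t /=; case: eqP => // ->.
    split=> /= t; case: eqP => [->|_]; eauto.
      by move=> hl _; apply: (h2 s) => //; case: isens hs.
    by move=> w [<-].
  rewrite /dom /dom_of /=; congr [:: (_, _, _)].
  by apply: functional_extensionality => t; case: eqP => // ->.
move=> /all_ok_par [/IH1 [h1 e1] /IH2 [h2 e2]].
by rewrite /= !map_cat e1 e2; split=> //; apply/all_ok_par.
Qed.

Lemma network_sens_update s h v M : sdom s v -> network M -> network (sens_update s h v M).
Proof.
move=> hv hM; have [h1 h2] := sens_update_wf h hv (network_all_ok hM).
by apply: network_perm hM h1; rewrite h2.
Qed.

Lemma network_nmapC f M : network M -> network (nmapC f M).
Proof.
move=> hM; have H : map dom (nodes (nmapC f M)) = map dom (nodes M).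
  by elim: M {hM} => //= M IH1 N IH2; rewrite !map_cat IH1 IH2.
apply: (network_perm _ hM); first by rewrite H.
elim: M {hM H} (network_all_ok hM) => [|[n I P mu k]|M IH1 N IH2|c M IH] //.
  move/all_ok_node/node_okE => [h1 h2]; apply/all_ok_node/node_okE; split=> //=.
  by rewrite pwf_pmapC.
by case/all_ok_par => /IH1 h1 /IH2 h2; apply/all_ok_par.
Qed.

Definition key x := (nname x, niface x, nmob x, nloc x).

Lemma map_dom_key (L : seq (nodeT S)) :
  map dom L = map (fun k => dom_of k.1.1.1 k.1.1.2) (map key L).
Proof. by rewrite -map_comp. Qed.

Lemma key_nmapC f M : map key (nodes (nmapC f M)) = map key (nodes M).
Proof. by elim: M => //= M IH1 N IH2; rewrite !map_cat IH1 IH2. Qed.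

(** The laws rearrange nodes and rewrite processes and channels, but never touch a name, interface,
    mobility or location. Well-formedness of compositions and the analysis of barbs both use this
    invariant. *)
Lemma ncong_key M N : ncong M N -> Permutation (map key (nodes M)) (map key (nodes N)).
Proof.
elim=> {M N} /=; rewrite ?map_cat.
- by move=> M; exact: Permutation_refl.
- by move=> M N _; exact: Permutation_sym.
- by move=> M O N _ _ h1 _ h2; exact: Permutation_trans h1 h2.
- by move=> M M' N N' _ h1 _ h2; rewrite !map_cat; exact: Permutation_app.
- by [].
- by move=> *; exact: Permutation_refl.
- by move=> M N; rewrite !map_cat; exact: Permutation_app_comm.
- by move=> M N O; rewrite !map_cat catA; exact: Permutation_refl.
- by move=> M; rewrite cats0; exact: Permutation_refl.
- by move=> *; exact: Permutation_refl.
- by move=> *; exact: Permutation_refl.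
- by move=> *; exact: Permutation_refl.
- by move=> c d M _ _; rewrite key_nmapC; exact: Permutation_refl.
Qed.

Lemma ncong_dom M N : ncong M N -> Permutation (map dom (nodes M)) (map dom (nodes N)).
Proof. by move/ncong_key => h; rewrite !map_dom_key; exact: Permutation_map. Qed.

Lemma network_congL M M' N : ncong M M' -> network M' -> network (NPar M N) ->
  network (NPar M' N).
Proof.
move=> h hM' hMN; apply: (network_perm _ hMN).
  by rewrite /= !map_cat; apply: Permutation_app_tail; exact: ncong_dom.
by apply/all_ok_par; split; apply: network_all_ok => //; exact: network_parR hMN.
Qed.

Lemma network_parC M N : network (NPar M N) -> network (NPar N M).
Proof.
move=> h; apply: (network_perm _ h); first exact/ncong_dom/nc_parC.
by apply/all_ok_par; case/network_all_ok/all_ok_par: h.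
Qed.

Lemma network_parA M N O : network (NPar M (NPar N O)) <-> network (NPar (NPar M N) O).
Proof. by rewrite /network /= catA. Qed.

Lemma network_par0 M : network M -> network (NPar M (NZero S)).
Proof. by rewrite /network /= cats0. Qed.

End WellFormedness.

(** * Renaming of channels *)

Section Renamings.

Variable S : cait.
Implicit Types (P Q R : proc S) (M N : net S) (c d e : chan S).

Hint Constructors ptrans ptick ntrans ntick : core.

Lemma cswapK c d : involutive (cswap c d).
Proof.
move=> e; rewrite /cswap; have [->|h1] := eqVneq e c.
  by have [->|h] := eqVneq d c; rewrite ?eqxx.
by have [->|h2] := eqVneq e d; rewrite ?eqxx // (negbTE h1) (negbTE h2).
Qed.

Lemma cswap_out c d e : e != c -> e != d -> cswap c d e = e.
Proof. by rewrite /cswap => /negbTE -> /negbTE ->. Qed.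

Lemma rng_cswap c d e : rng d = rng c -> rng (cswap c d e) = rng e.
Proof. by move=> hr; rewrite /cswap; case: eqP => [->|_] //; case: eqP => [->|]. Qed.

Definition plabC (f : chan S -> chan S) (l : plab S) : plab S :=
  match l with LOut c v => LOut (f c) v | LIn c v => LIn (f c) v | _ => l end.

Definition nlabC (f : chan S -> chan S) (l : nlab S) : nlab S :=
  match l with NLOut c v h => NLOut (f c) v h | NLIn c v h => NLIn (f c) v h | _ => l end.

(** * Moves and ticks under renamings that preserve ranges *)

Section RangePreserving.

Variable f : chan S -> chan S.
Hypothesis rngf : forall c, rng (f c) = rng c.

Lemma ptrans_pmapC l P P' : ptrans l P P' -> ptrans (plabC f l) (pmapC f P) (pmapC f P').
Proof.
elim=> //= {l P P'}; eauto; try by move=> *; rewrite pmapC_pmapE; constructor.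
- by move=> c v P P' Q Q' _ h1 _ h2 hc; apply: pt_comL h1 h2 _; rewrite rngf.
- by move=> c v P P' Q Q' _ h1 _ h2 hc; apply: pt_comR h1 h2 _; rewrite rngf.
- by move=> l P Q _; rewrite pmapC_unfold; eauto.
Qed.

(** Injectivity serves at a restriction: a label on another channel must not be sent to the
    restricted one. *)
Lemma ntrans_nmapC l M M' : injective f ->
  ntrans l M M' -> ntrans (nlabC f l) (nmapC f M) (nmapC f M').
Proof.
move=> injf; elim=> //= {l M M'}; eauto.
1-7: by move=> *; match goal with H : ptrans _ _ _ |- _ => move/ptrans_pmapC: H => /= H end;
  econstructor; rewrite ?rngf; eauto.
- by move=> c v k h M M' N N' _ h1 _ h2 hd; apply: nt_glbcomL h1 h2 _; rewrite rngf.
- by move=> c v k h M M' N N' _ h1 _ h2 hd; apply: nt_glbcomR h1 h2 _; rewrite rngf.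
- move=> l c M M' _ h hl; constructor => //.
  by case: l hl {h} => //= d v k; rewrite (inj_eq injf).
Qed.

Hypothesis fK : involutive f.

Lemma pmapCK P : pmapC f (pmapC f P) = P.
Proof. by rewrite pmapC_comp pmapC_id. Qed.

Lemma nmapCK M : nmapC f (nmapC f M) = M.
Proof.
elim: M => //= [[n I P mu h]|M -> N ->|c M ->] //=; first by rewrite pmapCK.
by rewrite fK.
Qed.

(** To transfer the negative premise, a move of the renamed process is renamed back. This is why [f]
    is assumed to be an involution, as swaps are. *)
Lemma ptick_pmapC P P' : ptick P P' -> ptick (pmapC f P) (pmapC f P').
Proof.
elim=> //= {P P'}; eauto.
- move=> P P' Q Q' _ h1 _ h2 no; apply: pk_par => // R /ptrans_pmapC /=.
  by rewrite !pmapCK => /no.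
- by move=> P Q _; rewrite pmapC_unfold; eauto.
Qed.

Lemma no_ntau_nmapC M : no_ntau M -> no_ntau (nmapC f M).
Proof. by move=> no M' /(ntrans_nmapC (inv_inj fK)) /=; rewrite nmapCK => /no. Qed.

Lemma ntick_nmapC M M' : ntick M M' -> ntick (nmapC f M) (nmapC f M').
Proof.
elim=> //= {M M'}; eauto.
- by move=> n I P P' h /ptick_pmapC h1 /no_ntau_nmapC h2; constructor.
- by move=> n I P P' h k /ptick_pmapC h1 /no_ntau_nmapC h2 hd; constructor.
- by move=> M M' N N' _ h1 _ h2 /no_ntau_nmapC h3; constructor.
Qed.

End RangePreserving.

Lemma nmapC_comp (f g : chan S -> chan S) M : nmapC f (nmapC g M) = nmapC (f \o g) M.
Proof.
by elim: M => //= [[n I P mu h]|M -> N ->|c M ->] //=; rewrite pmapC_comp.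
Qed.

Lemma nmapC_id M : nmapC id M = M.
Proof.
by elim: M => //= [[n I P mu h]|M -> N ->|c M ->] //=; rewrite pmapC_id.
Qed.

Lemma nfree_nmapC (f : chan S -> chan S) M : injective f ->
  nfree (nmapC f M) = map f (nfree M).
Proof.
move=> injf; elim: M => //= [x|M -> N ->|c M ->].
- by rewrite pchans_pmapC.
- by rewrite map_cat.
- by rewrite filter_map; congr map; apply: eq_filter => d /=; rewrite (inj_eq injf).
Qed.

Lemma pchans_ptrans l P P' : ptrans l P P' -> {subset pchans P' <= pchans P}.
Proof.
have sub P0 Q0 P1 Q1 : {subset pchans P1 <= pchans P0} -> {subset pchans Q1 <= pchans Q0} ->
    {subset pchans P1 ++ pchans Q1 <= pchans P0 ++ pchans Q0}.
  by move=> h1 h2 c; rewrite !mem_cat => /orP [/h1|/h2] ->; rewrite ?orbT.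
have vsub v P0 : pchans (vsubst v P0) = pchans P0 by exact: pchans_pmapE.
elim=> //= {l P P'}.
- by move=> c v P Q d h; rewrite in_cons mem_cat h orbT.
- by move=> c v P Q d; rewrite vsub => h; rewrite in_cons mem_cat h orbT.
- by move=> s v P d; rewrite vsub.
- by move=> a v P d.
- by move=> h P d; rewrite vsub.
- by move=> c v P P' Q Q' _ h1 _ h2 _; exact: sub.
- by move=> c v P P' Q Q' _ h1 _ h2 _; exact: sub.
- by move=> l P P' Q _ h; exact: sub.
- by move=> l P P' Q _ h; exact: sub.
- by move=> l P Q _ h c /h; exact: pchans_unfold.
- by move=> l b P Q P' _ _ h c /h; rewrite mem_cat => ->.
- by move=> l b P Q P' _ _ h c /h; rewrite mem_cat orbC => ->.
Qed.

Lemma pchans_ptick P P' : ptick P P' -> {subset pchans P' <= pchans P}.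
Proof.
elim=> //= {P P'}.
- by move=> P c.
- by move=> p P Q c h; rewrite in_cons mem_cat h !orbT.
- by move=> P P' Q Q' _ h1 _ h2 _ c; rewrite !mem_cat => /orP [/h1|/h2] ->; rewrite ?orbT.
- by move=> P Q _ h c /h; exact: pchans_unfold.
- by move=> b P Q P' _ _ h c /h; rewrite mem_cat => ->.
- by move=> b P Q P' _ _ h c /h; rewrite mem_cat orbC => ->.
Qed.

Definition plab_on c (l : plab S) : bool :=
  match l with LOut d _ | LIn d _ => d == c | _ => false end.

Lemma plab_on_chans c l P P' : ptrans l P P' -> plab_on c l -> c \in pchans P.
Proof.
elim=> //= {l P P'}.
- by move=> d v P Q /eqP ->; rewrite mem_head.
- by move=> d v P Q /eqP ->; rewrite mem_head.
- by move=> l P P' Q _ h /h; rewrite mem_cat => ->.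
- by move=> l P P' Q _ h /h; rewrite mem_cat orbC => ->.
- by move=> l P Q _ h /h; exact: pchans_unfold.
- by move=> l b P Q P' _ _ h /h; rewrite mem_cat => ->.
- by move=> l b P Q P' _ _ h /h; rewrite mem_cat orbC => ->.
Qed.

Lemma nlab_on_free c l M M' : ntrans l M M' -> nlab_on c l -> c \in nfree M.
Proof.
elim=> //= {l M M'}.
- by move=> n I d v P P' mu h H _ hc; exact: plab_on_chans H hc.
- by move=> n I d v P P' mu h H _ hc; exact: plab_on_chans H hc.
- by move=> l M M' N _ h /h; rewrite mem_cat => ->.
- by move=> l M M' N _ h /h; rewrite mem_cat orbC => ->.
- move=> l d M M' _ h hl hc; rewrite mem_filter h // andbT.
  by apply/eqP => E; move: hl; rewrite -E hc.
Qed.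

Lemma nfree_ntrans l M M' : ntrans l M M' -> {subset nfree M' <= nfree M}.
Proof.
have sub M0 N0 M1 N1 : {subset nfree M1 <= nfree M0} -> {subset nfree N1 <= nfree N0} ->
    {subset nfree M1 ++ nfree N1 <= nfree M0 ++ nfree N0}.
  by move=> h1 h2 c; rewrite !mem_cat => /orP [/h1|/h2] ->; rewrite ?orbT.
elim=> //= {l M M'}; try by move=> *; match goal with H : ptrans _ _ _ |- _ => exact: pchans_ptrans H end.
- by move=> c v k h M M' N N' _ h1 _ h2 _; exact: sub.
- by move=> c v k h M M' N N' _ h1 _ h2 _; exact: sub.
- by move=> l M M' N _ h; exact: sub.
- by move=> l M M' N _ h; exact: sub.
- by move=> l c M M' _ h _ d; rewrite !mem_filter => /andP [-> /h].
Qed.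

Lemma nfree_ntick M M' : ntick M M' -> {subset nfree M' <= nfree M}.
Proof.
elim=> //= {M M'}; try by move=> *; match goal with H : ptick _ _ |- _ => exact: pchans_ptick H end.
- by move=> M M' N N' _ h1 _ h2 _ c; rewrite !mem_cat => /orP [/h1|/h2] ->; rewrite ?orbT.
- by move=> c M M' _ h d; rewrite !mem_filter => /andP [-> /h].
Qed.

End Renamings.

(** * Structural congruence is a strong bisimulation *)

Section CongruenceBisimulation.

Variable S : cait.
Implicit Types (P Q R : proc S) (M N : net S) (c d e : chan S).

Hint Constructors ptrans ptick ntrans ntick ncong : core.

Definition nsim M N := forall l M', ntrans l M M' -> exists2 N', ntrans l N N' & ncong M' N'.

Local Ltac ninv :=
  repeat match goal with
  | H : ntrans _ (NPar _ _) _ |- _ => inversion H; subst; clear H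
  | H : ntrans _ (NRes _ _) _ |- _ => inversion H; subst; clear H
  | H : ntrans _ (NZero _) _ |- _ => inversion H
  end.

Local Ltac simall :=
  repeat match goal with
  | H : ntrans _ ?X _, A : nsim ?X _ |- _ => case: (A _ _ H) => ? ? ?; clear H
  end.

Lemma node_nsim n I P Q mu h : pcong P Q -> proc_ok P -> proc_ok Q ->
  nsim (Node n I P mu h) (Node n I Q mu h).
Proof.
move=> H oP oQ l M' T; inversion T; subst;
  match goal with K : ptrans _ P _ |- _ =>
    case: (pcong_ptrans H oP oQ K) => Q' h1 h2; by eexists; [eauto|eauto] end.
Qed.

Local Hint Extern 1 (is_true (~~ nlab_on _ _)) =>
  match goal with
  | F : forall l M', ntrans l _ M' -> is_true (~~ _), K : ntrans _ _ _ |- _ => exact (F _ _ K)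
  end : core.

(** As [c] is not free in [M], no label of [M] is on [c], so the restriction never blocks [M];
    freshness persists along moves, which lets the extrusion law relate the derivatives. *)
Lemma extr_nsim c M N : c \notin nfree M ->
  nsim (NRes c (NPar M N)) (NPar M (NRes c N)) /\
  nsim (NPar M (NRes c N)) (NRes c (NPar M N)).
Proof.
move=> hc.
have fresh l M' : ntrans l M M' -> ~~ nlab_on c l.
  by move=> h; apply: contra hc; exact: nlab_on_free h.
have fr l M' : ntrans l M M' -> c \notin nfree M'.
  by move=> h; apply: contra hc; exact: nfree_ntrans h _.
split=> l T H; ninv.
all: eexists; last by (first [apply: nc_extr | apply/nc_sym/nc_extr]; eauto).
all: by eauto.
Qed.

(** A label that crosses the restriction is on neither [c] nor [d], so the swap leaves it alone. *)
Lemma alpha_nsim c d M : d \notin nfree M -> rng d = rng c ->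
  nsim (NRes c M) (NRes d (nmapC (cswap c d) M)) /\
  nsim (NRes d (nmapC (cswap c d) M)) (NRes c M).
Proof.
move=> hd hr; have rngf e := @rng_cswap S c d e hr; have fK := @cswapK S c d.
have lab l : ~~ nlab_on c l -> ~~ nlab_on d l -> nlabC (cswap c d) l = l.
  by case: l => //= e v h h1 h2; rewrite cswap_out.
split=> l T H; inversion H as [| | | | | | | | | | |l' c' M1 M' H1 H2]; subst.
  have nd : ~~ nlab_on d l by apply: contra hd; exact: nlab_on_free H1.
  exists (NRes d (nmapC (cswap c d) M')).
    by constructor=> //; rewrite -[X in ntrans X](lab l) //; apply: ntrans_nmapC => //; exact: inv_inj.
  by apply: nc_alpha => //; apply: contra hd; exact: nfree_ntrans H1 _.
(* After the swap, a label on [c] would stem from a free occurrence of [d] in [M]. *)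
have nc : ~~ nlab_on c l.
  apply/negP => /(nlab_on_free H1); rewrite nfree_nmapC; last exact: inv_inj.
  move=> /mapP [e he E]; move: hd; have -> : d = e by rewrite -(fK e) -E /cswap eqxx.
  by rewrite he.
have := ntrans_nmapC rngf (inv_inj fK) H1; rewrite nmapCK // lab // => H3.
exists (NRes c (nmapC (cswap c d) M')); first by constructor.
rewrite -{1}(nmapCK fK M'); apply/nc_sym/nc_alpha => //.
by apply: contra hd; exact: nfree_ntrans H3 _.
Qed.

Lemma ncong_ntrans_sym M N : ncong M N -> network M -> network N -> nsim M N /\ nsim N M.
Proof.
elim=> {M N}.
- by move=> M _ _; split=> l M' h; exists M'.
- by move=> M N _ IH oM oN; case: (IH oN oM).
- move=> M O N oO _ IH1 _ IH2 oM oN; have [a1 a2] := IH1 oM oO; have [b1 b2] := IH2 oO oN.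
  split=> l T h.
    have [T1 h1 c1] := a1 _ _ h; have [T2 h2 c2] := b1 _ _ h1; exists T2 => //.
    by apply: nc_trans c1 c2; exact: network_ntrans h1 oO.
  have [T1 h1 c1] := b2 _ _ h; have [T2 h2 c2] := a2 _ _ h1; exists T2 => //.
  by apply: nc_trans c1 c2; exact: network_ntrans h1 oO.
- move=> M M' N N' hM IHM hN IHN o o'.
  have [a1 a2] := IHM (network_parL o) (network_parL o').
  have [b1 b2] := IHN (network_parR o) (network_parR o').
  by split=> l T H; [clear a2 b2|clear a1 b1]; ninv; simall; eexists; eauto.
- move=> c M N h IH o o'; have [a1 a2] := IH o o'.
  by split=> l T H; [clear a2|clear a1]; ninv; simall; eexists; eauto.
- move=> n I P Q mu h H /network_pwf/pwf_ok oP /network_pwf/pwf_ok oQ.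
  by split; apply: node_nsim; auto; exact: pc_sym.
- by move=> M N _ _; split=> l T H; ninv; eexists; eauto.
- by move=> M N O _ _; split=> l T H; ninv; eexists; eauto.
- by move=> M _ _; split=> l T H; [ninv; eexists; eauto|exists (NPar T (NZero S)); auto].
- by move=> c _ _; split=> l T H; ninv.
- by move=> c d M _ _; split=> l T H; ninv; eexists; eauto.
- by move=> c M N hc _ _; exact: extr_nsim.
- by move=> c d M hd hr _ _; exact: alpha_nsim.
Qed.

Lemma ncong_ntrans M N l M' : ncong M N -> network M -> network N ->
  ntrans l M M' -> exists2 N', ntrans l N N' & ncong M' N'.
Proof. by move=> h oM oN; have [H _] := ncong_ntrans_sym h oM oN; exact: H. Qed.

Lemma ncong_no_ntau M N : ncong M N -> network M -> network N -> no_ntau M -> no_ntau N.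
Proof.
move=> h oM oN no T H; have [T' h' _] := ncong_ntrans (nc_sym h) oN oM H.
exact: no h'.
Qed.

Lemma ntick_no_ntau M M' : ntick M M' -> no_ntau M.
Proof.
elim=> {M M'} //.
  by move=> T H; inversion H.
by move=> c M M' _ no T H; inversion H; subst; eapply no; eauto.
Qed.

Definition ntsim M N := forall M', ntick M M' -> exists2 N', ntick N N' & ncong M' N'.

Lemma node_ntsim n I P Q mu h : pcong P Q -> pwf I P -> pwf I Q ->
  network (Node n I P mu h) -> network (Node n I Q mu h) ->
  ntsim (Node n I P mu h) (Node n I Q mu h).
Proof.
move=> H /pwf_ok oP /pwf_ok oQ nP nQ M' T.
have no := ncong_no_ntau (nc_node n I mu h H) nP nQ (ntick_no_ntau T).
by inversion T; subst;
  match goal with K : ptick P _ |- _ =>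
    case: (pcong_ptick H oP oQ K) => Q' h1 h2; by eexists; [eauto|eauto] end.
Qed.

Local Ltac tinv :=
  repeat match goal with
  | H : ntick (NPar _ _) _ |- _ => inversion H; subst; clear H
  | H : ntick (NRes _ _) _ |- _ => inversion H; subst; clear H
  | H : ntick (NZero _) _ |- _ => inversion H; subst; clear H
  end.

Local Ltac tsimall :=
  repeat match goal with
  | H : ntick ?X _, A : ntsim ?X _ |- _ => case: (A _ H) => ? ? ?; clear H
  end.

Lemma ncong_ntick_sym M N : ncong M N -> network M -> network N -> ntsim M N /\ ntsim N M.
Proof.
(* The induction consumes the derivation, but rebuilding a tick of a composition needs stability to
   pass between the two compounds at hand. This fact is extracted beforehand and generalized. *)
move=> H; have whole := ncong_no_ntau H; have whole' := ncong_no_ntau (nc_sym H).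
elim: H whole whole' => {M N}.
- by move=> M _ _ _ _; split=> M' h; exists M'.
- by move=> M N _ IH w w' oM oN; case: (IH w' w oN oM).
- move=> M O N oO h1 IH1 h2 IH2 _ _ oM oN.
  have [a1 a2] := IH1 (ncong_no_ntau h1) (ncong_no_ntau (nc_sym h1)) oM oO.
  have [b1 b2] := IH2 (ncong_no_ntau h2) (ncong_no_ntau (nc_sym h2)) oO oN.
  split=> T h.
    have [T1 t1 c1] := a1 _ h; have [T2 t2 c2] := b1 _ t1; exists T2 => //.
    by apply: nc_trans c1 c2; exact: network_ntick t1 oO.
  have [T1 t1 c1] := b2 _ h; have [T2 t2 c2] := a2 _ t1; exists T2 => //.
  by apply: nc_trans c1 c2; exact: network_ntick t1 oO.
- move=> M M' N N' h1 IHM h2 IHN w w' o o'.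
  have [a1 a2] := IHM (ncong_no_ntau h1) (ncong_no_ntau (nc_sym h1)) (network_parL o) (network_parL o').
  have [b1 b2] := IHN (ncong_no_ntau h2) (ncong_no_ntau (nc_sym h2)) (network_parR o) (network_parR o').
  by split=> T H; have no := ntick_no_ntau H; [clear a2 b2|clear a1 b1]; tinv; tsimall;
    (eexists; [eapply nk_par; eauto|eauto]).
- move=> c M N h IH _ _ o o'.
  have [a1 a2] := IH (ncong_no_ntau h) (ncong_no_ntau (nc_sym h)) o o'.
  by split=> T H; [clear a2|clear a1]; tinv; tsimall; eexists; eauto.
- move=> n I P Q mu h H w w' oP oQ.
  have pP := network_pwf oP; have pQ := network_pwf oQ.
  by split; apply: node_ntsim => //; exact: pc_sym.
- by move=> M N w w' o o'; split=> T H; have no := ntick_no_ntau H; tinv;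
    (eexists; [eapply nk_par; eauto|eauto]).
- move=> M N O w w' o o'; split=> T H; have no := ntick_no_ntau H; tinv.
    have no2 := w o o' no; eexists; last exact: nc_parA.
    by do 2 constructor=> //; move=> T h; apply: no2; eauto.
  have no2 := w' o' o no; eexists; last exact/nc_sym/nc_parA.
  by do 2 constructor=> //; move=> T h; apply: no2; eauto.
- move=> M w w' o o'; split=> T H; first by tinv; eexists; eauto.
  by exists (NPar T (NZero S)); auto; constructor=> //; apply: w' => //; exact: ntick_no_ntau H.
- by move=> c _ _ _ _; split=> T H; tinv; eexists; eauto.
- by move=> c d M _ _ _ _; split=> T H; tinv; eexists; eauto.
- move=> c M N hc w w' o o'; have fr M' : ntick M M' -> c \notin nfree M'.
    by move=> h; apply: contra hc; exact: nfree_ntick h _.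
  split=> T H; have no := ntick_no_ntau H; tinv.
    eexists; last by apply: nc_extr; eauto.
    by constructor; eauto.
  eexists; last by apply/nc_sym/nc_extr; eauto.
  do 2 constructor=> //; move=> T h; apply: (w' o' o no (NRes c T)); eauto.
- move=> c d M hd hr _ _ _ _.
  have rngf e := @rng_cswap S c d e hr; have fK := @cswapK S c d.
  split=> T H; inversion H as [| | | |c' M1 M' H1]; subst.
    exists (NRes d (nmapC (cswap c d) M')); first by constructor; exact: ntick_nmapC.
    by apply: nc_alpha => //; apply: contra hd; exact: nfree_ntick H1 _.
  have := ntick_nmapC rngf fK H1; rewrite nmapCK // => H3.
  exists (NRes c (nmapC (cswap c d) M')); first by constructor.
  rewrite -{1}(nmapCK fK M'); apply/nc_sym/nc_alpha => //.
  by apply: contra hd; exact: nfree_ntick H3 _.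
Qed.

Lemma ncong_ntick M N M' : ncong M N -> network M -> network N ->
  ntick M M' -> exists2 N', ntick N N' & ncong M' N'.
Proof. by move=> h oM oN; have [H _] := ncong_ntick_sym h oM oN; exact: H. Qed.

Lemma nfree_sens_update s h v M : nfree (sens_update s h v M) = nfree M.
Proof. by elim: M => //= [x|M -> N ->|c M ->] //; case: ifP. Qed.

Lemma sens_update_nmapC s h v f M :
  sens_update s h v (nmapC f M) = nmapC f (sens_update s h v M).
Proof. by elim: M => //= [x|M -> N ->|c M ->] //=; case: ifP. Qed.

Lemma ncong_sens_update s h v M N : sdom s v -> ncong M N ->
  ncong (sens_update s h v M) (sens_update s h v N).
Proof.
move=> hv; elim=> {M N} //=; eauto.
- by move=> M O N oO _ h1 _ h2; apply: nc_trans h1 h2; exact: network_sens_update.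
- by move=> n I P Q mu k H; case: ifP => _; exact: nc_node.
- by move=> c M N hc; apply: nc_extr; rewrite nfree_sens_update.
- by move=> c d M hd hr; rewrite sens_update_nmapC; apply: nc_alpha; rewrite ?nfree_sens_update.
Qed.

Lemma scong_refl M : network M -> scong M M.
Proof. by split. Qed.

Lemma scong_sym M N : scong M N -> scong N M.
Proof. by case=> h1 h2 h3; split=> //; exact: nc_sym. Qed.

Lemma scong_trans N M O : scong M N -> scong N O -> scong M O.
Proof. by move=> [h1 h2 h3] [_ h4 h5]; split=> //; exact: nc_trans h2 h3 h5. Qed.

End CongruenceBisimulation.

(** * Transitions are reductions *)

Section TransitionsReductions.

Variable S : cait.
Implicit Types (P Q R T : proc S) (I J : iface S) (M N O : net S) (c d e : chan S).

Lemma scong_parC M N : network (NPar M N) -> scong (NPar M N) (NPar N M).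
Proof. by move=> h; split=> //; [exact: network_parC|exact: nc_parC]. Qed.

Lemma scong_parA M N O : network (NPar M (NPar N O)) ->
  scong (NPar M (NPar N O)) (NPar (NPar M N) O).
Proof. by move=> h; split=> //; [exact/network_parA|exact: nc_parA]. Qed.

Lemma scong_par0 M : network M -> scong (NPar M (NZero S)) M.
Proof. by move=> h; split=> //; [exact: network_par0|exact: nc_par0]. Qed.

Lemma scong_parl M M' N : scong M M' -> network (NPar M N) -> scong (NPar M N) (NPar M' N).
Proof.
move=> [h1 h2 h3] h; split=> //; first exact: network_congL h3 h2 h.
by apply: nc_par => //; exact: nc_refl.
Qed.

Lemma scong_parr M N N' : scong N N' -> network (NPar M N) -> scong (NPar M N) (NPar M N').
Proof.
move=> h hn; apply: scong_trans (scong_parC hn) _.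
have hn' := network_parC hn; have [_ hn2 _] := scong_parl h hn'.
exact: scong_trans (scong_parl h hn') (scong_parC hn2).
Qed.

Lemma scong_par M M' N N' : scong M M' -> scong N N' -> network (NPar M N) ->
  scong (NPar M N) (NPar M' N').
Proof.
move=> h1 h2 hn; have h3 := scong_parl h1 hn; apply: (scong_trans h3).
by apply: scong_parr => //; case: h3.
Qed.

Lemma scong_res c M N : scong M N -> scong (NRes c M) (NRes c N).
Proof. by case=> h1 h2 h3; split=> //; exact: nc_res. Qed.

Lemma scong_extr c M N : c \notin nfree M -> network (NPar M N) ->
  scong (NRes c (NPar M N)) (NPar M (NRes c N)).
Proof. by move=> h hn; split=> //; exact: nc_extr. Qed.

Lemma scong_alpha c d M : d \notin nfree M -> rng d = rng c -> network M ->
  scong (NRes c M) (NRes d (nmapC (cswap c d) M)).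
Proof.
move=> h1 h2 hM; split=> //; last exact: nc_alpha.
exact: (network_nmapC (cswap c d) hM).
Qed.

(** [c] may be free in [M], which blocks extrusion; hence the alpha-conversion to [d] beforehand. *)
Lemma scong_extrude c d M N : d \notin nfree M -> d \notin nfree N -> rng d = rng c ->
  network (NPar M N) ->
  scong (NPar M (NRes c N)) (NRes d (NPar M (nmapC (cswap c d) N))).
Proof.
move=> h1 h2 h3 hn; have hN := network_parR hn.
have h4 := scong_parr (scong_alpha h2 h3 hN) (hn : network (NPar M (NRes c N))).
apply: (scong_trans h4); apply/scong_sym/scong_extr => //.
by case: h4.
Qed.

Lemma scong_extrude_l c d M N : d \notin nfree M -> d \notin nfree N -> rng d = rng c ->
  network (NPar N M) ->
  scong (NPar (NRes c N) M) (NRes d (NPar (nmapC (cswap c d) N) M)).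
Proof.
move=> h1 h2 h3 hn; apply: scong_trans (scong_parC (hn : network (NPar (NRes c N) M))) _.
have s1 := scong_extrude h1 h2 h3 (network_parC hn).
by apply: (scong_trans s1); apply/scong_res/scong_parC; case: s1.
Qed.

(** With well-formed ends, transitivity has no side condition left, and a congruence lifts to
    [scong] between nodes. *)
Definition pcongw I P Q := [/\ pwf I P, pwf I Q & pcong P Q].

Lemma pcongw_refl I P : pwf I P -> pcongw I P P.
Proof. by move=> h; split=> //; exact: pc_refl. Qed.

Lemma pcongw_sym I P Q : pcongw I P Q -> pcongw I Q P.
Proof. by case=> h1 h2 h3; split=> //; exact: pc_sym. Qed.

Lemma pcongw_trans I Q P R : pcongw I P Q -> pcongw I Q R -> pcongw I P R.
Proof.
by move=> [h1 h2 h3] [_ h4 h5]; split=> //; exact: pc_trans (pwf_ok h2) h3 h5.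
Qed.

Lemma pcongw_par I P P' Q Q' : pcongw I P P' -> pcongw I Q Q' ->
  pcongw I (PPar P Q) (PPar P' Q').
Proof.
by move=> [h1 h2 h3] [h4 h5 h6]; split; rewrite ?pwf_par ?h1 ?h2 ?h4 ?h5 //; exact: pc_par.
Qed.

Lemma pcongw_parC I P Q : pwf I P -> pwf I Q -> pcongw I (PPar P Q) (PPar Q P).
Proof. by move=> h1 h2; split; rewrite ?pwf_par ?h1 ?h2 //; exact: pc_parC. Qed.

Lemma pcongw_parA I P Q R : pwf I P -> pwf I Q -> pwf I R ->
  pcongw I (PPar P (PPar Q R)) (PPar (PPar P Q) R).
Proof. by move=> h1 h2 h3; split; rewrite ?pwf_par ?h1 ?h2 ?h3 //; exact: pc_parA. Qed.

Lemma pcongw_par0 I P : pwf I P -> pcongw I (PPar P (PNil S)) P.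
Proof. by move=> h; split; rewrite ?pwf_par ?h //; exact: pc_par0. Qed.

Lemma pcongw_parCA I P Q R : pwf I P -> pwf I Q -> pwf I R ->
  pcongw I (PPar P (PPar Q R)) (PPar Q (PPar P R)).
Proof.
move=> h1 h2 h3; apply: pcongw_trans (pcongw_parA h1 h2 h3) _.
apply: pcongw_trans (pcongw_sym (pcongw_parA h2 h1 h3)).
by apply: pcongw_par; [exact: pcongw_parC|exact: pcongw_refl].
Qed.

Lemma pcongw_parACA I P Q R T : pwf I P -> pwf I Q -> pwf I R -> pwf I T ->
  pcongw I (PPar (PPar P Q) (PPar R T)) (PPar (PPar P R) (PPar Q T)).
Proof.
move=> h1 h2 h3 h4; have h34 : pwf I (PPar R T) by rewrite pwf_par h3.
have h24 : pwf I (PPar Q T) by rewrite pwf_par h2.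
apply: pcongw_trans (pcongw_sym (pcongw_parA h1 h2 h34)) _.
apply: pcongw_trans (pcongw_parA h1 h3 h24).
by apply: pcongw_par; [exact: pcongw_refl|exact: pcongw_parCA].
Qed.

Lemma pcongw_unfold I P : pwf I (PFix P) -> pcongw I (PFix P) (unfold_fix P).
Proof. by move=> h; split=> //; [exact: pwf_unfold|exact: pc_unfold]. Qed.

Lemma pcongw_true I b P Q : guard_is b true -> pwf I (PCond b P Q) ->
  pcongw I (PCond b P Q) P.
Proof. by move=> hb h; split=> //; [case/andP: (pwf_cond h)|exact: pc_true]. Qed.

Lemma pcongw_false I b P Q : guard_is b false -> pwf I (PCond b P Q) ->
  pcongw I (PCond b P Q) Q.
Proof. by move=> hb h; split=> //; [case/andP: (pwf_cond h)|exact: pc_false]. Qed.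

Lemma scong_node n I P Q mu h : pcongw I P Q -> network (Node n I P mu h) ->
  scong (Node n I P mu h) (Node n I Q mu h).
Proof.
move=> [h1 h2 h3] hn; split=> //; last exact: nc_node.
by apply/network_node; move/network_node: hn => /node_ok_pwf; apply.
Qed.

(** Moves whose redex is the whole process, in the shapes that the reduction axioms accept. *)
Inductive axstep : plab S -> proc S -> proc S -> Prop :=
  | ax_out c v P Q : axstep (LOut c v) (PTout (COut c (Val v)) P Q) P
  | ax_in c v P Q : axstep (LIn c v) (PTout (CIn c) P Q) (vsubst v P)
  | ax_sens s v P : axstep (LSens s v) (PPref (ISens s) P) (vsubst v P)
  | ax_act a v P : axstep (LAct a v) (PPref (IAct a (Val v)) P) P
  | ax_pos h P : axstep (LPos h) (PPref (IPos S) P) (vsubst (VLoc h) P)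
  | ax_com c v P Q P' Q' : rng c = RLocal ->
      axstep (LTau S) (PPar (PTout (COut c (Val v)) P Q) (PTout (CIn c) P' Q'))
                      (PPar P (vsubst v P')).

Lemma axstep_ptrans l P P' : axstep l P P' -> ptrans l P P'.
Proof. by case=> *; econstructor; eauto; constructor. Qed.

Lemma pcongw_split I P Q H T : pcongw I P (PPar H T) -> pwf I Q ->
  pcongw I (PPar P Q) (PPar H (PPar T Q)) /\ pcongw I (PPar Q P) (PPar H (PPar Q T)).
Proof.
move=> h hQ; have [_ + _] := h; rewrite pwf_par => /andP [hH hT]; split.
  apply: pcongw_trans (pcongw_sym (pcongw_parA hH hT hQ)).
  by apply: pcongw_par h _; exact: pcongw_refl.
apply: pcongw_trans (pcongw_parCA hQ hH hT).
by apply: pcongw_par h; exact: pcongw_refl.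
Qed.

(** A transition may fire deep inside a process. Congruence brings the redex to the front of a
    residue [T], and [T] is the same before and after the move, as [red_parp] demands of the
    component it adds. *)
Lemma ptrans_axstep I l P P' : ptrans l P P' -> pwf I P ->
  exists H H' T, [/\ axstep l H H', pcongw I P (PPar H T) & pcongw I P' (PPar H' T)].
Proof.
have ax l0 H H' : axstep l0 H H' -> pwf I H ->
    exists K K' T, [/\ axstep l0 K K', pcongw I H (PPar K T) & pcongw I H' (PPar K' T)].
  move=> h hH; have hH' := pwf_ptrans (axstep_ptrans h) hH.
  by exists H, H', (PNil S); split=> //; apply/pcongw_sym/pcongw_par0.
elim=> {l P P'}.
1-5: by move=> *; apply: ax => //; constructor.
- move=> c v P P' Q Q' _ IH1 _ IH2 hc; rewrite pwf_par => /andP [/IH1 [H1 [H1' [T1 [a1 p1 p1']]]]].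
  move=> /IH2 [H2 [H2' [T2 [a2 p2 p2']]]].
  exists (PPar H1 H2), (PPar H1' H2'), (PPar T1 T2); split.
  + by inversion a1; subst; inversion a2; subst; constructor.
  + apply: pcongw_trans (pcongw_par p1 p2) _.
    move: p1 p2 => [_ + _] [_ + _]; rewrite !pwf_par => /andP [? ?] /andP [? ?].
    exact: pcongw_parACA.
  + apply: pcongw_trans (pcongw_par p1' p2') _.
    move: p1' p2' => [_ + _] [_ + _]; rewrite !pwf_par => /andP [? ?] /andP [? ?].
    exact: pcongw_parACA.
- move=> c v P P' Q Q' _ IH1 _ IH2 hc; rewrite pwf_par => /andP [/IH2 [H2 [H2' [T2 [a2 p2 p2']]]]].
  move=> /IH1 [H1 [H1' [T1 [a1 p1 p1']]]].
  exists (PPar H1 H2), (PPar H1' H2'), (PPar T1 T2).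
  have aux A B A' B' C D : pcongw I A (PPar A' C) -> pcongw I B (PPar B' D) ->
      pcongw I (PPar B A) (PPar (PPar A' B') (PPar C D)).
    move=> hA hB; have [wA + _] := hA; have [wB + _] := hB.
    rewrite !pwf_par => /andP [? ?] /andP [? ?].
    apply: pcongw_trans (pcongw_parC wB wA) _; apply: pcongw_trans (pcongw_par hA hB) _.
    exact: pcongw_parACA.
  split; try exact: aux.
  by inversion a1; subst; inversion a2; subst; constructor.
- move=> l P P' Q _ IH; rewrite pwf_par => /andP [/IH [H [H' [T [a p p']]]] hQ].
  exists H, H', (PPar T Q); split=> //; first by case: (pcongw_split p hQ).
  by case: (pcongw_split p' hQ).
- move=> l P P' Q _ IH; rewrite pwf_par => /andP [hQ /IH [H [H' [T [a p p']]]]].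
  exists H, H', (PPar Q T); split=> //; first by case: (pcongw_split p hQ).
  by case: (pcongw_split p' hQ).
- move=> l P Q _ IH h; have [H [H' [T [a p p']]]] := IH (pwf_unfold h).
  exists H, H', T; split=> //; exact: pcongw_trans (pcongw_unfold h) p.
- move=> l b P Q P' hb _ IH h; have hc := pcongw_true hb h; have [_ /IH + _] := hc.
  move=> [H [H' [T [a p p']]]].
  by exists H, H', T; split=> //; exact: pcongw_trans hc p.
- move=> l b P Q P' hb _ IH h; have hc := pcongw_false hb h; have [_ /IH + _] := hc.
  move=> [H [H' [T [a p p']]]].
  by exists H, H', T; split=> //; exact: pcongw_trans hc p.
Qed.

Lemma network_node_par n I P Q mu h : network (Node n I (PPar P Q) mu h) ->
  network (Node n I P mu h).
Proof.
move=> hn; apply/network_node; move/network_node: (hn) => /node_ok_pwf; apply.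
by move/network_pwf: hn; rewrite pwf_par => /andP [].
Qed.

(** [red_parp] speaks of products over an index set; over a single index the product is the node
    beside [NZero], which structural congruence removes. *)
Lemma red_node_par w n I I' P P' Q mu h :
  network (Node n I (PPar P Q) mu h) -> network (Node n I' (PPar P' Q) mu h) ->
  red w (Node n I P mu h) (Node n I' P' mu h) ->
  red w (Node n I (PPar P Q) mu h) (Node n I' (PPar P' Q) mu h).
Proof.
move=> h1 h2 hr.
have := @red_parp S w 1 (fun _ => n) (fun _ => I) (fun _ => I') (fun _ => P) (fun _ => P')
  (fun _ => Q) (fun _ => mu) (fun _ => mu) (fun _ => h) (fun _ => h).
rewrite /nprod !big_ord_recl !big_ord0 => H.
apply: red_struct (H _) _; last exact: scong_par0.
  exact/scong_sym/scong_par0.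
exact: red_parn.
Qed.

Lemma red_node2_par w n I I' P P' Q mu h m J J' R R' T mu' k :
  network (NPar (Node n I (PPar P Q) mu h) (Node m J (PPar R T) mu' k)) ->
  network (NPar (Node n I' (PPar P' Q) mu h) (Node m J' (PPar R' T) mu' k)) ->
  red w (NPar (Node n I P mu h) (Node m J R mu' k))
        (NPar (Node n I' P' mu h) (Node m J' R' mu' k)) ->
  red w (NPar (Node n I (PPar P Q) mu h) (Node m J (PPar R T) mu' k))
        (NPar (Node n I' (PPar P' Q) mu h) (Node m J' (PPar R' T) mu' k)).
Proof.
(* [sel] presents a pair as a family over two indices, as [red_parp] requires. *)
move=> h1 h2 hr; pose sel A (x y : A) (i : 'I_2) := if nat_of_ord i is 0 then x else y.
have sub I1 P1 J1 R1 : network (NPar (Node n I1 (PPar P1 Q) mu h) (Node m J1 (PPar R1 T) mu' k)) ->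
    network (NPar (Node n I1 P1 mu h) (Node m J1 R1 mu' k)).
  move=> hn; apply: (network_perm _ hn); first exact: Permutation_refl.
  apply/all_ok_par; split; apply: network_all_ok.
    exact: network_node_par (network_parL hn).
  exact: network_node_par (network_parR hn).
have two A B : network (NPar A B) -> scong (NPar A (NPar B (NZero S))) (NPar A B).
  move=> hn; apply/scong_sym/scong_parr => //; apply/scong_sym/scong_par0.
  exact: network_parR hn.
have := @red_parp S w 2 (sel _ n m) (sel _ I J) (sel _ I' J') (sel _ P R) (sel _ P' R')
  (sel _ Q T) (sel _ mu mu') (sel _ mu mu') (sel _ h k) (sel _ h k).
rewrite /nprod !big_ord_recl !big_ord0 /= => H.
apply: red_struct (H _) (two _ _ h2); first exact/scong_sym/two.
apply: red_struct hr _; first exact/two/sub.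
exact/scong_sym/two/sub.
Qed.

Lemma node_red n I I' mu h w l P P' : ptrans l P P' ->
  (forall H H', axstep l H H' -> red w (Node n I H mu h) (Node n I' H' mu h)) ->
  (forall Q, pwf I' Q = pwf I Q) ->
  network (Node n I P mu h) -> network (Node n I' P' mu h) ->
  red w (Node n I P mu h) (Node n I' P' mu h).
Proof.
move=> hp hr eqI h1 h2; have [H [H' [T [a p p']]]] := ptrans_axstep hp (network_pwf h1).
have p2 : pcongw I' P' (PPar H' T) by case: p' => ? ? ?; split; rewrite ?eqI.
have s1 := scong_node p h1; have s2 := scong_node p2 h2.
apply: (red_struct s1 _ (scong_sym s2)); apply: red_node_par (hr _ _ a).
  by case: s1.
by case: s2.
Qed.

(** [red_struct] asks for targets that are networks; this transition provides that through
    [network_ntrans]. *)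
Lemma ntrans_com_out c v n I A B T mu h k N N' : within (dist h k) (rng c) ->
  ntrans (NLIn c v k) N N' ->
  ntrans (NLTau S) (NPar (Node n I (PPar (PTout (COut c (Val v)) A B) T) mu h) N)
    (NPar (Node n I (PPar A T) mu h) N').
Proof.
move=> hd hN; apply: (@nt_glbcomL S c v h k) => //; last by rewrite dist_sym.
by apply: nt_out; [apply: pt_parL; constructor|case: (rng c) hd].
Qed.

Lemma chan_fresh4 c d (l1 l2 l3 : seq (chan S)) : exists e,
  [/\ e != d, e \notin l1, e \notin l2, e \notin l3 & rng e = rng c].
Proof.
have [e + hr] := chan_fresh c (d :: l1 ++ l2 ++ l3).
by rewrite in_cons !mem_cat !negb_or => /and4P [h1 h2 h3 h4]; exists e.
Qed.

(* The statement is closed under renaming because crossing a restriction in [N]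
   requires an alpha-conversion. *)
Lemma red_in c v k N N' : ntrans (NLIn c v k) N N' ->
  forall f, injective f -> (forall e, rng (f e) = rng e) -> f c = c ->
  forall n I A B T mu h, within (dist h k) (rng c) ->
  network (NPar (Node n I (PPar (PTout (COut c (Val v)) A B) T) mu h) (nmapC f N)) ->
  red (RTau S) (NPar (Node n I (PPar (PTout (COut c (Val v)) A B) T) mu h) (nmapC f N))
           (NPar (Node n I (PPar A T) mu h) (nmapC f N')).
Proof.
move E : (NLIn c v k) => l H; elim: H E => {N N' l} //.
- move=> m J c' v' P P' mu' k' hp hr [? ? ?] f injf rngf fc n I A B T mu h hd hn; subst c' v' k'.
  have hp' := ptrans_pmapC rngf hp; rewrite /= fc in hp'.
  have hn' := network_ntrans (ntrans_com_out n I A B T mu hd (nt_in m J mu' k hp' hr)) hn.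
  have [G [G' [T' [a p p']]]] := ptrans_axstep hp' (network_pwf (network_parR hn)).
  have s1 := scong_parr (scong_node p (network_parR hn)) hn.
  have s2 := scong_parr (scong_node p' (network_parR hn')) hn'.
  apply: (red_struct s1 _ (scong_sym s2)); apply: red_node2_par.
  + by case: s1.
  + by case: s2.
  + by inversion a; subst; exact: red_glbcom.
- move=> l M M' N hM IH E f injf rngf fc n I A B T mu h hd hn; subst l.
  have h1 := ntrans_nmapC rngf injf hM; rewrite /= fc in h1.
  have hn' := network_ntrans (ntrans_com_out n I A B T mu hd (nt_parL (nmapC f N) h1)) hn.
  apply: red_struct (scong_parA hn) _ (scong_sym (scong_parA hn')).
  apply: red_parn; apply: IH => //.
  by apply: network_parL (_ : network (NPar _ (nmapC f N))); apply/network_parA.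
- move=> l M M' N hM IH E f injf rngf fc n I A B T mu h hd hn; subst l.
  have h1 := ntrans_nmapC rngf injf hM; rewrite /= fc in h1.
  have hn' := network_ntrans (ntrans_com_out n I A B T mu hd (nt_parR (nmapC f N) h1)) hn.
  have s (X Y Z : net S) : network (NPar X (NPar Y Z)) -> scong (NPar X (NPar Y Z)) (NPar (NPar X Z) Y).
    move=> hx; have h2 := scong_parr (scong_parC (network_parR hx)) hx.
    by apply: (scong_trans h2); apply: scong_parA; case: h2.
  apply: red_struct (s _ _ _ hn) _ (scong_sym (s _ _ _ hn')).
  apply: red_parn; apply: IH => //.
  by case: (s _ _ _ hn) => _ /network_parL.
- move=> l d M M' hM IH hl E f injf rngf fc n I A B T mu h hd hn; subst l => /=.
  set X := Node n I (PPar (PTout _ _ _) _) mu h in hn *; set X' := Node n I (PPar A T) mu h.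
  (* The bound channel [f d] is converted to a fresh [d'], its scope is extruded over the sender,
     and the swap is absorbed into the renaming of the induction hypothesis. Since [d'] differs from
     [c], the renaming still fixes [c]. *)
  have [d' [nc nX nX' nM hr]] := chan_fresh4 (f d) c (nfree X) (nfree X') (nfree (nmapC f M)).
  have h1 := ntrans_nmapC rngf injf hM; rewrite /= fc in h1.
  have hn1 : network (NPar X (nmapC f M)) by [].
  have hn' : network (NPar X' (nmapC f M')).
    exact: network_ntrans (ntrans_com_out n I A B T mu hd h1) hn1.
  have nM' : d' \notin nfree (nmapC f M').
    by apply: contra nM; exact: nfree_ntrans h1 _.
  have s1 := scong_extrude nX nM hr hn1; have s2 := scong_extrude nX' nM' hr hn'.
  apply: (red_struct s1 _ (scong_sym s2)); apply: red_res; rewrite !nmapC_comp.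
  apply: IH => //.
  + exact: inj_comp (inv_inj (@cswapK S _ _)) injf.
  + by move=> e /=; rewrite rng_cswap.
  + by rewrite /= fc cswap_out // 1?eq_sym // -fc (inj_eq injf) eq_sym; move: hl => /=; rewrite eq_sym.
  + by case: s1 => _; rewrite nmapC_comp.
Qed.

(** Follows the output down to its node: every component passed on the way is moved over to [N],
    which is why [N] is arbitrary, and every restriction is extruded at the price of a renaming.
    Once the sender is a node, [red_in] deals with the receiver. *)
Lemma red_com c v h k M M' : ntrans (NLOut c v h) M M' ->
  forall f, injective f -> (forall e, rng (f e) = rng e) -> f c = c ->
  forall N N', within (dist h k) (rng c) -> ntrans (NLIn c v k) N N' ->
  network (NPar (nmapC f M) N) ->
  red (RTau S) (NPar (nmapC f M) N) (NPar (nmapC f M') N').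
Proof.
have step M1 M1' f N N' : injective f -> (forall e, rng (f e) = rng e) -> f c = c ->
    ntrans (NLOut c v h) M1 M1' -> within (dist h k) (rng c) -> ntrans (NLIn c v k) N N' ->
    network (NPar (nmapC f M1) N) -> network (NPar (nmapC f M1') N').
  move=> injf rngf fc h1 hd h2; apply: (@network_ntrans _ (NLTau S)).
  apply: (@nt_glbcomL S c v h k) => //; last by rewrite dist_sym.
  by have := ntrans_nmapC rngf injf h1; rewrite /= fc.
move E : (NLOut c v h) => l H; elim: H E => {M M' l} //.
- move=> m J c' v' P P' mu' k' hp hr [? ? ?] f injf rngf fc N N' hd hN hn; subst c' v' k'.
  have hn' := step _ _ _ _ _ injf rngf fc (nt_out m J mu' h hp hr) hd hN hn.
  have hp' := ptrans_pmapC rngf hp; rewrite /= fc in hp'.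
  have [G [G' [T' [a p p']]]] := ptrans_axstep hp' (network_pwf (network_parL hn)).
  have s1 := scong_parl (scong_node p (network_parL hn)) hn.
  have s2 := scong_parl (scong_node p' (network_parL hn')) hn'.
  apply: (red_struct s1 _ (scong_sym s2)); case: s1 => _ s1 _.
  inversion a; subst; have := red_in hN (@inj_id _) (fun _ => erefl) erefl hd.
  by rewrite !nmapC_id; apply.
- move=> l M M' N0 hM IH E f injf rngf fc N N' hd hN hn; subst l.
  have hn' := step _ _ _ _ _ injf rngf fc (nt_parL N0 hM) hd hN hn.
  have s (X Y Z : net S) : network (NPar (NPar X Y) Z) -> scong (NPar (NPar X Y) Z) (NPar X (NPar Y Z)).
    by move=> hx; apply/scong_sym/scong_parA/network_parA.
  apply: red_struct (s _ _ _ hn) _ (scong_sym (s _ _ _ hn')).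
  by apply: IH => //; [exact: nt_parR|case: (s _ _ _ hn)].
- move=> l M M' N0 hM IH E f injf rngf fc N N' hd hN hn; subst l.
  have hn' := step _ _ _ _ _ injf rngf fc (nt_parR N0 hM) hd hN hn.
  have s (X Y Z : net S) : network (NPar (NPar X Y) Z) -> scong (NPar (NPar X Y) Z) (NPar Y (NPar X Z)).
    move=> hx; have h1 := scong_parl (scong_parC (network_parL hx)) hx.
    by apply: (scong_trans h1); apply/scong_sym/scong_parA/network_parA; case: h1.
  apply: red_struct (s _ _ _ hn) _ (scong_sym (s _ _ _ hn')).
  by apply: IH => //; [exact: nt_parR|case: (s _ _ _ hn)].
- move=> l d M M' hM IH hl E f injf rngf fc N N' hd hN hn; subst l => /=.
  have [d' [nc nX nX' nM hr]] := chan_fresh4 (f d) c (nfree N) (nfree N') (nfree (nmapC f M)).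
  have hn1 : network (NPar (nmapC f M) N) by [].
  have hn' := step _ _ _ _ _ injf rngf fc hM hd hN hn1.
  have h1 := ntrans_nmapC rngf injf hM; rewrite /= fc in h1.
  have nM' : d' \notin nfree (nmapC f M').
    by apply: contra nM; exact: nfree_ntrans h1 _.
  have s1 := scong_extrude_l nX nM hr hn1; have s2 := scong_extrude_l nX' nM' hr hn'.
  apply: (red_struct s1 _ (scong_sym s2)); apply: red_res; rewrite !nmapC_comp.
  apply: IH => //.
  + exact: inj_comp (inv_inj (@cswapK S _ _)) injf.
  + by move=> e /=; rewrite rng_cswap.
  + by rewrite /= fc cswap_out // 1?eq_sym // -fc (inj_eq injf) eq_sym; move: hl => /=; rewrite eq_sym.
  + by case: s1 => _; rewrite nmapC_comp.
Qed.

Definition ract_nlab (w : ract S) : nlab S :=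
  match w with RTau => NLTau S | RAct a => NLAct a end.

Lemma ntrans_red w M M' : ntrans (ract_nlab w) M M' -> network M -> red w M M'.
Proof.
move E : (ract_nlab w) => l H; elim: H w E => {l M M'}.
- move=> n I P P' mu h hp [] // _ hn; apply: (node_red hp) => //.
    by move=> H H' a; inversion a; subst; constructor.
  exact: network_ntrans (nt_pos n I mu hp) hn.
- move=> n I s v P P' mu h hs hp [] // _ hn; apply: (node_red hp) => //.
    by move=> H H' a; inversion a; subst; constructor.
  exact: network_ntrans (nt_sensread n mu h hs hp) hn.
- move=> n I a v P P' mu h hs hp [] // _ hn; apply: (node_red hp) => //.
    by move=> H H' ax; inversion ax; subst; constructor.
  exact: network_ntrans (nt_actunchg n mu h hs hp) hn.
- move=> n I a v P P' mu h hs hp [] // _ [->] hn; apply: (node_red hp) => //.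
  + by move=> H H' ax; inversion ax; subst; constructor.
  + move=> Q; apply: eq_pwf => //= b; case: eqP => // ->.
    by rewrite (pwf_act hp (network_pwf hn)).
  + exact: network_ntrans (nt_actchg n mu h hs hp) hn.
- move=> n I P P' mu h hp [] // _ hn; apply: (node_red hp) => //.
    by move=> H H' a; inversion a; subst; constructor.
  exact: network_ntrans (nt_loccom n I mu h hp) hn.
- by move=> n I c v P P' mu h _ _ [].
- by move=> n I c v P P' mu h _ _ [].
- move=> c v k h M M' N N' h1 _ h2 _ hd [] // _ hn.
  have := red_com h1 (@inj_id _) (fun _ => erefl) erefl; rewrite !nmapC_id; apply; eauto.
  by rewrite dist_sym.
- move=> c v k h M M' N N' h1 _ h2 _ hd [] // _ hn.
  have hn' := network_ntrans (nt_glbcomR h1 h2 hd) hn.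
  apply: red_struct (scong_parC hn) _ (scong_sym (scong_parC hn')).
  have := red_com h1 (@inj_id _) (fun _ => erefl) erefl; rewrite !nmapC_id; apply; eauto.
    by rewrite dist_sym.
  exact: network_parC.
- move=> l M M' N _ IH w E hn; apply/red_parn/IH => //; exact: network_parL hn.
- move=> l M M' N h IH w E hn; have hn' := network_ntrans (nt_parR N h) hn.
  apply: red_struct (scong_parC hn) _ (scong_sym (scong_parC hn')).
  apply/red_parn/IH => //; exact: network_parR hn.
- by move=> l c M M' h IH hl w E hn; apply/red_res/IH.
Qed.

End TransitionsReductions.

(** * Reductions are transitions, up to structural congruence *)

Section ReductionsTransitions.

Variable S : cait.
Implicit Types (P Q R T : proc S) (I J : iface S) (M N O : net S) (c d e : chan S).
Implicit Types (x y : nodeT S) (L : seq (nodeT S)).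

Hint Constructors ptrans ptick ntrans ntick : core.

Definition node_cong x y :=
  [/\ key x = key y, proc_ok (nproc x), proc_ok (nproc y) & pcong (nproc x) (nproc y)].

(** One permutation followed by one pointwise comparison; [Permutation_Forall2] commutes the two, so
    this form is closed under composition. *)
Definition list_cong L L' := exists2 L0, Permutation L L0 & List.Forall2 node_cong L0 L'.

Lemma node_cong_flip L L' : List.Forall2 node_cong L L' -> List.Forall2 node_cong L' L.
Proof.
elim=> // x y L1 L2 [h1 h2 h3 h4] _ h; constructor=> //; split=> //; exact: pc_sym.
Qed.

Lemma node_cong_trans L1 L2 L3 : List.Forall2 node_cong L1 L2 ->
  List.Forall2 node_cong L2 L3 -> List.Forall2 node_cong L1 L3.
Proof.
move=> h; elim: h L3 => [L3 H|x y L L' [h1 h2 h3 h4] _ IH L3 H]; inversion H; subst => //.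
constructor; last exact: IH.
case: H2 => h1' _ h3' h4'; split=> //; first by rewrite h1.
exact: pc_trans h3 h4 h4'.
Qed.

Lemma list_cong_refl L : (forall x, List.In x L -> proc_ok (nproc x)) -> list_cong L L.
Proof.
move=> h; exists L; first exact: Permutation_refl.
elim: L h => // x L IH h; constructor; last by apply: IH => y hy; apply: h; right.
by split=> //; [apply: h; left|apply: h; left|exact: pc_refl].
Qed.

Lemma list_cong_sym L L' : list_cong L L' -> list_cong L' L.
Proof.
case=> L0 hp hf; have [L1 [h1 h2]] := Permutation_Forall2 (Permutation_sym hp) hf.
by exists L1 => //; exact: node_cong_flip.
Qed.

Lemma list_cong_trans L1 L2 L3 : list_cong L1 L2 -> list_cong L2 L3 -> list_cong L1 L3.
Proof.
case=> A hp1 hf1 [B hp2 hf2].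
have [A' [h1 h2]] := Permutation_Forall2 hp2 (node_cong_flip hf1).
exists A'; first exact: Permutation_trans hp1 h1.
exact: node_cong_trans (node_cong_flip h2) hf2.
Qed.

Lemma list_cong_cat L1 L1' L2 L2' : list_cong L1 L1' -> list_cong L2 L2' ->
  list_cong (L1 ++ L2) (L1' ++ L2').
Proof.
case=> A hp1 hf1 [B hp2 hf2]; exists (A ++ B); first exact: Permutation_app.
exact: List.Forall2_app.
Qed.

(* Bound channels are all sent to the same channel, the constant value of [K]:
   this makes the list invariant under alpha-conversion, scope extrusion and
   exchange of restrictions, whereas [pcong] does not look at channel names. *)
Fixpoint flat (K r : chan S -> chan S) M : seq (nodeT S) :=
  match M with
  | NZero => [::]
  | NNode x => [:: MkNode (nname x) (niface x) (pmapC r (nproc x)) (nmob x) (nloc x)]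
  | NPar M N => flat K r M ++ flat K r N
  | NRes c M => flat K (fun e => if e == c then K c else r e) M
  end.

Lemma eq_flat K r r' M : {in nfree M, r =1 r'} -> flat K r M = flat K r' M.
Proof.
elim: M r r' => //= [x|M IH N IH'|c M IH] r r' h.
- by rewrite (eq_pmapC h).
- by rewrite (IH r r') ?(IH' r r') // => e he; apply: h; rewrite mem_cat he ?orbT.
- apply: IH => e he; case: eqP => // /eqP hc; apply: h.
  by rewrite mem_filter hc.
Qed.

Lemma flat_nmapC K r f M : (forall c d, K c = K d) -> injective f ->
  flat K r (nmapC f M) = flat K (r \o f) M.
Proof.
move=> hK injf; elim: M r => //= [x|M IH N IH'|c M IH] r.
- by rewrite pmapC_comp.
- by rewrite IH IH'.
- rewrite IH; apply: eq_flat => e _ /=; rewrite (inj_eq injf).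
  by case: eqP => // _; exact: hK.
Qed.

Lemma flat_ok K r M x : all_ok M -> List.In x (flat K r M) -> proc_ok (nproc x).
Proof.
elim: M r => //= [[n I P mu h]|M IH N IH'|c M IH] r.
- move=> /all_ok_node /node_okE [/pwf_ok h1 _] [<-|[]] //=.
  by rewrite proc_ok_pmapC.
- move=> /all_ok_par [h1 h2] /List.in_app_iff [] h3; [exact: IH h3|exact: IH' h3].
- by move=> h1 h2; exact: IH h2.
Qed.

(** Stated for all [r], because entering a restriction changes it. Constancy of [K] settles exchange
    of restrictions and alpha-conversion; extrusion holds because the channel is not free in the
    component left outside. *)
Lemma ncong_flat K r M N : (forall c d, K c = K d) ->
  ncong M N -> network M -> network N -> list_cong (flat K r M) (flat K r N).
Proof.
move=> hK H; have R r' M' : network M' -> list_cong (flat K r' M') (flat K r' M').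
  by move=> h; apply: list_cong_refl => x; apply: flat_ok; exact: network_all_ok.
elim: H r => {M N}.
- by move=> M r h _; exact: R.
- by move=> M N _ IH r h1 h2; apply/list_cong_sym/IH.
- by move=> M O N hO _ IH1 _ IH2 r h1 h2; apply: list_cong_trans (IH1 r h1 hO) (IH2 r hO h2).
- move=> M M' N N' _ IH1 _ IH2 r h1 h2; apply: list_cong_cat.
    exact: IH1 (network_parL h1) (network_parL h2).
  exact: IH2 (network_parR h1) (network_parR h2).
- by move=> c M N _ IH r h1 h2; exact: IH.
- move=> n I P Q mu h H r /network_pwf/pwf_ok h1 /network_pwf/pwf_ok h2.
  exists (flat K r (Node n I P mu h)); first exact: Permutation_refl.
  constructor=> //; split=> //=; rewrite ?proc_ok_pmapC //; exact: pcong_pmapC.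
- move=> M N r h1 h2 /=; have [L hp hf] := R r _ h2.
  exists L => //; apply: Permutation_trans hp; exact: Permutation_app_comm.
- by move=> M N O r h1 h2; have := R r _ h1; rewrite /= catA.
- by move=> M r h1 h2; have := R r _ h1; rewrite /= cats0.
- by move=> c r h1 h2; exact: R.
- move=> c d M r h1 h2 /=; have := R r _ h1; rewrite /=.
  set A := flat K _ M; set B := flat K _ M; suff -> : B = A by [].
  by apply: eq_flat => e _; case: eqP => // ->; case: eqP => // <-; exact: hK.
- move=> c M N hc r h1 h2 /=; have := R r _ h1; rewrite /=.
  set A := flat K _ M; set B := flat K r M; suff -> : B = A by [].
  by apply: eq_flat => e he; case: eqP => // E; rewrite -E he in hc.
- move=> c d M hd hr r h1 h2 /=; have := R r _ h1.
  rewrite /= (flat_nmapC _ _ hK (inv_inj (@cswapK S c d))).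
  set A := flat K _ M; set B := flat K _ M; suff -> : B = A by [].
  apply: eq_flat => e he /=; rewrite /cswap.
  have hed : e != d by apply: contraNneq hd => <-.
  have [hec|hec] := eqVneq e c; first by rewrite eqxx; exact: hK.
  by rewrite (negbTE hed) (negbTE hed).
Qed.

Fixpoint nores M : bool :=
  match M with
  | NZero | NNode _ => true
  | NPar M N => nores M && nores N
  | NRes _ _ => false
  end.

Lemma flat_nores K M : nores M -> flat K id M = nodes M.
Proof.
elim: M => //= [[n I P mu h] _|M IH N IH' /andP [/IH -> /IH' ->]] //=.
by rewrite pmapC_id.
Qed.

Lemma nores_ntrans l M M' : ntrans l M M' -> nores M = nores M'.
Proof. by elim=> //= [c v k h M1 M1' N N' _ -> _ ->|c v k h M1 M1' N N' _ -> _ ->|l' M1 M1' N _ ->|l' M1 M1' N _ ->]. Qed.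

(** The derivation may pass through networks with restrictions even though its ends have none, so no
    direct induction is possible; [flat] makes sense for the intermediate networks too. *)
Lemma ncong_nodes M N : nores M -> nores N -> ncong M N -> network M -> network N ->
  list_cong (nodes M) (nodes N).
Proof.
move=> hM hN H h1 h2.
(* If there are no channels at all, the identity is constant vacuously. *)
have [K hK] : exists K : chan S -> chan S, forall c d, K c = K d.
  have [[c _]|no] := classic (exists c : chan S, True); first by exists (fun _ => c).
  by exists id => c; case: no; exists c.
have := ncong_flat id hK H h1 h2; by rewrite !flat_nores.
Qed.

Definition lprod L : net S := foldr (fun x M => NPar (NNode x) M) (NZero S) L.

Lemma nodes_lprod L : nodes (lprod L) = L.
Proof. by elim: L => //= x L ->. Qed.

Lemma eq_network M N : nodes M = nodes N -> network M -> network N.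
Proof. by rewrite /network => ->. Qed.

Lemma scong_lprod_cat L L' : network (lprod (L ++ L')) ->
  scong (NPar (lprod L) (lprod L')) (lprod (L ++ L')).
Proof.
elim: L => /= [|x L IH] hn.
  have h0 : network (NPar (NZero S) (lprod L')) by exact: eq_network hn.
  by apply: scong_trans (scong_parC h0) (scong_par0 hn).
have h1 := IH (network_parR hn); have h2 := scong_parr (scong_sym h1) hn.
apply: scong_trans (scong_sym h2); apply/scong_sym/scong_parA.
by case: h2.
Qed.

Lemma scong_lprod M : nores M -> network M -> scong M (lprod (nodes M)).
Proof.
elim: M => //= [_ h|x _ h|M IH N IH' /andP [hM hN] h].
- exact: scong_refl.
- exact/scong_sym/scong_par0.
- have h1 := scong_par (IH hM (network_parL h)) (IH' hN (network_parR h)) h.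
  apply: (scong_trans h1); apply: scong_lprod_cat.
  by apply: eq_network h; rewrite nodes_lprod.
Qed.

Lemma scong_perm L L' : Permutation L L' -> network (lprod L) -> scong (lprod L) (lprod L').
Proof.
elim=> {L L'} /=.
- exact: scong_refl.
- by move=> x L L' _ IH h; apply: scong_parr => //; apply/IH/(network_parR h).
- move=> x y L h; have h1 := scong_parA h.
  have h2 := scong_parl (scong_parC (network_parL (proj1 (network_parA _ _ _) h))) (proj1 (network_parA _ _ _) h).
  apply: (scong_trans h1); apply: (scong_trans h2); apply/scong_sym/scong_parA/network_parA.
  by case: h2.
- move=> L1 L2 L3 _ IH1 _ IH2 h; have h1 := IH1 h; apply: (scong_trans h1); apply: IH2.
  by case: h1.
Qed.

Variable q : nodename S -> proc S.

(** The added process is looked up by node name, not by position: congruence permutes nodes but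
    keeps their names. *)
Definition addq1 x := MkNode (nname x) (niface x) (PPar (nproc x) (q (nname x))) (nmob x) (nloc x).

Fixpoint addq M : net S :=
  match M with
  | NZero => NZero S
  | NNode x => NNode (addq1 x)
  | NPar M N => NPar (addq M) (addq N)
  | NRes c M => NRes c (addq M)
  end.

Lemma ntrans_addq l M M' : ntrans l M M' -> ntrans l (addq M) (addq M').
Proof.
by elim=> {l M M'} /=; move=> *; econstructor; eauto.
Qed.

Lemma nodes_addq M : nodes (addq M) = map addq1 (nodes M).
Proof. by elim: M => //= M -> N ->; rewrite map_cat. Qed.

Lemma nores_addq M : nores (addq M) = nores M.
Proof. by elim: M => //= M -> N ->. Qed.

Lemma network_addq_inv M : network (addq M) -> network M.
Proof.
move=> h; apply: (network_perm _ h).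
  by rewrite nodes_addq -map_comp; exact: Permutation_refl.
move=> x hx; have : node_ok (addq1 x).
  by apply: (network_all_ok h); rewrite nodes_addq; exact: List.in_map.
by rewrite !node_okE /= pwf_par => -[/andP [-> _]].
Qed.

(** Adding components inside nodes is not a congruence rule. It is compatible with congruence
    because both networks have the same nodes up to order and congruent processes, so that equally
    named nodes receive the same addition. *)
Lemma scong_addq M N : nores M -> nores N -> scong M N -> network (addq M) ->
  scong (addq M) (addq N).
Proof.
move=> rM rN [hM hN hc] hq; have [L hp hf] := ncong_nodes rM rN hc hM hN.
have hqN : network (addq N).
  apply: (network_perm _ hq).
    rewrite !nodes_addq -!map_comp; exact: (ncong_dom hc).
  move=> z; rewrite nodes_addq => /List.in_map_iff [y [<- hy]].
  have [x hx [hk _ _ _]] : exists2 x, List.In x L & node_cong x y.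
    elim: hf hy => // x1 y1 L1 L2 h _ IH [<-|/IH [x ? ?]]; first by exists x1 => //; left.
    by exists x => //; right.
  have hx' : node_ok (addq1 x).
    apply: (network_all_ok hq); rewrite nodes_addq; apply: List.in_map.
    exact: Permutation_in (Permutation_sym hp) hx.
  have := network_all_ok hN hy; move: hx'; rewrite !node_okE /= !pwf_par.
  case: x y hk {hx hy} => [n I P mu h] [n' I' P' mu' h'] [-> -> -> ->] /=.
  by move=> [/andP [_ ->] h1] [-> _].
have h1 : scong (addq M) (lprod (nodes (addq M))) by apply: scong_lprod; rewrite ?nores_addq.
have h2 : scong (addq N) (lprod (nodes (addq N))) by apply: scong_lprod; rewrite ?nores_addq.
apply: (scong_trans h1); apply: scong_trans (scong_sym h2).
have h3 : scong (lprod (nodes (addq M))) (lprod (map addq1 L)).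
  by apply: scong_perm; [rewrite nodes_addq; exact: Permutation_map|case: h1].
apply: (scong_trans h3); split; [by case: h3|by case: h2|].
rewrite nodes_addq; elim: hf => [|x y L1 L2 [hk _ _ hx] _ IH] /=; first exact: nc_refl.
apply: nc_par => //.
case: x y hk hx => [n I P mu h] [n' I' P' mu' h'] [-> -> -> ->] /= hx.
by apply: nc_node; apply: pc_par hx _; exact: pc_refl.
Qed.

End ReductionsTransitions.

(** * Agreement of reductions and transitions *)

Section Harmony.

Variable S : cait.
Implicit Types (P Q R T : proc S) (I J : iface S) (M N O : net S) (c d e : chan S).

Hint Constructors ptrans ptick ntrans ntick : core.

Lemma names_nprod k (n : 'I_k -> nodename S) (I : 'I_k -> iface S) (P : 'I_k -> proc S) mu h :
  map (@nname S) (nodes (nprod (fun i => Node (n i) (I i) (P i) (mu i) (h i)))) =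
  map n (index_enum 'I_k).
Proof.
rewrite /nprod; elim: (index_enum _) => [|i r IH]; rewrite ?big_nil ?big_cons //=.
by rewrite IH.
Qed.

Lemma nores_nprod k (n : 'I_k -> nodename S) (I : 'I_k -> iface S) (P : 'I_k -> proc S) mu h :
  nores (nprod (fun i => Node (n i) (I i) (P i) (mu i) (h i))).
Proof. by rewrite /nprod; elim/big_ind: _ => //= M N -> ->. Qed.

Lemma addq_nprod k q (n : 'I_k -> nodename S) (I : 'I_k -> iface S) (P : 'I_k -> proc S) mu h :
  addq q (nprod (fun i => Node (n i) (I i) (P i) (mu i) (h i))) =
  nprod (fun i => Node (n i) (I i) (PPar (P i) (q (n i))) (mu i) (h i)).
Proof. exact: (big_morph (addq q)). Qed.

(** Transitions have no structural rule, so the target is reached only up to [scong]. This looseness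
    is what makes [red_parp] the hard case. *)
Lemma red_ntrans w M M' : red w M M' -> network M ->
  exists2 N, ntrans (ract_nlab w) M N & scong N M'.
Proof.
have fin w0 M0 M0' : ntrans (ract_nlab w0) M0 M0' -> network M0 ->
    exists2 N, ntrans (ract_nlab w0) M0 N & scong N M0'.
  by move=> h hM; exists M0' => //; exact/scong_refl/(network_ntrans h hM).
elim=> {w M M'}.
- by move=> n I P mu h; apply: fin; apply: nt_pos.
- by move=> n I s v P mu h hs; apply: fin; apply: nt_sensread hs _.
- by move=> n I a v P mu h hs; apply: fin; apply: nt_actunchg hs _.
- by move=> n I a v P mu h hs; apply: fin; apply: nt_actchg hs _.
- by move=> n I c v P R Q T mu h hc; apply: fin; apply: nt_loccom; eauto.
- move=> n I c v P R mu1 h m J Q T mu2 k hd; apply: fin.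
  apply: (@nt_glbcomL S c v h k); last by rewrite dist_sym.
    by apply: nt_out => //; case: (rng c) hd.
  by apply: nt_in => //; case: (rng c) hd.
- move=> w k n I I' P P' Q mu mu' h h' _ IH hn.
  have injn : injective n.
    have [_ + _ _] := hn; rewrite names_nprod => hu i j E; apply/eqP.
    have := nth_uniq (n i) _ _ hu; rewrite size_map => H.
    have hi := mem_index_enum i; have hj := mem_index_enum j.
    have := H (index i (index_enum 'I_k)) (index j (index_enum 'I_k)).
    rewrite !index_mem => /(_ hi hj); rewrite !(nth_map i) ?index_mem // !nth_index //.
    rewrite E eqxx => /esym/eqP Ei; apply/eqP.
    by rewrite -(nth_index i hi) Ei nth_index.
  (* Names in a network are distinct, so [n] is injective and the family [Q] can be read as a
     function of names; names that do not occur get [nil]. *)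
  pose q m := if [pick i | n i == m] is Some i then Q i else PNil S.
  have hq i : q (n i) = Q i.
    by rewrite /q; case: pickP => [j /eqP /injn -> //|/(_ i)]; rewrite eqxx.
  have Eq (I0 : 'I_k -> iface S) (P0 : 'I_k -> proc S) mu0 h0 : nprod (fun i => Node (n i) (I0 i) (PPar (P0 i) (Q i)) (mu0 i) (h0 i)) =
      addq q (nprod (fun i => Node (n i) (I0 i) (P0 i) (mu0 i) (h0 i))).
    by rewrite addq_nprod /nprod; apply: eq_bigr => i _; rewrite hq.
  rewrite !Eq in hn *; have [N h1 h2] := IH (network_addq_inv hn).
  have h3 := ntrans_addq q h1; exists (addq q N) => //.
  apply: scong_addq => //; last exact: network_ntrans h3 hn.
    by rewrite -(nores_ntrans h1) nores_nprod.
  exact: nores_nprod.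
- move=> w M M' N _ IH hn; have [M1 h1 h2] := IH (network_parL hn).
  exists (NPar M1 N); first exact: nt_parL.
  by apply: scong_parl => //; exact: network_ntrans (nt_parL N h1) hn.
- move=> w c M M' _ IH hn; have [M1 h1 h2] := IH hn.
  by exists (NRes c M1); [apply: nt_res => //; case: (w)|exact: scong_res].
- move=> w M N N' M' [hM hN hc] _ IH hs _; have [N1 h1 h2] := IH hN.
  have [M1 h3 h4] := ncong_ntrans (nc_sym hc) hN hM h1; exists M1 => //.
  apply: scong_trans hs; apply: scong_trans h2; split; last exact: nc_sym.
    exact: network_ntrans h3 hM.
  exact: network_ntrans h1 hN.
Qed.

(** Identifies the negative premises of the two semantics, after which sigma-reductions and ticks
    can be compared rule by rule. *)
Lemma no_tauE M : network M -> no_redtau M <-> no_ntau M.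
Proof.
move=> hM; split=> no M' h; first by apply: (no M'); exact: (@ntrans_red S (RTau S)).
by have [N /no] := red_ntrans h hM.
Qed.

Lemma ptick_pprod k (F F' : 'I_k -> proc S) :
  (forall i, ptick (F i) (F' i)) -> (forall R, ~ ptrans (LTau S) (pprod F) R) ->
  ptick (pprod F) (pprod F').
Proof.
rewrite /pprod; elim: k F F' => [|k IH] F F' h; rewrite ?big_ord0 // !big_ord_recl => no.
by apply: pk_par => //; apply: IH => // R hR; exact: no (pt_parR _ hR).
Qed.

Lemma redsigma_ntick M M' : redsigma M M' -> network M ->
  exists2 N, ntick M N & scong N M'.
Proof.
have node n I p (pi : 'I_p -> cpre S) (P Q : 'I_p -> proc S) k (R : 'I_k -> proc S) mu h :
    let T := PPar (pprod (fun i => PTout (pi i) (P i) (Q i)))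
                  (pprod (fun j => PPref (ISigma S) (R j))) in
    no_redtau (Node n I T mu h) -> network (Node n I T mu h) ->
    no_ntau (Node n I T mu h) /\ ptick T (PPar (pprod Q) (pprod R)).
  move=> T no hn; have no' := proj1 (no_tauE hn) no; split=> //.
  have noT X : ~ ptrans (LTau S) T X by move=> hX; apply: (no' _); apply: nt_loccom hX.
  apply: pk_par => //; apply: ptick_pprod => // X hX.
    exact: noT (pt_parL _ hX).
  exact: noT (pt_parR _ hX).
have fin M0 M0' : ntick M0 M0' -> network M0 -> exists2 N, ntick M0 N & scong N M0'.
  by move=> h hM; exists M0' => //; exact/scong_refl/(network_ntick h hM).
elim=> {M M'}.
- move=> n I p pi P Q k R h N no hN; apply: fin => //.
  by have [h1 h2] := node _ _ _ _ _ _ _ _ _ _ no hN; exact: nk_stat.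
- move=> n I p pi P Q k R h h' N no hd hN; apply: fin => //.
  by have [h1 h2] := node _ _ _ _ _ _ _ _ _ _ no hN; exact: nk_mob.
- move=> M M' N N' _ IH1 _ IH2 no hn.
  have [M1 h1 h2] := IH1 (network_parL hn); have [N1 h3 h4] := IH2 (network_parR hn).
  have h5 : ntick (NPar M N) (NPar M1 N1) by apply: nk_par => //; exact/no_tauE.
  by exists (NPar M1 N1) => //; apply: scong_par => //; exact: network_ntick h5 hn.
- by apply: fin; constructor.
- move=> c M M' _ IH hn; have [M1 h1 h2] := IH hn.
  by exists (NRes c M1); [constructor|exact: scong_res].
- move=> M N N' M' [hM hN hc] _ IH hs _; have [N1 h1 h2] := IH hN.
  have [M1 h3 h4] := ncong_ntick (nc_sym hc) hN hM h1; exists M1 => //.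
  apply: scong_trans hs; apply: scong_trans h2; split; last exact: nc_sym.
    exact: network_ntick h3 hM.
  exact: network_ntick h1 hN.
Qed.

Local Notation bigpar s F := (\big[@PPar S/PNil S]_(t <- s) F t).

Lemma pcongw_bigpar_cat (A : Type) I (F : A -> proc S) s t :
  pwf I (bigpar s F) -> pwf I (bigpar t F) ->
  pcongw I (PPar (bigpar s F) (bigpar t F)) (bigpar (s ++ t) F).
Proof.
elim: s => [|x s IH] /=; rewrite ?big_nil ?big_cons.
  move=> h0 h; exact: pcongw_trans (pcongw_parC h0 h) (pcongw_par0 h).
rewrite pwf_par => /andP [hx hs] ht.
apply: pcongw_trans (pcongw_sym (pcongw_parA hx hs ht)) _.
by apply: pcongw_par; [exact: pcongw_refl|exact: IH].
Qed.

(** The reduction rules for time apply only to a literal product of timeouts and delays. The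
    derivation of the tick exhibits it: recursions are unfolded, guards resolved, and [nil] becomes
    a pair of empty products. *)
Lemma ptick_canonical I P P' : ptick P P' -> pwf I P ->
  exists (ts : seq (cpre S * proc S * proc S)) (rs : seq (proc S)),
    pcongw I P (PPar (bigpar ts (fun t => PTout t.1.1 t.1.2 t.2)) (bigpar rs (PPref (ISigma S)))) /\
    pcongw I P' (PPar (bigpar ts (fun t => t.2)) (bigpar rs id)).
Proof.
have single P0 : pwf I P0 -> pcongw I P0 (PPar (PNil S) (PPar P0 (PNil S))).
  move=> h; apply/pcongw_sym; apply: pcongw_trans (pcongw_par0 h).
  have h0 : pwf I (PPar P0 (PNil S)) by rewrite pwf_par h.
  apply: pcongw_trans (pcongw_parC _ h0) (pcongw_par0 h0); exact: isT.
have single' P0 : pwf I P0 -> pcongw I P0 (PPar (PPar P0 (PNil S)) (PNil S)).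
  move=> h; apply/pcongw_sym; apply: pcongw_trans (pcongw_par0 h).
  by apply: pcongw_par0; rewrite pwf_par h.
elim=> {P P'}.
- by move=> h; exists [::], [::]; rewrite !big_nil; split; apply/pcongw_sym/pcongw_par0.
- move=> P h; exists [::], [:: P]; rewrite !big_nil !big_cons !big_nil.
  by split; apply: single => //; exact: pwf_ptick (pk_sigma P) h.
- move=> p P Q h; exists [:: (p, P, Q)], [::]; rewrite !big_nil !big_cons !big_nil /=.
  by split; apply: single' => //; exact: pwf_ptick (pk_tout p P Q) h.
- move=> P P' Q Q' _ IH1 _ IH2 _; rewrite pwf_par => /andP [/IH1 [t1 [r1 [p1 p1']]]].
  move=> /IH2 [t2 [r2 [p2 p2']]]; exists (t1 ++ t2), (r1 ++ r2).
  have aux A B (F : A -> proc S) (G : B -> proc S) a1 a2 b1 b2 X Y :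
      pcongw I X (PPar (bigpar a1 F) (bigpar b1 G)) ->
      pcongw I Y (PPar (bigpar a2 F) (bigpar b2 G)) ->
      pcongw I (PPar X Y) (PPar (bigpar (a1 ++ a2) F) (bigpar (b1 ++ b2) G)).
    move=> hX hY; apply: pcongw_trans (pcongw_par hX hY) _.
    move: hX hY => [_ + _] [_ + _]; rewrite !pwf_par => /andP [? ?] /andP [? ?].
    apply: (@pcongw_trans _ _ (PPar (PPar (bigpar a1 F) (bigpar a2 F)) (PPar (bigpar b1 G) (bigpar b2 G)))).
      exact: pcongw_parACA.
    by apply: pcongw_par; exact: pcongw_bigpar_cat.
  by split; exact: aux.
- move=> P Q _ IH h; have [t [r [p p']]] := IH (pwf_unfold h); exists t, r; split=> //.
  exact: pcongw_trans (pcongw_unfold h) p.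
- move=> b P Q P' hb _ IH h; have hc := pcongw_true hb h; have [_ /IH + _] := hc.
  by move=> [t [r [p p']]]; exists t, r; split=> //; exact: pcongw_trans hc p.
- move=> b P Q P' hb _ IH h; have hc := pcongw_false hb h; have [_ /IH + _] := hc.
  by move=> [t [r [p p']]]; exists t, r; split=> //; exact: pcongw_trans hc p.
Qed.

Lemma ptick_pprod_inv I P P' : ptick P P' -> pwf I P ->
  exists p (pi : 'I_p -> cpre S) (A B : 'I_p -> proc S) q (R : 'I_q -> proc S),
    pcongw I P (PPar (pprod (fun i => PTout (pi i) (A i) (B i)))
                     (pprod (fun j => PPref (ISigma S) (R j)))) /\
    pcongw I P' (PPar (pprod B) (pprod R)).
Proof.
move=> h hP; have [ts [rs []]] := ptick_canonical h hP.
rewrite !(big_tnth _ _ ts) !(big_tnth _ _ rs) => h1 h2.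
by exists (size ts), (fun i => (tnth (in_tuple ts) i).1.1), (fun i => (tnth (in_tuple ts) i).1.2),
  (fun i => (tnth (in_tuple ts) i).2), (size rs), (tnth (in_tuple rs)).
Qed.

Lemma ntick_redsigma M M' : ntick M M' -> network M -> redsigma M M'.
Proof.
have no_c n I P Q mu h : pcongw I P Q -> network (Node n I P mu h) ->
    no_ntau (Node n I P mu h) -> no_redtau (Node n I Q mu h).
  move=> p hn no; have [h1 h2 h3] := scong_node p hn; apply/no_tauE => //.
  exact: ncong_no_ntau h3 h1 h2 no.
elim=> {M M'}.
- move=> n I P P' h hp no hn; have hn' := network_ntick (nk_stat hp no) hn.
  have [p [pi [A [B [k [R [e e']]]]]]] := ptick_pprod_inv hp (network_pwf hn).
  apply: (rs_struct (scong_node e hn) _ (scong_sym (scong_node e' hn'))).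
  exact/rs_stat/(no_c _ _ _ _ _ _ e hn no).
- move=> n I P P' h h' hp no hd hn; have hn' := network_ntick (nk_mob hp no hd) hn.
  have [p [pi [A [B [k [R [e e']]]]]]] := ptick_pprod_inv hp (network_pwf hn).
  apply: (rs_struct (scong_node e hn) _ (scong_sym (scong_node e' hn'))).
  by apply: rs_mob => //; exact: (no_c _ _ _ _ _ _ e hn no).
- move=> M M' N N' h1 IH1 h2 IH2 no hn; apply: rs_par.
  + exact: IH1 (network_parL hn).
  + exact: IH2 (network_parR hn).
  + exact/no_tauE.
- by move=> _; exact: rs_zero.
- by move=> c M M' _ IH hn; apply/rs_res/IH.
Qed.

End Harmony.

(** * Barbs *)

Section Barbs.

Variable S : cait.
Implicit Types (M N O : net S) (c d e : chan S) (x : nodeT S).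

Lemma nodes_ress (g : seq (chan S)) M : nodes (ress g M) = nodes M.
Proof. by elim: g. Qed.

(** [N] collects the components set aside and [f] the alpha-conversions made on the way to the node.
    Renaming affects only its process, which is therefore left unspecified. *)
Lemma scong_expose f x M N : network (NPar (nmapC f M) N) -> List.In x (nodes M) ->
  exists g P M', scong (NPar (nmapC f M) N)
    (ress g (NPar (Node (nname x) (niface x) P (nmob x) (nloc x)) M')).
Proof.
elim: M f N => //= [y|M1 IH1 M2 IH2|c M IH] f N hn.
- by case=> // <-; exists [::], (pmapC f (nproc y)), N; exact: scong_refl.
- case/List.in_app_iff => hx.
    have s1 := scong_sym (scong_parA (proj2 (network_parA _ _ _) hn)).
    have [_ hn1 _] := s1; have [g [P [M' s2]]] := IH1 _ _ hn1 hx.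
    by exists g, P, M'; exact: scong_trans s1 s2.
  have s0 := scong_parl (scong_parC (network_parL hn)) hn; have [_ hn0 _] := s0.
  have s1 := scong_sym (scong_parA (proj2 (network_parA _ _ _) hn0)).
  have [_ hn1 _] := s1; have [g [P [M' s2]]] := IH2 _ _ hn1 hx.
  by exists g, P, M'; exact: scong_trans (scong_trans s0 s1) s2.
- move=> hx; have [d [_ h1 h2 _ hr]] := chan_fresh4 (f c) c (nfree N) (nfree (nmapC f M)) [::].
  have s1 := scong_extrude_l h1 h2 hr (hn : network (NPar (nmapC f M) N)).
  have [_ hn1 _] := s1; rewrite nmapC_comp in hn1 s1.
  have [g [P [M' s2]]] := IH _ _ hn1 hx.
  by exists (d :: g), P, M'; exact: scong_trans s1 (scong_res d s2).
Qed.

(** Reduces barbs to the list of nodes: one direction is the invariance of keys, the other brings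
    the node to the top by [scong_expose]. *)
Lemma barbP a v h M : network M ->
  barb a v h M <-> exists x, [/\ List.In x (nodes M), nloc x = h & iact (niface x) a = Some v].
Proof.
move=> hM; split=> [[g [n [I [P [mu [M' [[_ _ hc] ha]]]]]]]|[x [hx <- ha]]].
  have := Permutation_in (n, I, mu, h) (Permutation_sym (ncong_key hc)).
  rewrite nodes_ress => /(_ (or_introl erefl)) /List.in_map_iff [[n' I' P' mu' h'] [E hx]].
  by case: E hx => -> -> -> -> hx; exists (MkNode n I P' mu h).
have := @scong_expose id x M (NZero S).
rewrite nmapC_id => /(_ (network_par0 hM) hx) [g [P [M' s]]].
exists g, (nname x), (niface x), P, (nmob x), M'; split=> //.
exact: scong_trans (scong_sym (scong_par0 hM)) s.
Qed.

Lemma barb_scong a v h M N : scong M N -> barb a v h M -> barb a v h N.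
Proof.
move=> hs [g [n [I [P [mu [M' [h1 h2]]]]]]]; exists g, n, I, P, mu, M'; split=> //.
exact: scong_trans (scong_sym hs) h1.
Qed.

Lemma barb_par a v h M N : network (NPar M N) ->
  barb a v h (NPar M N) <-> barb a v h M \/ barb a v h N.
Proof.
move=> hn; rewrite !barbP //; try exact: network_parL hn; try exact: network_parR hn.
split=> [[x [/List.in_app_iff [] hx h1 h2]]|[] [x [hx h1 h2]]].
- by left; exists x.
- by right; exists x.
- by exists x; split=> //; apply/List.in_app_iff; left.
- by exists x; split=> //; apply/List.in_app_iff; right.
Qed.

Lemma barb_res a v h c M : network M -> barb a v h (NRes c M) <-> barb a v h M.
Proof. by move=> hM; rewrite !barbP. Qed.

End Barbs.

(** * Bisimilarity *)

Section Bisimilarity.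

Variable S : cait.
Implicit Types (M N O X Y Z : net S) (c d e : chan S) (l : elab S).

Hint Constructors ntrans ntick etrans : core.

Lemma network_etrans l M M' : etrans l M M' -> network M -> network M'.
Proof.
case=> {l M M'} //.
- by move=> M M' h; exact: network_ntrans h.
- by move=> M M' h; exact: network_ntick h.
- by move=> a M M' h; exact: network_ntrans h.
- by move=> c v h k M M' H _; exact: network_ntrans H.
- by move=> c v h k M M' H _; exact: network_ntrans H.
- by move=> s v h M hv; exact: network_sens_update.
Qed.

Lemma taus_refl M : taus M M.
Proof. exact: rt_refl. Qed.

Lemma taus_trans N M O : taus M N -> taus N O -> taus M O.
Proof. exact: rt_trans. Qed.

Lemma taus_map (F : net S -> net S) M M' :
  (forall X Y, ntrans (NLTau S) X Y -> ntrans (NLTau S) (F X) (F Y)) ->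
  taus M M' -> taus (F M) (F M').
Proof.
move=> hF; elim=> [X Y h|X|X Y Z _ h1 _ h2]; last exact: taus_trans h1 h2.
  by inversion h; subst; apply: rt_step; auto.
exact: taus_refl.
Qed.

Lemma taus_wtrans_hat l M N O O' : taus M N -> wtrans_hat l N O -> taus O O' ->
  wtrans_hat l M O'.
Proof.
case: l => /=; try by move=> *; match goal with H : wtrans _ _ _ |- _ =>
  case: H => N1 [N2 [h1 h2 h3]]; exists N1, N2; split=> //; [exact: taus_trans h1|exact: taus_trans h3 _] end.
by move=> h1 h2 h3; exact: taus_trans (taus_trans h1 h2) h3.
Qed.

Lemma etrans_wtrans_hat l M N : etrans l M N -> wtrans_hat l M N.
Proof.
move=> h; suff H : wtrans l M N by case: l h H => // h _; exact: rt_step.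
by exists M, N; split=> //; exact: taus_refl.
Qed.

Lemma wtrans_hat_map l M N M' N' : (taus M N -> taus M' N') ->
  (wtrans l M N -> wtrans l M' N') -> wtrans_hat l M N -> wtrans_hat l M' N'.
Proof. by case: l. Qed.

Lemma bisimilar_networks M N : bisimilar M N -> network M /\ network N.
Proof. by case=> R [h _ _] /h. Qed.

Lemma bisimilar_sym M N : bisimilar M N -> bisimilar N M.
Proof. by case=> R hR h; exists R => //; case: hR => _ hs _; exact: hs. Qed.

Lemma bisimilar_etrans l M N M' : bisimilar M N -> etrans l M M' ->
  exists2 N', wtrans_hat l N N' & bisimilar M' N'.
Proof.
case=> R hR h hl; have [_ _ ht] := hR; have [N' h1 h2] := ht _ _ _ _ h hl.
by exists N' => //; exists R.
Qed.

Lemma bisimilar_taus M N M' : bisimilar M N -> taus M M' ->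
  exists2 N', taus N N' & bisimilar M' N'.
Proof.
move=> h H; elim: H N h => [X Y hs N h|X N h|X Y Z _ IH1 _ IH2 N h].
- exact: (bisimilar_etrans h hs).
- by exists N => //; exact: taus_refl.
- have [N1 h1 h2] := IH1 _ h; have [N2 h3 h4] := IH2 _ h2; exists N2 => //.
  exact: taus_trans h1 h3.
Qed.

Lemma bisimilar_wtrans l M N M' : bisimilar M N -> wtrans_hat l M M' ->
  exists2 N', wtrans_hat l N N' & bisimilar M' N'.
Proof.
move=> h; have gen : wtrans l M M' -> exists2 N', wtrans_hat l N N' & bisimilar M' N'.
  move=> [M1 [M2 [h1 h2 h3]]]; have [N1 a1 b1] := bisimilar_taus h h1.
  have [N2 a2 b2] := bisimilar_etrans b1 h2; have [N3 a3 b3] := bisimilar_taus b2 h3.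
  by exists N3 => //; exact: taus_wtrans_hat a1 a2 a3.
by case: l gen => // _; exact: bisimilar_taus.
Qed.

Lemma bisimilar_trans N M O : bisimilar M N -> bisimilar N O -> bisimilar M O.
Proof.
move=> h1 h2; exists (fun X Z => exists2 Y, bisimilar X Y & bisimilar Y Z); last by exists N.
split=> [X Z [Y a b]|X Z [Y a b]|X Z l X' [Y a b] h].
- by have [? _] := bisimilar_networks a; have [_ ?] := bisimilar_networks b.
- by exists Y; exact: bisimilar_sym.
- have [Y' a1 b1] := bisimilar_etrans a h; have [Z' a2 b2] := bisimilar_wtrans b a1.
  by exists Z' => //; exists Y'.
Qed.

Lemma scong_etrans l M N M' : scong M N -> etrans l M M' ->
  exists2 N', etrans l N N' & scong M' N'.
Proof.
move=> hs h; have [hM hN hc] := hs.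
suff [N' h1 h2] : exists2 N', etrans l N N' & ncong M' N'.
  by exists N' => //; split=> //; [exact: network_etrans h hM|exact: network_etrans h1 hN].
case: h hs hM hc => {l M M'} [M M' H|M M' H|a M M' H|c v h k M M' H hd|c v h k M M' H hd
  |s v h M hv|a v h M hb] hs hM hc.
- by have [N' h1 h2] := ncong_ntrans hc hM hN H; exists N'; auto.
- by have [N' h1 h2] := ncong_ntick hc hM hN H; exists N'; auto.
- by have [N' h1 h2] := ncong_ntrans hc hM hN H; exists N'; auto.
- by have [N' h1 h2] := ncong_ntrans hc hM hN H; exists N'; eauto.
- by have [N' h1 h2] := ncong_ntrans hc hM hN H; exists N'; eauto.
- by exists (sens_update s h v N); auto; exact: ncong_sens_update.
- by exists N => //; apply: et_barb; exact: barb_scong hs hb.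
Qed.

Lemma scong_bisimilar M N : scong M N -> bisimilar M N.
Proof.
move=> h; exists (@scong S) => //; split=> [X Y []|X Y|X Y l X' h1 h2] //.
  exact: scong_sym.
have [Y' h3 h4] := scong_etrans h1 h2; exists Y' => //; exact: etrans_wtrans_hat.
Qed.

Lemma taus_no_ntau M N : no_ntau M -> taus M N -> N = M.
Proof.
move=> no h; elim: h no => // [X Y h no|X Y Z _ IH1 _ IH2 no].
  by inversion h; subst; case: (no Y).
by have E := IH1 no; rewrite E in IH2; exact: IH2.
Qed.

Lemma wtrans_no_ntau l M N : l <> ETau S -> no_ntau M -> wtrans_hat l M N ->
  exists N', etrans l M N'.
Proof.
move=> hl no; suff H : wtrans l M N -> exists N', etrans l M N' by case: l hl H.
by move=> [M1 [M2 [h1 h2 _]]]; rewrite -(taus_no_ntau no h1); exists M2.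
Qed.

(** Channels are not values, so communication never extrudes a scope and the pairs need no enclosing
    restrictions. *)
Definition par_rel X Y := exists M N O,
  [/\ X = NPar M O, Y = NPar N O, bisimilar M N, network X & network Y].

Lemma network_taus M N : taus M N -> network M -> network N.
Proof.
elim=> [X Y h|X|X Y Z _ h1 _ h2] //; first exact: network_etrans h.
by move=> h; exact/h2/h1.
Qed.

Lemma network_wtrans l M N : wtrans_hat l M N -> network M -> network N.
Proof.
have gen : wtrans l M N -> network M -> network N.
  move=> [M1 [M2 [h1 h2 h3]]] hM; apply: (network_taus h3); apply: (network_etrans h2).
  exact: network_taus h1 hM.
by case: l gen => // _; exact: network_taus.
Qed.

(* A tick of [M | O] is answered by a tick of [N1 | O] where [N1] is reached from
   [N] by internal moves and satisfies [M ~ N1]; maximal progress is not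
   violated because a communication of [N1] with [O] would give one of [M] with
   [O]. *)
Lemma par_no_ntau M N O : bisimilar M N -> no_ntau N -> no_ntau (NPar M O) ->
  no_ntau (NPar N O).
Proof.
move=> hb noN no X H; have noM : no_ntau M by move=> Y hY; exact: no (nt_parL O hY).
(* As [M] is stable, its weak answer to a label other than tau starts with that very label. *)
have weak l Y : l <> ETau S -> etrans l N Y -> exists Y', etrans l M Y'.
  move=> hl hY; have [Y' h1 _] := bisimilar_etrans (bisimilar_sym hb) hY.
  exact: wtrans_no_ntau hl noM h1.
inversion H as [| | | | | | |c v k h X1 X1' X2 X2' K1 K2 hd|c v k h X1 X1' X2 X2' K1 K2 hd
  |l' X1 X1' X2 K|l' X1 X1' X2 K|]; subst.
- have [||Y' hY'] := weak (EOut c v h) X1' => //.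
    by apply: et_out K1 _; rewrite dist_sym.
  inversion hY' as [| | |c0 v0 h0 k0 Z1 Z2 K hk| | |]; subst.
  by apply: (no _); apply: nt_glbcomL K K2 _; rewrite dist_sym.
- have [||Y' hY'] := weak (EIn c v k) X2' => //.
    by apply: et_in K2 _; rewrite dist_sym.
  inversion hY' as [| | | |c0 v0 h0 k0 Z1 Z2 K hk| |]; subst.
  by apply: (no _); apply: nt_glbcomR K1 K _; rewrite dist_sym.
- exact: noN K.
- exact: no (nt_parR M K).
Qed.

Lemma par_rel_bisimulation : bisimulation par_rel.
Proof.
split=> [X Y [M [N [O []]]]|X Y [M [N [O [-> -> hb h1 h2]]]]|X Y l X' [M [N [O [-> -> hb hM hN]]]] H] //.
  by exists N, M, O; split=> //; exact: bisimilar_sym.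
have tp O' X1 X2 : taus X1 X2 -> taus (NPar X1 O') (NPar X2 O').
  by apply: (@taus_map (fun Z => NPar Z O')) => *; exact: nt_parL.
have fin : (exists N' M' O', [/\ X' = NPar M' O', wtrans_hat l (NPar N O) (NPar N' O') &
    bisimilar M' N']) -> exists2 N', wtrans_hat l (NPar N O) N' & par_rel X' N'.
  move=> [N' [M' [O' [E h1 h2]]]]; exists (NPar N' O') => //; exists M', N', O'; split=> //.
    exact: network_etrans H hM.
  exact: network_wtrans h1 hN.
have fromO O' : etrans l (NPar N O) (NPar N O') -> X' = NPar M O' ->
    exists2 N', wtrans_hat l (NPar N O) N' & par_rel X' N'.
  by move=> h1 h2; apply: fin; exists N, M, O'; split=> //; exact: etrans_wtrans_hat.
have fromM M' : etrans l M M' -> X' = NPar M' O ->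
    (forall X1 X2, etrans l X1 X2 -> network (NPar X1 O) -> etrans l (NPar X1 O) (NPar X2 O)) ->
    exists2 N', wtrans_hat l (NPar N O) N' & par_rel X' N'.
  move=> h1 h2 hpar; have [N' h3 h4] := bisimilar_etrans hb h1.
  apply: fin; exists N', M', O; split=> //.
  have gen : wtrans l N N' -> wtrans l (NPar N O) (NPar N' O).
    move=> [N1 [N2 [a1 a2 a3]]]; exists (NPar N1 O), (NPar N2 O); split; auto.
    by apply: hpar => //; exact: network_taus (tp _ _ _ a1) hN.
  exact: wtrans_hat_map (tp _ _ _) gen h3.
inversion H as [X0 X0' K|X0 X0' K|a X0 X0' K|c v h k X0 X0' K hd|c v h k X0 X0' K hd
  |s v h X0 hv|a v h X0 hbarb]; subst.
- inversion K as [| | | | | | |c v k h X1 X1' X2 X2' K1 K2 hd|c v k h X1 X1' X2 X2' K1 K2 hd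
    |l' X1 X1' X2 K'|l' X1 X1' X2 K'|]; subst.
  (* The output is observed from the receiver's location [h]. The answer may be sent from elsewhere,
     but still within range of [h]. *)
  + have e : etrans (EOut c v h) M X1' by apply: et_out K1 _; rewrite dist_sym.
    have [N' [N1 [N2 [a1 a2 a3]]] h4] := bisimilar_etrans hb e.
    apply: fin; exists N', X1', X2'; split=> //=.
    inversion a2 as [| | |c0 v0 h0 k0 Z1 Z2 K3 hk| | |]; subst.
    apply: taus_trans (tp O _ _ a1) _; apply: taus_trans (tp X2' _ _ a3).
    by apply: rt_step; apply: et_tau; apply: nt_glbcomL K3 K2 _; rewrite dist_sym.
  + have e : etrans (EIn c v k) M X2' by apply: et_in K2 _; rewrite dist_sym.
    have [N' [N1 [N2 [a1 a2 a3]]] h4] := bisimilar_etrans hb e.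
    apply: fin; exists N', X2', X1'; split=> //=.
    inversion a2 as [| | | |c0 v0 h0 k0 Z1 Z2 K3 hk| |]; subst.
    apply: taus_trans (tp O _ _ a1) _; apply: taus_trans (tp X1' _ _ a3).
    by apply: rt_step; apply: et_tau; apply: nt_glbcomR K1 K3 _; rewrite dist_sym.
  + apply: (fromM X1'); auto => Z1 Z2 e _; inversion e; subst; auto.
  + by apply: (fromO X1'); auto.
- inversion K as [| |X1 M' X2 O' K1 K2 no| |]; subst.
  have [N' [N1 [N2 [a1 a2 a3]]] h4] := bisimilar_etrans hb (et_sigma K1).
  have noM : no_ntau M by move=> Z hZ; exact: no (nt_parL O hZ).
  have [M1 b1 b2] := bisimilar_taus (bisimilar_sym hb) a1.
  rewrite (taus_no_ntau noM b1) in b2.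
  inversion a2 as [|Z1 Z2 K3| | | | |]; subst.
  have no1 := par_no_ntau (bisimilar_sym b2) (ntick_no_ntau K3) no.
  apply: fin; exists N', M', O'; split=> //.
  exists (NPar N1 O), (NPar N2 O'); split; [exact: tp a1| |exact: tp a3].
  by apply: et_sigma; exact: nk_par.
- inversion K as [| | | | | | | | |l' X1 X1' X2 K'|l' X1 X1' X2 K'|]; subst.
  + apply: (fromM X1'); auto => Z1 Z2 e _; inversion e; subst; auto.
  + by apply: (fromO X1'); auto.
- inversion K as [| | | | | | | | |l' X1 X1' X2 K'|l' X1 X1' X2 K'|]; subst.
  + apply: (fromM X1'); eauto => Z1 Z2 e _; inversion e; subst; eauto.
  + by apply: (fromO X1'); eauto.
- inversion K as [| | | | | | | | |l' X1 X1' X2 K'|l' X1 X1' X2 K'|]; subst.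
  + apply: (fromM X1'); eauto => Z1 Z2 e _; inversion e; subst; eauto.
  + by apply: (fromO X1'); eauto.
- have [N' [N1 [N2 [a1 a2 a3]]] h4] := bisimilar_etrans hb (et_sens h M hv).
  apply: fin; exists N', (sens_update s h v M), (sens_update s h v O); split=> //.
  inversion a2; subst; exists (NPar N1 O), (sens_update s h v (NPar N1 O)); split; auto.
  by apply: tp.
- case/barb_par: (hbarb) => // hb'.
    apply: (fromM M); auto => Z1 Z2 e hn; inversion e; subst.
    by apply: et_barb; apply/barb_par => //; left.
  by apply: (fromO O) => //; apply: et_barb; apply/barb_par => //; right.
Qed.

Lemma bisimilar_par M N O : bisimilar M N -> network (NPar M O) -> network (NPar N O) ->
  bisimilar (NPar M O) (NPar N O).
Proof.
by move=> h h1 h2; exists par_rel; [exact: par_rel_bisimulation|exists M, N, O].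
Qed.

Definition res_rel X Y := exists c M N, [/\ X = NRes c M, Y = NRes c N & bisimilar M N].

Lemma res_rel_bisimulation : bisimulation res_rel.
Proof.
split=> [X Y [c [M [N [-> -> /bisimilar_networks]]]]|X Y [c [M [N [-> -> hb]]]]
  |X Y l X' [c [M [N [-> -> hb]]]] H] //.
  by exists c, N, M; split=> //; exact: bisimilar_sym.
have [hM hN] := bisimilar_networks hb.
have from M' : etrans l M M' -> X' = NRes c M' ->
    (forall X1 X2, etrans l X1 X2 -> network X1 -> etrans l (NRes c X1) (NRes c X2)) ->
    exists2 N', wtrans_hat l (NRes c N) N' & res_rel X' N'.
  move=> h1 h2 hres; have [N' h3 h4] := bisimilar_etrans hb h1.
  exists (NRes c N'); last by exists c, M', N'.
  have tp X1 X2 : taus X1 X2 -> taus (NRes c X1) (NRes c X2).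
    by apply: (@taus_map (NRes c)) => *; exact: nt_res.
  have gen : wtrans l N N' -> wtrans l (NRes c N) (NRes c N').
    move=> [N1 [N2 [a1 a2 a3]]]; exists (NRes c N1), (NRes c N2); split; auto.
    by apply: hres => //; exact: network_taus a1 hN.
  exact: wtrans_hat_map (tp _ _) gen h3.
inversion H as [X0 X0' K|X0 X0' K|a X0 X0' K|d v h k X0 X0' K hd|d v h k X0 X0' K hd
  |s v h X0 hv|a v h X0 hbarb]; subst.
1,3,4,5: inversion K as [| | | | | | | | | | |l' c' X1 X1' K' hl]; subst.
(* The side condition on the label has been established by the move of [NRes c M] and serves the
   answer as well. *)
1-4: apply: (from X1'); eauto => Z1 Z2 e _; inversion e; subst; eauto.
- inversion K as [| | | |c' X1 X1' K']; subst.
  by apply: (from X1'); eauto => Z1 Z2 e _; inversion e; subst; eauto.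
- apply: (from (sens_update s h v M)); auto => Z1 Z2 e _; inversion e; subst.
  exact: (et_sens h (NRes c Z1)).
- apply: (from M) => //; first by apply: et_barb; apply/(barb_res a v h c hM).
  move=> Z1 Z2 e hn; inversion e; subst; apply: et_barb; exact/barb_res.
Qed.

Lemma bisimilar_res c M N : bisimilar M N -> bisimilar (NRes c M) (NRes c N).
Proof. by move=> h; exists res_rel; [exact: res_rel_bisimulation|exists c, M, N]. Qed.

End Bisimilarity.

(** * Sensor updates *)

Section InternalSize.

Variable S : cait.
Implicit Types (P Q R : proc S) (M N : net S).

(* Number of prefixes that can be consumed before the next tick; recursion does
   not count because it is time-guarded. *)
Fixpoint psize P : nat :=
  match P with
  | PNil | PVar _ => 0
  | PPref (ISigma) _ => 0
  | PPref _ P => (psize P).+1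
  | PPar P Q | PCond _ P Q => psize P + psize Q
  | PTout _ P _ => (psize P).+1
  | PFix P => psize P
  end.

Lemma psize_pmapE f k P : psize (pmapE f k P) = psize P.
Proof.
elim: P k => //= [r P IH|P IH Q IH'|p P IH Q IH'|b P IH Q IH'] k; rewrite ?IH ?IH' //.
by case: r => //= *; rewrite IH.
Qed.

(** A guarded variable occurs only behind a delay or in the second branch of a timeout, where
    [psize] does not look. *)
Lemma psize_psubst k R P : tguarded k P -> psize (psubst k R P) = psize P.
Proof.
elim: P k R => //= [r P IH|P IH Q IH'|p P IH Q IH'|b P IH Q IH'|X|P IH] k R.
- by case: r => //= *; rewrite IH.
- by case/andP => *; rewrite IH ?IH'.
- by move=> *; rewrite IH.
- by case/andP => *; rewrite IH ?IH'.
- by case: eqP.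
- by move=> *; rewrite IH.
Qed.

Lemma psize_ptrans l P P' : ptrans l P P' -> proc_ok P -> psize P' < psize P.
Proof.
elim=> {l P P'} /=; try by move=> *; rewrite ?psize_pmapE.
- by move=> c v P P' Q Q' _ IH1 _ IH2 _ /andP [/IH1 h1 /IH2 h2]; lia.
- by move=> c v P P' Q Q' _ IH1 _ IH2 _ /andP [/IH2 h1 /IH1 h2]; lia.
- by move=> l P P' Q _ IH /andP [/IH h _]; lia.
- by move=> l P P' Q _ IH /andP [_ /IH h]; lia.
- move=> l P Q _ IH h; have := IH (proc_ok_unfold h); rewrite psize_psubst //.
  by case/andP: h.
- by move=> l b P Q P' _ _ IH /andP [/IH h _]; lia.
- by move=> l b P Q P' _ _ IH /andP [_ /IH h]; lia.
Qed.

Definition nsize M : nat := sumn (map (fun x => psize (nproc x)) (nodes M)).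

Lemma nsize_par M N : nsize (NPar M N) = nsize M + nsize N.
Proof. by rewrite /nsize /= map_cat sumn_cat. Qed.

Lemma nsize_ntrans l M M' : ntrans l M M' -> all_ok M -> nsize M' < nsize M.
Proof.
elim=> {l M M'}.
1-7: by move=> *; match goal with H : ptrans _ _ _, K : all_ok _ |- _ =>
  move/all_ok_node/node_okE: K => [/pwf_ok K _]; rewrite /nsize /= !addn0;
  exact: psize_ptrans H K end.
- by move=> c v k h M M' N N' _ IH1 _ IH2 _ /all_ok_par [/IH1 h1 /IH2 h2]; rewrite !nsize_par; lia.
- by move=> c v k h M M' N N' _ IH1 _ IH2 _ /all_ok_par [/IH2 h1 /IH1 h2]; rewrite !nsize_par; lia.
- by move=> l M M' N _ IH /all_ok_par [/IH h _]; rewrite !nsize_par; lia.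
- by move=> l M M' N _ IH /all_ok_par [_ /IH h]; rewrite !nsize_par; lia.
- by [].
Qed.

Lemma nsize_sens_update s h v M : nsize (sens_update s h v M) = nsize M.
Proof.
elim: M => //= [x|M IH N IH'].
  by rewrite /nsize; case: ifP.
by rewrite !nsize_par IH IH'.
Qed.

Lemma sens_update_idem s h v w M :
  sens_update s h v (sens_update s h w M) = sens_update s h v M.
Proof.
elim: M => //= [x|M -> N ->|c M ->] //.
case E : ((nloc x == h) && isens (niface x) s); rewrite /= ?E // eqxx andbT.
case/andP: E => -> _; congr (NNode (MkNode _ _ _ _ _)); rewrite /upd_sens; congr Iface.
by apply: functional_extensionality => t /=; case: eqP.
Qed.

(** A move reads at most one sensor. If it reads [s], then [w] is the value read, which lies in the
    domain of [s] by well-formedness. Communications read nothing: their premises have labels other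
    than tau, which excludes the second alternative. *)
Lemma ntrans_sens_update s h l M M' : ntrans l M M' -> all_ok M ->
  (forall w, ntrans l (sens_update s h w M) (sens_update s h w M')) \/
  l = NLTau S /\
  exists2 w, sdom s w & ntrans (NLTau S) (sens_update s h w M) (sens_update s h w M').
Proof.
elim=> {l M M'}.
- by move=> n I P P' mu k hp _; left=> w /=; case: ifP => _; exact: nt_pos.
- move=> n I t v P P' mu k hv hp /all_ok_node /node_okE [_ [_ hs]].
  have [E|nts] := eqVneq t s.
    subst t; right; split=> //; exists v; first exact: (hs s v hv).
    by move=> /=; case: ifP => _; apply: nt_sensread hp => //=; rewrite eqxx.
  by left=> w /=; case: ifP => _; apply: nt_sensread hp => //=; rewrite (negbTE nts).
- by move=> n I a v P P' mu k hv hp _; left=> w /=; case: ifP => _; exact: nt_actunchg hp.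
- by move=> n I a v P P' mu k hv hp _; left=> w /=; case: ifP => _; exact: nt_actchg hp.
- by move=> n I P P' mu k hp _; left=> w /=; case: ifP => _; exact: nt_loccom.
- by move=> n I c v P P' mu k hp hr _; left=> w /=; case: ifP => _; exact: nt_out.
- by move=> n I c v P P' mu k hp hr _; left=> w /=; case: ifP => _; exact: nt_in.
- move=> c v k j M M' N N' _ IH1 _ IH2 hd /all_ok_par [/IH1 [h1|[] //] /IH2 [h2|[] //]].
  by left=> w /=; exact: nt_glbcomL (h1 w) (h2 w) hd.
- move=> c v k j M M' N N' _ IH1 _ IH2 hd /all_ok_par [/IH2 [h1|[] //] /IH1 [h2|[] //]].
  by left=> w /=; exact: nt_glbcomR (h2 w) (h1 w) hd.
- move=> l M M' N _ IH /all_ok_par [/IH [h1|[-> [w hw h1]]] _].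
    by left=> w /=; exact: nt_parL.
  by right; split=> //; exists w => //=; exact: nt_parL.
- move=> l M M' N _ IH /all_ok_par [_ /IH [h1|[-> [w hw h1]]]].
    by left=> w /=; exact: nt_parR.
  by right; split=> //; exists w => //=; exact: nt_parR.
- move=> l c M M' _ IH hl /IH [h1|[-> [w hw h1]]].
    by left=> w /=; exact: nt_res.
  by right; split=> //; exists w => //=; exact: nt_res.
Qed.

End InternalSize.

(** * Closure of bisimilarity under sensor updates *)

Section SensorUpdate.

Variables (S : cait) (s : sensor S) (h : loc S) (v : val S).
Hypothesis sdom_v : sdom s v.
Implicit Types (M N X Y : net S).

Local Notation upd M := (sens_update s h v M).

Definition env_steps : net S -> net S -> Prop :=
  clos_refl_trans _ (fun X Y =>
    etrans (ETau S) X Y \/ exists2 w, sdom s w & Y = sens_update s h w X).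

(** The last update writes [v] over all values set earlier, so that a path without internal moves
    ends exactly in [upd X]. *)
Definition env_upd X Y := exists2 X1, env_steps X X1 & taus (upd X1) Y.

Lemma taus_env_steps X Y : taus X Y -> env_steps X Y.
Proof.
elim=> [M N hs|M|M N O _ h1 _ h2]; [by apply: rt_step; left|exact: rt_refl|].
exact: rt_trans h1 h2.
Qed.

Lemma network_env_steps X Y : env_steps X Y -> network X -> network Y.
Proof.
elim=> [M N [/network_etrans //|[w hw ->]]|M|M N O _ h1 _ h2] //.
  exact: network_sens_update.
by move=> hM; exact/h2/h1.
Qed.

Lemma taus_size X Y : taus X Y -> network X -> nsize Y < nsize X \/ Y = X.
Proof.
elim=> [M N hs hM|M|M N O hMN h1 hNO h2 hM].
- left; inversion hs as [X0 Y0 K| | | | | |]; subst; exact: nsize_ntrans K (network_all_ok hM).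
- by right.
- have hN := network_taus hMN hM.
  by case: (h1 hM) => [?|<-]; case: (h2 hN) => [?|->]; try (by left; lia); try (by left); right.
Qed.

(** Without internal moves only updates of [s] at [h] have taken place, and [upd] overwrites their
    effect. *)
Lemma env_steps_size X Y : env_steps X Y -> network X ->
  nsize Y < nsize X \/ nsize Y = nsize X /\ upd Y = upd X.
Proof.
elim=> [M N [hs|[w hw ->]] hM|M|M N O hMN h1 hNO h2 hM].
- left; inversion hs as [X0 Y0 K| | | | | |]; subst; exact: nsize_ntrans K (network_all_ok hM).
- by right; rewrite nsize_sens_update sens_update_idem.
- by right.
- have hN := network_env_steps hMN hM.
  case: (h1 hM) => [?|[e1 e2]]; case: (h2 hN) => [?|[e3 e4]]; try by left; lia.
  by right; rewrite e3 e4.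
Qed.

Lemma env_upd_size X Y : env_upd X Y -> network X -> nsize Y < nsize X \/ Y = upd X.
Proof.
move=> [X1 h1 h2] hX; have hX1 := network_sens_update h sdom_v (network_env_steps h1 hX).
have := taus_size h2 hX1; rewrite nsize_sens_update.
case: (env_steps_size h1 hX) => [l1|[e1 e2]] [l2|e3].
- by left; lia.
- by left; rewrite e3 nsize_sens_update.
- by left; lia.
- by right; rewrite e3.
Qed.

Lemma bisimilar_env_steps X Y X' : bisimilar X Y -> env_steps X X' ->
  exists2 Y', env_steps Y Y' & bisimilar X' Y'.
Proof.
move=> hb H; elim: H Y hb => [M N [hs|[w hw ->]] Y hb|M Y hb|M N O _ h1 _ h2 Y hb].
- have [Y' a b] := bisimilar_etrans hb hs; exists Y' => //; exact: taus_env_steps.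
- have [Y' [Y1 [Y2 [a1 a2 a3]]] b] := bisimilar_etrans hb (et_sens h M hw).
  exists Y' => //; apply: rt_trans (taus_env_steps a1) _.
  apply: rt_trans (taus_env_steps a3); apply: rt_step; right; exists w => //.
  by inversion a2.
- by exists Y => //; exact: rt_refl.
- have [Y1 a1 b1] := h1 _ hb; have [Y2 a2 b2] := h2 _ b1; exists Y2 => //.
  exact: rt_trans a1 a2.
Qed.

Lemma bisimilar_env_upd X Y X' : bisimilar X Y -> env_upd X X' ->
  exists2 Y', env_upd Y Y' & bisimilar X' Y'.
Proof.
move=> hb [X1 h1 h2]; have [Y1 a1 b1] := bisimilar_env_steps hb h1.
have [Y4 [Y2 [Y3 [c1 c2 c3]]] b2] := bisimilar_etrans b1 (et_sens h X1 sdom_v).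
have [Y5 d1 d2] := bisimilar_taus b2 h2; exists Y5 => //; exists Y2.
  exact: rt_trans a1 (taus_env_steps c1).
by inversion c2; subst; exact: taus_trans c3 d1.
Qed.

(* Internal moves terminate, so a path [A ~> B ~> A] up to bisimilarity can only be
   followed forever without internal moves, i.e. by updates alone. *)
Lemma env_upd_cycle n X A B A' B' : nsize X < n -> bisimilar X A ->
  env_upd A B' -> bisimilar B' B -> env_upd B A' -> bisimilar A' A -> bisimilar A B.
Proof.
elim: n X => // n IH X hn hX hAB hB hBA hA.
(* The cycle is replayed from [X], any network bisimilar to [A]: it reaches some [X1] bisimilar to
   [B], then some [X2] bisimilar to [A]. If a half of the replay has internal moves, [X2] is smaller
   and takes the place of [X]. *)
have [X1 a1 b1] := bisimilar_env_upd (bisimilar_sym hX) hAB.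
have hX1 : bisimilar B X1 := bisimilar_trans (bisimilar_sym hB) b1.
have [X2 a2 b2] := bisimilar_env_upd hX1 hBA.
have hX2 : bisimilar X2 A := bisimilar_trans (bisimilar_sym b2) hA.
have [nX _] := bisimilar_networks hX; have [_ nX1] := bisimilar_networks hX1.
case: (env_upd_size a1 nX) (env_upd_size a2 nX1) => [l1|e1] [l2|e2].
- by apply: (IH X2) => //; lia.
- by apply: (IH X2) => //; rewrite e2 nsize_sens_update; lia.
- by apply: (IH X2) => //; rewrite e1 nsize_sens_update in l2; lia.
(* Here [X1] is [upd X] and [X2] is [upd X1]; by idempotence they coincide, and this one network is
   bisimilar to both [A] and [B]. *)
- rewrite e2 e1 sens_update_idem -e1 in hX2.
  exact: bisimilar_trans (bisimilar_sym hX2) (bisimilar_sym hX1).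
Qed.

(* A move of [M] that reads [s] is available from [upd M] once the environment has
   restored the value that it reads. *)
Lemma taus_upd M N : taus M N -> network M -> env_steps (upd M) (upd N).
Proof.
elim=> [X Y hs hX|X _|X Y Z hXY h1 hYZ h2 hX]; first last.
- by apply: rt_trans (h1 hX) (h2 _); exact: network_taus hXY hX.
- exact: rt_refl.
inversion hs as [X0 Y0 K| | | | | |]; subst.
case: (ntrans_sens_update s h K (network_all_ok hX)) => [H|[_ [w hw H]]].
  by apply: rt_step; left; exact: et_tau.
apply: (@rt_trans _ _ _ (sens_update s h w X)).
  by apply: rt_step; right; exists w => //; rewrite sens_update_idem.
apply: (@rt_trans _ _ _ (sens_update s h w Y)); first by apply: rt_step; left; exact: et_tau.
(* The value [v] is written back after the move. *)
by apply: rt_step; right; exists v => //; rewrite sens_update_idem.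
Qed.

Lemma bisimilar_sens_update M N : bisimilar M N -> bisimilar (upd M) (upd N).
Proof.
(* [M0] answers the update of [N0] by internal moves to some [M1], the update, and further internal
   moves. Replaying this from [upd M0] leads to [upd M1], where updating once more changes
   nothing. *)
have half M0 N0 : bisimilar M0 N0 -> exists2 M', env_upd (upd M0) M' & bisimilar M' (upd N0).
  move=> hb; have [hM hN] := bisimilar_networks hb.
  have [M' [M1 [M2 [a1 a2 a3]]] b] := bisimilar_etrans (bisimilar_sym hb) (et_sens h N0 sdom_v).
  exists M'; last exact: bisimilar_sym.
  exists (upd M1); first exact: taus_upd.
  by rewrite sens_update_idem; inversion a2; subst.
move=> hb; have [hM hN] := bisimilar_networks hb.
have [B' h1 h2] := half _ _ hb; have [A' h3 h4] := half _ _ (bisimilar_sym hb).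
(* The cycle joins [upd M] and [upd N]; its first replay starts from [upd M] itself. *)
apply: (@env_upd_cycle _ (upd M)) (ltnSn _) _ h1 h2 h3 h4.
exact/scong_bisimilar/scong_refl/network_sens_update.
Qed.

End SensorUpdate.

(** * Bisimilarity is a barbed congruence *)

Section Soundness.

Variable S : cait.
Implicit Types (M N X : net S).

Lemma taus_reduces M N : taus M N -> network M -> reduces_star M N.
Proof.
elim=> [X Y hs hX|X _|X Y Z hXY h1 hYZ h2 hX].
- by apply: rt_step; left; inversion hs; subst; exact: (@ntrans_red S (RTau S)).
- exact: rt_refl.
- by apply: rt_trans (h1 hX) (h2 _); exact: network_taus hXY hX.
Qed.

(** The label [EBarb] leaves the network unchanged, so the weak answer passes through a network with
    the barb; its final internal moves are dropped. *)
Lemma bisimilar_barb_preserving : barb_preserving (@bisimilar S).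
Proof.
move=> M N a v h hb hM; have [_ hN] := bisimilar_networks hb.
have [N' [N1 [N2 [a1 a2 a3]]] b] := bisimilar_etrans hb (et_barb hM).
exists N1; first exact: taus_reduces.
by inversion a2.
Qed.

(** A reduction is a transition up to [scong], which bisimilarity absorbs by transitivity. The
    answer is turned back into reductions step by step, each from a network. *)
Lemma bisimilar_reduction_closed : reduction_closed (@bisimilar S).
Proof.
move=> M N hb; have [hM hN] := bisimilar_networks hb.
have close X M' N' : scong X M' -> bisimilar X N' -> bisimilar M' N'.
  by move=> h1 h2; exact: bisimilar_trans (bisimilar_sym (scong_bisimilar h1)) h2.
split=> [M' [hr|hr]|a M' hr].
- have [X h1 h2] := red_ntrans hr hM; have [N' a b] := bisimilar_etrans hb (et_tau h1).
  by exists N'; [exact: taus_reduces|exact: close h2 b].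
- have [X h1 h2] := redsigma_ntick hr hM.
  have [N' [N1 [N2 [a1 a2 a3]]] b] := bisimilar_etrans hb (et_sigma h1).
  exists N'; last exact: close h2 b.
  have hN1 := network_taus a1 hN; have hN2 := network_etrans a2 hN1.
  apply: rt_trans (taus_reduces a1 hN) _; apply: rt_trans (taus_reduces a3 hN2).
  by apply: rt_step; right; inversion a2; subst; exact: ntick_redsigma.
- have [X h1 h2] := red_ntrans hr hM.
  have [N' [N1 [N2 [a1 a2 a3]]] b] := bisimilar_etrans hb (et_act h1).
  have hN1 := network_taus a1 hN; have hN2 := network_etrans a2 hN1.
  exists N1, N2, N'; split; [exact: taus_reduces| |exact: taus_reduces|exact: close h2 b].
  by inversion a2; subst; exact: (@ntrans_red S (RAct a)).
Qed.

Lemma bisimilar_contextual : contextual (@bisimilar S).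
Proof.
move=> M N hb; split=> [O|c|s h v hv].
- exact: bisimilar_par.
- exact: bisimilar_res.
- exact: bisimilar_sens_update.
Qed.

End Soundness.

Theorem theorem4 (S : cait) (M N : net S) (hM : network M) (hN : network N)
  (hbis : bisimilar M N) : barbed_congruent M N.
Proof.
exists (@bisimilar S); split=> //.
- by split; [exact: bisimilar_networks|exact: bisimilar_sym].
- exact: bisimilar_reduction_closed.
- exact: bisimilar_barb_preserving.
- exact: bisimilar_contextual.
Qed.
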